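(* Let $B$ be a nonzero Banach space, $\mathcal B\subset L(B)$ a semisimple commutative Banach subalgebra of the algebra $L(B)$ of continuous linear operators on $B$ containing the identity operator $\mathbf 1$, $X$ the maximal ideal space of $\mathcal B$, and $\delta$ an endomorphism of $\mathcal B$ with $\delta(\mathbf 1)=\mathbf 1$. Let $\mathcal C$ be a functional base algebra on $X$ containing $\operatorname{Re}\varphi$ for all $\varphi\in\mathcal B$ and such that $(\mathcal C,\delta)$ is a $C^*$-dynamical system, and let $A:\mathcal C\to\mathcal C$ be a transfer operator for $(\mathcal C,\delta)$. Let $1\le p<\infty$, $T\in L(B)$, $\psi\in\mathcal B$, and suppose that $$\|(\psi T)^n\|_{L(B)}=\bigl\|(A|\psi|^p)^n\mathbf 1\bigr\|_{\mathcal C}^{1/p}\qquad\text{for all }n\in\mathbb N$$ (in particular, $\psi T$ can be an abstract weighted shift operator). Then the spectral radius of $\psi T$ satisfies $$\ln r(\psi T)=\max_{\mu\in M_\delta(\mathcal C)}\left(\int_X\ln|\psi|\,d\mu+\frac{\tau(\mu)}{p}\right).$$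
   Context: Elements $\varphi\in\mathcal B$ are identified with their Gelfand transforms, functions on $X$. The endomorphism $\delta$ has the form $[\delta\varphi](x)=\varphi(\alpha(x))$ for a continuous $\alpha:X\to X$, and $\delta$ acts on functions on $X$ by $\delta f=f\circ\alpha$. A base algebra is the selfadjoint part of a commutative $C^*$-algebra with identity; a functional base algebra on $X$ is a base algebra consisting of bounded real-valued functions on $X$ with the uniform norm (so it is a uniformly closed real algebra containing constants). That $(\mathcal C,\delta)$ is a $C^*$-dynamical system means that $\delta$ is an endomorphism of $\mathcal C$ with $\delta(\mathbf 1)=\mathbf 1$. Then $|\varphi|^p\in\mathcal C$ for $\varphi\in\mathcal B$. A linear operator $A:\mathcal C\to\mathcal C$ is a transfer operator for $(\mathcal C,\delta)$ if it is positive and $A((\delta f)g)=fAg$ for all $f,g\in\mathcal C$. $A|\psi|^p$ denotes the operator $f\mapsto A(|\psi|^pf)$ on $\mathcal C$. An operator $T\in L(B)$ is an abstract shift operator (associated with $\delta$ and $A$), and $\psi T$, $\psi\in\mathcal B$, is an abstract weighted shift operator (in a space of $L^p$ type), if (a) $T\varphi=\delta(\varphi)T$ for all $\varphi\in\mathcal B$, and (b) $\|(\varphi T)^n\|_{L(B)}=\|(A|\varphi|^p)^n\mathbf 1\|_{\mathcal C}^{1/p}$ for all $\varphi\in\mathcal B$ and $n\in\mathbb N$. $r(\psi T)=\lim_n\|(\psi T)^n\|^{1/n}$ and $\ln0=-\infty$. $M(\mathcal C)$ is the set of positive linear functionals $\mu$ on $\mathcal C$ with $\mu(\mathbf 1)=1$;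 $M_\delta(\mathcal C)$ is the set of $\mu\in M(\mathcal C)$ with $\mu(\delta f)=\mu(f)$ for all $f\in\mathcal C$. The integral $\int_X\ln|\psi|\,d\mu\in[-\infty,\infty)$ is the integral of $\ln$ of the function $|\psi|\in\mathcal C$ with respect to the regular Borel probability measure representing $\mu$ under the Gelfand identification of $\mathcal C$ with the continuous real functions on its maximal ideal space (when $\mathcal C=C(X)$ this is literally an integral over $X$). A partition of unity in $\mathcal C$ is a finite set $D=\{g_1,\dots,g_k\}$ of nonnegative elements with $g_1+\dots+g_k=\mathbf 1$. For $\mu\in M_\delta(\mathcal C)$ the $t$-entropy is $$\tau(\mu):=\inf_{n\in\mathbb N}\frac{\tau_n(\mu)}{n},\qquad \tau_n(\mu):=\inf_D\tau_n(\mu,D),\qquad \tau_n(\mu,D):=\sup_{m\in M(\mathcal C)}\sum_{g\in D}\mu(g)\ln\frac{m(A^ng)}{\mu(g)},$$ the infimum being over all partitions of unity $D$ in $\mathcal C$; a summand with $\mu(g)=0$ is set to be zero regardless of $m(A^ng)$; and if for some $g\in D$ one has $A^ng=0$ and $\mu(g)>0$, then $\tau(\mu)=-\infty$ (consistently with $\ln0=-\infty$). *)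

(* Defs.v *)
From HB Require Import structures.
From mathcomp Require Import all_boot all_order all_algebra finmap.
From mathcomp Require Import complex.
From mathcomp Require Import all_classical all_reals all_analysis.

Set Implicit Arguments.
Unset Strict Implicit.
Unset Printing Implicit Defensive.

Import Order.TTheory GRing.Theory Num.Theory.
Import numFieldNormedType.Exports.

Local Open Scope classical_set_scope.
Local Open Scope ring_scope.

(* Elements of L(B) are plain functions B -> B satisfying bounded_op. Maps
   defined on a subset (the algebras below) are total functions whose axioms
   only concern arguments in the subset. *)
Section Operators.
Variables (R : realType) (B : completeNormedModType R[i]).

(* The norm of a normed module over R[i] is R[i]-valued, with real values. *)
Definition rnorm (v : B) : R := complex.Re `|v|.

Definition bounded_op (T : B -> B) : Prop := linear T /\ continuous T.

Definition opnorm (T : B -> B) : R :=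
  sup [set rnorm (T v) | v in [set v | rnorm v <= 1]].

Definition spectral_radius (T : B -> B) : R :=
  limn (fun n : nat => opnorm (iter n T) `^ n%:R^-1).

Record banach_subalgebra (BB : set (B -> B)) : Prop := BanachSubalgebra {
  bsub_op : forall phi, BB phi -> bounded_op phi;
  bsub_id : BB idfun;
  bsub_add : forall phi psi, BB phi -> BB psi -> BB (phi \+ psi);
  bsub_scale : forall (c : R[i]) phi, BB phi -> BB (c \*: phi);
  bsub_comp : forall phi psi, BB phi -> BB psi -> BB (phi \o psi);
  bsub_closed : forall T, bounded_op T ->
    (forall e : R, 0 < e -> exists2 phi, BB phi & opnorm (T \- phi) < e) ->
    BB T
}.

Definition commutative_subalgebra (BB : set (B -> B)) : Prop :=
  forall phi psi, BB phi -> BB psi -> phi \o psi = psi \o phi.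

(* Left multiplication suffices: these are ideals of commutative algebras. *)
Record ideal (BB J : set (B -> B)) : Prop := Ideal {
  ideal_sub : J `<=` BB;
  ideal_zero : J (fun=> 0);
  ideal_add : forall phi psi, J phi -> J psi -> J (phi \+ psi);
  ideal_scale : forall (c : R[i]) phi, J phi -> J (c \*: phi);
  ideal_mul : forall phi psi, BB phi -> J psi -> J (phi \o psi)
}.

Definition maximal_ideal (BB J : set (B -> B)) : Prop :=
  [/\ ideal BB J, J <> BB &
      forall K, ideal BB K -> J `<=` K -> K <> BB -> K = J].

Definition semisimple (BB : set (B -> B)) : Prop :=
  forall phi, BB phi -> (forall J, maximal_ideal BB J -> J phi) ->
  phi = (fun=> 0).

Record endomorphism (BB : set (B -> B)) (delta : (B -> B) -> (B -> B)) :
    Prop := Endomorphism {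
  endo_sub : forall phi, BB phi -> BB (delta phi);
  endo_add : forall phi psi, BB phi -> BB psi ->
    delta (phi \+ psi) = delta phi \+ delta psi;
  endo_scale : forall (c : R[i]) phi, BB phi ->
    delta (c \*: phi) = c \*: delta phi;
  endo_comp : forall phi psi, BB phi -> BB psi ->
    delta (phi \o psi) = delta phi \o delta psi
}.

(* The maximal ideal space is realized as the space of unital complex
   characters of BB with the topology of pointwise convergence. A character is
   extended by 0 outside BB, so that two characters agreeing on BB are equal. *)
Record character (BB : set (B -> B)) (x : (B -> B) -> R[i]) : Prop :=
    Character {
  char_one : x idfun = 1;
  char_add : forall phi psi, BB phi -> BB psi ->
    x (phi \+ psi) = x phi + x psi;
  char_scale : forall (c : R[i]) phi, BB phi -> x (c \*: phi) = c * x phi;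
  char_comp : forall phi psi, BB phi -> BB psi ->
    x (phi \o psi) = x phi * x psi;
  char_out : forall phi, ~ BB phi -> x phi = 0
}.

Definition characters (BB : set (B -> B)) : set {ptws (B -> B) -> R[i]^o} :=
  [set x | character BB x].

Definition max_space (BB : set (B -> B)) : topologicalType :=
  set_type (characters BB).

Definition gelfand (BB : set (B -> B)) (phi : B -> B) (x : max_space BB) :
  R[i] := set_val x phi.

(* |phi| as a real function on the maximal ideal space *)
Definition gelfand_abs (BB : set (B -> B)) (phi : B -> B) :
  max_space BB -> R := fun x => complex.Re `|gelfand phi x|.

Definition char_pullback (BB : set (B -> B)) (delta : (B -> B) -> (B -> B))
    (x : {ptws (B -> B) -> R[i]^o}) : {ptws (B -> B) -> R[i]^o} :=
  fun phi => if `[< BB phi >] then x (delta phi) else 0.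

Section Alpha.
Variables (BB : set (B -> B)) (delta : (B -> B) -> (B -> B)).
Hypotheses (hBB : banach_subalgebra BB) (hdelta : endomorphism BB delta).
Hypothesis delta1 : delta idfun = idfun.

Lemma char_pullback_subproof (x : max_space BB) :
  char_pullback BB delta (set_val x) \in characters BB.
Proof.
case: x => /= x xP; have [x1 xD xZ xM x0] := set_mem xP; apply/mem_set.
have E phi : BB phi -> char_pullback BB delta x phi = x (delta phi).
  by move=> h; rewrite /char_pullback asboolT.
split.
- by rewrite E ?delta1//; exact: bsub_id.
- move=> phi psi hphi hpsi; rewrite !E//; last exact: bsub_add.
  by rewrite (endo_add hdelta)// xD//; exact: (endo_sub hdelta).
- move=> c phi hphi; rewrite !E//; last exact: bsub_scale.
  by rewrite (endo_scale hdelta)// xZ//; exact: (endo_sub hdelta).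
- move=> phi psi hphi hpsi; rewrite !E//; last exact: bsub_comp.
  by rewrite (endo_comp hdelta)// xM//; exact: (endo_sub hdelta).
- by move=> phi h; rewrite /char_pullback asboolF.
Qed.

Definition alpha (x : max_space BB) : max_space BB :=
  exist (fun y => y \in characters BB) _ (char_pullback_subproof x).

Lemma alphaE phi x : BB phi -> gelfand (delta phi) x = gelfand phi (alpha x).
Proof.
by move=> h; rewrite /gelfand !set_valE /= /char_pullback asboolT.
Qed.

End Alpha.
End Operators.

Section BaseAlgebra.
Variables (R : realType) (X : Type).

Definition supnorm (f : X -> R) : R := sup [set `|f x| | x in [set: X]].

Record functional_base_algebra (C : set (X -> R)) : Prop := BaseAlgebra {
  base_bounded : forall f, C f -> exists M : R, forall x, `|f x| <= M;
  base_cst : forall c : R, C (fun=> c);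
  base_add : forall f g, C f -> C g -> C (f \+ g);
  base_mul : forall f g, C f -> C g -> C (f \* g);
  base_closed : forall f,
    (forall e : R, 0 < e -> exists2 g, C g & forall x, `|f x - g x| <= e) ->
    C f
}.

Record linear_functional_on (C : set (X -> R)) (mu : (X -> R) -> R) : Prop :=
    LinearFunctionalOn {
  lfun_add : forall f g, C f -> C g -> mu (f \+ g) = mu f + mu g;
  lfun_scale : forall (c : R) f, C f -> mu (c \*o f) = c * mu f
}.

Definition states (C : set (X -> R)) : set ((X -> R) -> R) :=
  [set mu | [/\ linear_functional_on C mu,
                forall f, C f -> (forall x, 0 <= f x) -> 0 <= mu f &
                mu (fun=> 1) = 1]].

Definition invariant_states (C : set (X -> R)) (a : X -> X) :
  set ((X -> R) -> R) :=
  [set mu | states C mu /\ forall f, C f -> mu (f \o a) = mu f].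

Record transfer_operator (C : set (X -> R)) (a : X -> X)
    (A : (X -> R) -> (X -> R)) : Prop := TransferOperator {
  transfer_sub : forall f, C f -> C (A f);
  transfer_add : forall f g, C f -> C g -> A (f \+ g) = A f \+ A g;
  transfer_scale : forall (c : R) f, C f -> A (c \*o f) = c \*o A f;
  transfer_pos : forall f, C f -> (forall x, 0 <= f x) -> forall x, 0 <= A f x;
  transfer_id : forall f g, C f -> C g -> A ((f \o a) \* g) = f \* A g
}.

Definition partition_of_unity (C : set (X -> R)) (D : {fset (X -> R)}) : Prop :=
  [/\ forall g, g \in D -> C g,
      forall g, g \in D -> forall x, 0 <= g x &
      forall x, \sum_(g <- D) g x = 1].

Section TEntropy.
Variables (C : set (X -> R)) (A : (X -> R) -> (X -> R)) (mu : (X -> R) -> R).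
Local Open Scope ereal_scope.

(* lne 0 = -oo *)
Definition tau_term (n : nat) (m : (X -> R) -> R) (g : X -> R) : \bar R :=
  if mu g == 0%R then 0 else (mu g)%:E * lne (m (iter n A g) / mu g)%:E.

Definition tau_nD (n : nat) (D : {fset (X -> R)}) : \bar R :=
  ereal_sup [set \sum_(g <- D) tau_term n m g | m in states C].

Definition tau_n (n : nat) : \bar R :=
  ereal_inf [set tau_nD n D | D in partition_of_unity C].

Definition tau : \bar R :=
  ereal_inf [set tau_n n * (n%:R^-1)%:E | n in [set n | (0 < n)%N]].

End TEntropy.

(* The maximal ideal space of C, realized in the same way as max_space. *)
Record fun_character (C : set (X -> R)) (y : (X -> R) -> R) : Prop :=
    FunCharacter {
  fchar_one : y (fun=> 1) = 1;
  fchar_lin : linear_functional_on C y;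
  fchar_mul : forall f g, C f -> C g -> y (f \* g) = y f * y g;
  fchar_out : forall f, ~ C f -> y f = 0
}.

Definition fun_characters (C : set (X -> R)) : set {ptws (X -> R) -> R} :=
  [set y | fun_character C y].

Definition spectrum (C : set (X -> R)) : topologicalType :=
  set_type (fun_characters C).

Definition fun_gelfand (C : set (X -> R)) (f : X -> R) (y : spectrum C) : R :=
  set_val y f.

End BaseAlgebra.

(* Measurable types are pointed in the library; the base point y0 plays no
   other role. *)
Definition spectrum_at (R : realType) (X : Type) (C : set (X -> R))
  (y0 : spectrum C) : Type := spectrum C.

HB.instance Definition _ (R : realType) (X : Type) (C : set (X -> R))
  (y0 : spectrum C) := Topological.on (spectrum_at y0).
HB.instance Definition _ (R : realType) (X : Type) (C : set (X -> R))
  (y0 : spectrum C) := isPointed.Build (spectrum_at y0) y0.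

Definition borel_spectrum (R : realType) (X : Type) (C : set (X -> R))
    (y0 : spectrum C) :=
  g_sigma_algebraType (open : set (set (spectrum_at y0))).

Section Integral.
Variables (R : realType) (X : Type) (C : set (X -> R)).
Local Open Scope ereal_scope.

Definition regular_measure (y0 : spectrum C)
    (nu : probability (borel_spectrum y0) R) : Prop :=
  forall E : set (borel_spectrum y0), measurable E ->
    nu E = ereal_inf [set nu U | U in
             [set U : set (spectrum C) | open U /\ E `<=` U]] /\
    nu E = ereal_sup [set nu K | K in
             [set K : set (spectrum C) | compact K /\ K `<=` E]].

Definition represents (y0 : spectrum C)
    (nu : probability (borel_spectrum y0) R) (mu : (X -> R) -> R) : Prop :=
  forall f, C f -> \int[nu]_y (fun_gelfand f y)%:E = (mu f)%:E.

(* The integral of ln f with respect to the regular Borel probability measure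
   representing the state mu; by the Riesz representation theorem this measure
   exists and is unique, so get selects the only value. *)
Definition ln_integral (mu : (X -> R) -> R) (f : X -> R) : \bar R :=
  get [set v | exists (y0 : spectrum C)
                 (nu : probability (borel_spectrum y0) R),
       [/\ regular_measure nu, represents nu mu &
           v = \int[nu]_y lne (fun_gelfand f y)%:E]].

End Integral.

(* Main.v *)
(* Write [P f = A (v^p f)] with [v = |psi|], so that the spectral radius of
   [psi T] is [r^(1/p)] for [r = lim_n supnorm (P^n 1)^(1/n)].

   Upper bound. Take [c > r] and [n] with [supnorm (P^n 1) < c^n], and put
   [w = prod_(k < n) max (v o alpha^k) e ^ p]. For a fine partition of unity [D],
   [w] is nearly constant on the support of each [g] in [D], so [A^n g] is nearly
   a scalar multiple of [A^n (w g)]; Jensen's inequality then bounds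
   [tau_n (mu, D) / n] by [ln c - p mu (ln (max v e))].

   Attainment. The pressure [F |-> lim_n (1/n) ln supnorm ((P e^F)^n 1)] is
   convex, monotone, and unchanged by adding [g o alpha - g] to [F], so by
   Hahn-Banach it has an invariant state [mu] as subgradient at [F = 0]. For a
   partition [D], the duality for [sup_m sum_g mu g * ln (m (A^N g))] yields
   weights [c_g] with [sum_g c_g A^N g <= 1]. Then
   [F = ln (sum_g c_g g) / N - p ln (max v e)] has nonpositive pressure, and the
   subgradient inequality at [F] bounds [tau_N (mu, D) / N] from below.

   The integral of [ln v] is the infimum over [e > 0] of [mu (ln (max v e))], by
   the Riesz representation of [mu] on the spectrum and monotone convergence.
   The maximal ideal space is nonempty by Gelfand-Mazur: a minimal algebra
   seminorm on a commutative Banach algebra is multiplicative, and Ostrowski's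
   argument makes every element a scalar modulo its kernel. *)
Require Import Defs.
From HB Require Import structures.
From mathcomp Require Import all_boot all_order all_algebra finmap.
From mathcomp Require Import complex.
From mathcomp Require Import all_classical all_reals all_analysis.
From mathcomp Require Import measurable_realfun.
From mathcomp Require Import ring lra.

Set Implicit Arguments.
Unset Strict Implicit.
Unset Printing Implicit Defensive.

Import Order.TTheory GRing.Theory Num.Theory.
Import numFieldNormedType.Exports.

Local Open Scope classical_set_scope.
Local Open Scope ring_scope.

(** * Submultiplicative sequences *)

(** The weight [v] may vanish, so [ln v] need not lie in [C] and only the truncations [ln (max v e)]
    can be fed to a state. Both halves are proved with [e] in place, and [e] disappears at the end
    through an infimum. The upper bound can afford this because, for fixed [n], the error made in
    [P^n 1] tends to 0 with [e]. The lower bound is shaped by uniformity: a single [mu] has to serve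
    every [N], [D] and [e]. It is therefore fixed beforehand as a subgradient, and these data enter
    only through the test potential [F]. The factor [(max v e)^-p] in [e^F] absorbs the weight
    [v^p], which leaves the unweighted operator [A] and a Birkhoff average of [ln (sum_g c_g g)].
    The pointwise inequality [sum_g c_g A^N g <= 1] comes from first-order optimality over all
    states, tested at point evaluations. For [r = 0] the pressure at [F = 0] is [-oo] and has no
    subgradient; there the upper bound gives every invariant state the value [-oo], so any invariant
    state attains the maximum. *)

Section Submultiplicative.
Variables (R : realType) (b : nat -> R).
Hypothesis b_ge0 : forall n, 0 <= b n.
Hypothesis b_submul : forall m n, b (m + n)%N <= b m * b n.

(** Euclidean division of [n] by [q]: the full blocks cost a power of [c^q], and [M] dominates the
    finitely many remainders [b r / c^r], its summand [1] making it positive. *)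
Lemma submul_bound (c : R) (q : nat) : 0 < c -> (0 < q)%N -> b q <= c ^+ q ->
  exists2 M : R, 0 < M & forall n, b n <= M * c ^+ n.
Proof.
move=> c0 q0 bq; pose M : R := 1 + \sum_(r < q) b r / c ^+ r.
have M0 : 0 < M.
  by rewrite ltr_pwDl// sumr_ge0// => i _; rewrite divr_ge0// exprn_ge0// ltW.
exists M => // n; rewrite (divn_eq n q).
have bk k r : b (k * q + r)%N <= c ^+ (k * q) * b r.
  elim: k => [|k ih]; first by rewrite mul0n add0n expr0 mul1r.
  rewrite mulSn -addnA (le_trans (b_submul _ _))// exprD -mulrA.
  by rewrite ler_pM.
rewrite (le_trans (bk _ _))// exprD mulrCA ler_wpM2l ?exprn_ge0 ?(ltW c0)//.
have rq := ltn_pmod n q0.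
rewrite -ler_pdivrMr ?exprn_gt0// /M (bigD1 (Ordinal rq))//=.
rewrite addrCA lerDl addr_ge0// sumr_ge0// => i _.
by rewrite divr_ge0// exprn_ge0// ltW.
Qed.

(** Bernoulli's inequality for [d / c = 1 + u]: the powers grow at least linearly, hence exceed
    [M]. *)
Lemma expr_eventually_dom (M c d : R) : 0 < c -> c < d ->
  exists n0, forall n, (n0 <= n)%N -> M * c ^+ n <= d ^+ n.
Proof.
move=> c0 cd; have d0 := lt_trans c0 cd.
pose u := d / c - 1.
have u0 : 0 < u by rewrite subr_gt0 ltr_pdivlMr// mul1r.
exists (Num.truncn (M / u)).+1 => n hn.
have -> : d = (1 + u) * c by rewrite /u; field; rewrite gt_eqF.
rewrite exprMn ler_wpM2r ?exprn_ge0 ?(ltW c0)//.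
have bern k : 1 + k%:R * u <= (1 + u) ^+ k.
  elim: k => [|k ih]; first by rewrite mul0r addr0 expr0.
  have k0 : 0 <= k%:R * u * u by rewrite !mulr_ge0// ltW.
  rewrite exprS; apply: (@le_trans _ _ ((1 + u) * (1 + k%:R * u))).
    by rewrite -[k.+1%:R]natr1; lra.
  by rewrite ler_wpM2l// addr_ge0// ltW.
apply: le_trans (bern n).
have : M / u < n%:R by apply: lt_le_trans (truncnS_gt _) _; rewrite ler_nat.
rewrite ltr_pdivrMr//; lra.
Qed.

Lemma powR_rootK (x : R) n : 0 <= x -> (0 < n)%N -> (x `^ n%:R^-1) ^+ n = x.
Proof.
move=> x0 n0; rewrite -powR_mulrn ?powR_ge0// -powRrM mulVf ?powRr1//.
by rewrite pnatr_eq0 -lt0n.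
Qed.

Lemma powR_root_le (x y : R) n : 0 <= x -> 0 <= y -> (0 < n)%N ->
  (x `^ n%:R^-1 <= y) = (x <= y ^+ n).
Proof.
move=> x0 y0 n0; by rewrite -[in RHS](powR_rootK x0 n0) ler_pXn2r// nnegrE// powR_ge0.
Qed.

Lemma powR_root_ge (x y : R) n : 0 <= x -> 0 <= y -> (0 < n)%N ->
  (y <= x `^ n%:R^-1) = (y ^+ n <= x).
Proof.
move=> x0 y0 n0; by rewrite -[in RHS](powR_rootK x0 n0) ler_pXn2r// nnegrE// powR_ge0.
Qed.

(** Fekete's lemma, with [r] the infimum of the roots over [n > 0]. The two explicit bounds are what
    later arguments use; the limit only serves to identify the spectral radius. *)
Lemma submul_rate : exists2 r : R, 0 <= r &
  [/\ (fun n => b n `^ n%:R^-1) @ \oo --> r,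
      forall n, (0 < n)%N -> r ^+ n <= b n &
      forall c, r < c -> exists2 M : R, 0 < M & forall n, b n <= M * c ^+ n].
Proof.
pose S : set R := [set b n `^ n%:R^-1 | n in [set n | (0 < n)%N]].
have hS : has_inf S.
  split; first by exists (b 1 `^ 1%:R^-1), 1%N.
  by exists 0 => _ [n _ <-]; exact: powR_ge0.
pose r := inf S.
have r0 : 0 <= r by apply: lb_le_inf; [exact: hS.1|move=> _ [n _ <-]; exact: powR_ge0].
have rb n : (0 < n)%N -> r <= b n `^ n%:R^-1.
  by move=> n0; apply: ge_inf; [exact: hS.2|exists n].
have hc c : r < c -> exists2 q, (0 < q)%N & b q <= c ^+ q.
  move=> rc; have c0 := le_lt_trans r0 rc.
  have [_ [q q0 <-]] := inf_lt hS.1 rc.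
  by move=> /ltW; rewrite powR_root_le// ?(ltW c0)//; exists q.
exists r => //; split.
- apply/cvgrPdist_le => e e0.
  have [|q q0 bq] := hc (r + e / 2); first by rewrite ltrDl divr_gt0.
  have c0 : 0 < r + e / 2 by rewrite ltr_wpDl// divr_gt0.
  have [M M0 bM] := submul_bound c0 q0 bq.
  have [|n0 hn0] := @expr_eventually_dom M (r + e / 2) (r + e) c0.
    by rewrite ltrD2l; lra.
  near=> n.
  have n1 : (0 < n)%N by near: n; exists 1%N.
  have nn0 : (n0 <= n)%N by near: n; exists n0.
  rewrite distrC ger0_norm ?subr_ge0 ?rb// lerBlDl addrC powR_root_le//.
    by rewrite addrC (le_trans (bM n))// hn0.
  by rewrite addr_ge0// ltW.
- by move=> n n0; rewrite -powR_root_ge// rb.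
- move=> c rc; have [q q0 bq] := hc _ rc.
  by apply: submul_bound bq => //; exact: le_lt_trans rc.
Unshelve. all: by end_near.
Qed.

End Submultiplicative.

(** * Functional calculus, states and positive operators *)

Section FunctionAlgebra.
Variables (R : realType) (X : Type) (C : set (X -> R)).
Hypothesis hC : functional_base_algebra C.
Implicit Types f g : X -> R.

Lemma fba_cst c : C (fun=> c).
Proof. exact: base_cst hC c. Qed.

Lemma fba_add f g : C f -> C g -> C (fun x => f x + g x).
Proof. exact: base_add. Qed.

Lemma fba_mul f g : C f -> C g -> C (fun x => f x * g x).
Proof. exact: base_mul. Qed.

Lemma fba_scale c f : C f -> C (fun x => c * f x).
Proof. exact: fba_mul (fba_cst c). Qed.

Lemma fba_opp f : C f -> C (fun x => - f x).
Proof.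
move=> Cf; rewrite (_ : (fun _ => _) = (fun x => (-1) * f x)).
  exact: fba_scale.
by apply/funext => x; rewrite mulN1r.
Qed.

Lemma fba_sub f g : C f -> C g -> C (fun x => f x - g x).
Proof. by move=> Cf Cg; exact: fba_add Cf (fba_opp Cg). Qed.

Lemma fba_sum (I : eqType) (s : seq I) (F : I -> X -> R) :
  (forall i, i \in s -> C (F i)) -> C (fun x => \sum_(i <- s) F i x).
Proof.
elim: s => [|i s ih] CF.
  rewrite (_ : (fun _ => _) = (fun=> 0)); first exact: fba_cst.
  by apply/funext => x; rewrite big_nil.
rewrite (_ : (fun _ => _) = (fun x => F i x + \sum_(j <- s) F j x)).
  apply: fba_add; first by apply: CF; rewrite mem_head.
  by apply: ih => j js; apply: CF; rewrite inE js orbT.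
by apply/funext => x; rewrite big_cons.
Qed.

Lemma fba_prod (I : Type) (s : seq I) (F : I -> X -> R) :
  (forall i, C (F i)) -> C (fun x => \prod_(i <- s) F i x).
Proof.
move=> CF; elim: s => [|i s ih].
  rewrite (_ : (fun _ => _) = (fun=> 1)); first exact: fba_cst.
  by apply/funext => x; rewrite big_nil.
rewrite (_ : (fun _ => _) = (fun x => F i x * \prod_(j <- s) F j x)).
  exact: fba_mul.
by apply/funext => x; rewrite big_cons.
Qed.

Lemma fba_bound f : C f -> exists2 M : R, 0 < M & forall x, `|f x| <= M.
Proof.
move=> /(base_bounded hC)[M fM]; exists (`|M| + 1); first by rewrite ltr_wpDl.
by move=> x; rewrite (le_trans (fM x))// (le_trans (ler_norm _))// lerDl.
Qed.

(** The iterates are polynomials in [t] that approximate its square root from below on [[0, 1]];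
    polynomials in an element of [C] stay in [C]. *)
Fixpoint sqrt_iter (t : R) (n : nat) : R :=
  if n is n'.+1 then sqrt_iter t n' + (t - sqrt_iter t n' ^+ 2) / 2 else 0.

(** Each step multiplies the error by [1 - (s + q) / 2]. The last estimate yields an error of at
    most [2 / n] uniformly in [s], although convergence slows down near [s = 0]. *)
Lemma sqrt_iter_bound (s : R) n : 0 <= s <= 1 ->
  [/\ 0 <= sqrt_iter (s ^+ 2) n, sqrt_iter (s ^+ 2) n <= s &
      (s - sqrt_iter (s ^+ 2) n) * (2 + n%:R * s) <= 2 * s].
Proof.
move=> /andP[s0 s1]; elim: n => [|n [q0 qs qe]] /=.
  by split=> //; rewrite mul0r addr0 subr0 mulrC.
set q := sqrt_iter _ _ in q0 qs qe *.
have n0 : (0 : R) <= n%:R by [].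
have -> : s - (q + (s ^+ 2 - q ^+ 2) / 2) = (s - q) * (1 - (s + q) / 2) by field.
split.
- by rewrite addr_ge0// divr_ge0// subr_ge0 lerXn2r.
- rewrite -subr_ge0.
  have -> : s - (q + (s ^+ 2 - q ^+ 2) / 2) = (s - q) * (1 - (s + q) / 2) by field.
  by rewrite mulr_ge0//; lra.
- rewrite -[n.+1%:R]natr1; apply: le_trans qe; rewrite -mulrA ler_wpM2l ?subr_ge0//.
  have h1 : 0 <= n%:R * s by rewrite mulr_ge0.
  have h2 : 0 <= n%:R * s * s by rewrite mulr_ge0.
  have h3 : 0 <= n%:R * s * q by rewrite mulr_ge0.
  have h4 : 0 <= s * s by rewrite mulr_ge0.
  have h5 : 0 <= q * s by rewrite mulr_ge0.
  rewrite -subr_ge0.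
  have -> : 2 + n%:R * s - (1 - (s + q) / 2) * (2 + (n%:R + 1) * s) =
    q + (n%:R * s * s + n%:R * s * q + s * s + q * s) / 2 by field.
  by rewrite addr_ge0 ?divr_ge0 ?addr_ge0.
Qed.

Lemma fba_sqrt f : C f -> (forall x, 0 <= f x) -> C (fun x => Num.sqrt (f x)).
Proof.
move=> Cf f0; have [M M0 fM] := fba_bound Cf.
pose g x := f x / M.
have Cg : C g.
  rewrite (_ : g = (fun x => M^-1 * f x)); first exact: fba_scale.
  by apply/funext => x; rewrite /g mulrC.
have g01 x : 0 <= Num.sqrt (g x) <= 1.
  rewrite sqrtr_ge0 -[leRHS]sqrtr1 ler_wsqrtr//= ler_pdivrMr// mul1r.
  by rewrite (le_trans (ler_norm _)).
have Cq n : C (fun x => sqrt_iter (g x) n).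
  elim: n => [|n ih] /=; first exact: fba_cst.
  apply: fba_add => //; rewrite (_ : (fun _ => _) =
    (fun x => 2^-1 * (g x - sqrt_iter (g x) n * sqrt_iter (g x) n))).
    by apply: fba_scale; apply: fba_sub => //; exact: fba_mul.
  by apply/funext => x; rewrite mulrC expr2.
have Csg : C (fun x => Num.sqrt (g x)).
  apply: (base_closed hC) => e e0.
  pose n := (Num.truncn (2 / e)).+1.
  exists (fun x => sqrt_iter (g x) n) => // x.
  set s := Num.sqrt (g x).
  have sE : g x = s ^+ 2 by rewrite sqr_sqrtr// divr_ge0// ltW.
  rewrite sE; have [q0 qs qe] := sqrt_iter_bound n (g01 x).
  rewrite ger0_norm ?subr_ge0//.
  have /andP[s0 s1] := g01 x; rewrite -/s in s0 s1 q0 qs qe *.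
  have en : 2 < n%:R * e.
    by rewrite -ltr_pdivrMr// truncnS_gt.
  set d := s - _ in qe *.
  have d0 : 0 <= d by rewrite subr_ge0.
  have n0 : (0 : R) <= n%:R by [].
  have := s0; rewrite le_eqVlt => /predU1P[s00|sp].
    have : d <= s by rewrite gerBl.
    by rewrite -s00 => /le_trans; apply; exact: ltW.
  have : d * (n%:R * s) <= 2 * s by nra.
  rewrite mulrA ler_pM2r// => dn.
  rewrite leNgt; apply/negP => ed.
  have : e * n%:R < d * n%:R by rewrite ltr_pM2r// ltr0n.
  by nra.
rewrite (_ : (fun _ => _) = (fun x => Num.sqrt M * Num.sqrt (g x))).
  exact: fba_scale.
apply/funext => x; rewrite -sqrtrM ?ltW// /g; congr Num.sqrt.
by field; rewrite gt_eqF.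
Qed.

Lemma fba_norm f : C f -> C (fun x => `|f x|).
Proof.
move=> Cf; rewrite (_ : (fun _ => _) = (fun x => Num.sqrt (f x * f x))).
  apply: fba_sqrt; first exact: fba_mul.
  by move=> x; rewrite -expr2 sqr_ge0.
by apply/funext => x; rewrite -expr2 sqrtr_sqr.
Qed.

Lemma fba_max f g : C f -> C g -> C (fun x => Num.max (f x) (g x)).
Proof.
move=> Cf Cg; rewrite (_ : (fun _ => _) =
  (fun x => 2^-1 * (f x + g x + `|f x - g x|))).
  apply: fba_scale; apply: fba_add; first exact: fba_add.
  by apply: fba_norm; exact: fba_sub.
by apply/funext => x; rewrite maxr_absE mulrC.
Qed.

Lemma fba_min f g : C f -> C g -> C (fun x => Num.min (f x) (g x)).
Proof.
move=> Cf Cg; rewrite (_ : (fun _ => _) =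
  (fun x => - Num.max (- f x) (- g x))).
  by apply: fba_opp; apply: fba_max; exact: fba_opp.
by apply/funext => x; rewrite oppr_max !opprK.
Qed.

Lemma fba_bigmax (I : Type) (s : seq I) (F : I -> X -> R) f : C f ->
  (forall i, C (F i)) -> C (fun x => \big[Num.max/f x]_(i <- s) F i x).
Proof.
move=> Cf CF; elim: s => [|i s ih].
  rewrite (_ : (fun _ => _) = f)//.
  by apply/funext => x; rewrite big_nil.
rewrite (_ : (fun _ => _) =
  (fun x => Num.max (F i x) (\big[Num.max/f x]_(j <- s) F j x))).
  exact: fba_max.
by apply/funext => x; rewrite big_cons.
Qed.

(* On the range of [f], [phi] is the supremum of the functions
   [phi t - L * |_ - t|], and finitely many nodes [t] suffice up to [e]. *)
Lemma fba_lipschitz f (phi : R -> R) (a b L : R) : C f ->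
  (forall x, a <= f x <= b) ->
  (forall s t, a <= s <= b -> a <= t <= b -> `|phi s - phi t| <= L * `|s - t|) ->
  C (fun x => phi (f x)).
Proof.
move=> Cf fab phiL; apply: (base_closed hC) => e e0.
pose K := `|L| + 1.
have K0 : 0 < K by rewrite ltr_wpDl.
have phiK s t : a <= s <= b -> a <= t <= b -> `|phi s - phi t| <= K * `|s - t|.
  move=> hs ht; apply: (le_trans (phiL _ _ hs ht)); rewrite ler_wpM2r//.
  by rewrite (le_trans (ler_norm _))// lerDl.
pose d := e / (2 * K).
have d0 : 0 < d by rewrite divr_gt0// mulr_gt0.
pose n := (Num.truncn ((b - a) / d)).+1.
pose t (i : nat) := a + i%:R * d.
pose F (i : nat) x := phi (t i) - K * `|f x - t i|.
have CF i : C (F i).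
  apply: fba_sub; first exact: fba_cst.
  by apply: fba_scale; apply: fba_norm; apply: fba_sub => //; exact: fba_cst.
exists (fun x => \big[Num.max/F 0%N x]_(i < n) F i x); first exact: fba_bigmax.
move=> x; have /andP[ax xb] := fab x.
have tab (i : 'I_n) : a <= t i <= b.
  rewrite lerDl mulr_ge0 ?(ltW d0)//=.
  have : (i <= Num.truncn ((b - a) / d))%N by rewrite -ltnS ltn_ord.
  rewrite truncn_ge_nat; last first.
    by rewrite divr_ge0 ?(ltW d0)// subr_ge0 (le_trans ax).
  by rewrite ler_pdivlMr// lerBrDl.
have Fle (i : 'I_n) : F i x <= phi (f x).
  have := phiK _ _ (fab x) (tab i); rewrite ler_norml /F => /andP[? ?]; lra.
have n0 : (0 < n)%N by [].
have le1 : \big[Num.max/F 0%N x]_(i < n) F i x <= phi (f x).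
  by apply: bigmax_le => [|i _]; [exact: (Fle (Ordinal n0))|exact: Fle].
rewrite ger0_norm ?subr_ge0//.
have fad : 0 <= (f x - a) / d by rewrite divr_ge0 ?(ltW d0)// subr_ge0.
have in_ : (Num.truncn ((f x - a) / d) < n)%N.
  rewrite ltnS; apply: le_truncn; rewrite ler_pM2r ?invr_gt0//; lra.
pose i := Ordinal in_.
have ti1 : t i <= f x.
  rewrite /t/= -lerBrDl -ler_pdivlMr//.
  by rewrite -truncn_ge_nat.
have ti2 : f x < t i + d.
  have := truncnS_gt ((f x - a) / d); rewrite ltr_pdivrMr// -natr1 mulrDl mul1r.
  by rewrite /t/=; lra.
have Fi : F i x <= \big[Num.max/F 0%N x]_(i < n) F i x.
  exact: (le_bigmax _ (fun i : 'I_n => F i x) i).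
have fd : `|f x - t i| <= d by rewrite ger0_norm; lra.
have hKd : K * `|f x - t i| <= e / 2.
  have -> : e / 2 = K * d by rewrite /d; field; rewrite gt_eqF.
  by rewrite ler_wpM2l// ltW.
have := phiK _ _ (fab x) (tab i); rewrite ler_norml => /andP[_ h].
by rewrite /F in Fi; lra.
Qed.

Lemma expR_tangent (s t : R) : expR t * (1 + (s - t)) <= expR s.
Proof.
have -> : expR s = expR t * expR (s - t) by rewrite -expRD addrC subrK.
by rewrite ler_wpM2l ?expR_ge0// expR_ge1Dx.
Qed.

Lemma expR_lip (s t b : R) : s <= b -> t <= b ->
  `|expR s - expR t| <= expR b * `|s - t|.
Proof.
wlog st : s t / s <= t => [hw sb tb|].
  by have [/hw|/ltW/hw h] := leP s t; [apply|rewrite distrC (distrC s); exact: h].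
move=> sb tb; rewrite distrC (distrC s) !ger0_norm ?subr_ge0 ?ler_expR//.
have h := expR_tangent s t.
apply: (@le_trans _ _ (expR t * (t - s))); first by lra.
by rewrite ler_wpM2r ?subr_ge0// ler_expR.
Qed.

Lemma fba_exp f : C f -> C (fun x => expR (f x)).
Proof.
move=> Cf; have [M M0 fM] := fba_bound Cf.
apply: (@fba_lipschitz f expR (- M) M (expR M)) => //.
  by move=> x; rewrite -ler_norml.
by move=> s t /andP[_ sM] /andP[_ tM]; exact: expR_lip.
Qed.

Lemma ln_lip (s t a : R) : 0 < a -> a <= s -> a <= t ->
  `|ln s - ln t| <= a^-1 * `|s - t|.
Proof.
move=> a0; wlog st : s t / s <= t => [hw sb tb|].
  by have [/hw|/ltW/hw h] := leP s t; [apply|rewrite distrC (distrC s); exact: h].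
move=> as_ at_; have s0 := lt_le_trans a0 as_; have t0 := lt_le_trans a0 at_.
rewrite distrC (distrC s) !ger0_norm ?subr_ge0 ?ler_ln//.
rewrite -ln_div ?posrE//.
have -> : t / s = 1 + (t - s) / s by field; rewrite gt_eqF.
apply: (le_trans (le_ln1Dx _)).
  have : 0 <= (t - s) / s by rewrite divr_ge0 ?subr_ge0// ltW.
  by lra.
by rewrite mulrC ler_wpM2r ?subr_ge0// lef_pV2.
Qed.

Lemma fba_ln f (c : R) : C f -> 0 < c -> (forall x, c <= f x) ->
  C (fun x => ln (f x)).
Proof.
move=> Cf c0 cf; have [M M0 fM] := fba_bound Cf.
apply: (@fba_lipschitz f (@ln R) c M c^-1 Cf).
  by move=> x; rewrite cf (le_trans (ler_norm _)).
by move=> s t /andP[cs _] /andP[ct _]; exact: ln_lip.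
Qed.

Lemma fba_ln_max f (c : R) : C f -> 0 < c -> C (fun x => ln (Num.max (f x) c)).
Proof.
move=> Cf c0; apply: (fba_ln (fba_max Cf (fba_cst c)) c0) => x.
by rewrite le_max lexx orbT.
Qed.

(** Since [f] may vanish, [exp (p ln f)] is available only after truncation. The level [d] with
    [d^p = e] changes [f^p] by at most [e]. *)
Lemma fba_powR f (p : R) : C f -> (forall x, 0 <= f x) -> 0 < p ->
  C (fun x => f x `^ p).
Proof.
move=> Cf f0 p0; apply: (base_closed hC) => e e0.
pose d := e `^ p^-1.
have d0 : 0 < d by rewrite powR_gt0.
have dp : d `^ p = e by rewrite -powRrM mulVf ?gt_eqF// powRr1// ltW.
exists (fun x => Num.max (f x) d `^ p).
  rewrite (_ : (fun _ => _) = (fun x => expR (p * ln (Num.max (f x) d)))).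
    by apply: fba_exp; apply: fba_scale; exact: fba_ln_max.
  by apply/funext => x; rewrite /powR gt_eqF// lt_max d0 orbT.
move=> x; have [fd|df] := leP (f x) d; last by rewrite subrr normr0 ltW.
rewrite dp distrC ger0_norm; first by rewrite gerBl powR_ge0.
by rewrite subr_ge0 -dp ge0_ler_powR ?nnegrE ?(ltW p0) ?(ltW d0).
Qed.

End FunctionAlgebra.

Section PositiveOperators.
Variables (R : realType) (X : Type) (C : set (X -> R)).
Hypothesis hC : functional_base_algebra C.
Implicit Types (f g : X -> R) (mu : (X -> R) -> R).

Section States.
Variables (mu : (X -> R) -> R).
Hypothesis hmu : states C mu.

Lemma state_add f g : C f -> C g -> mu (fun x => f x + g x) = mu f + mu g.
Proof. by case: hmu => -[+ _] _ _ => h; exact: h. Qed.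

Lemma state_scale c f : C f -> mu (fun x => c * f x) = c * mu f.
Proof. by case: hmu => -[_ +] _ _ => h; exact: h. Qed.

Lemma state_opp f : C f -> mu (fun x => - f x) = - mu f.
Proof.
move=> Cf; rewrite (_ : (fun _ => _) = (fun x => -1 * f x)).
  by rewrite state_scale// mulN1r.
by apply/funext => x; rewrite mulN1r.
Qed.

Lemma state_sub f g : C f -> C g -> mu (fun x => f x - g x) = mu f - mu g.
Proof. by move=> Cf Cg; rewrite state_add ?state_opp//; exact: fba_opp. Qed.

Lemma state_cst c : mu (fun=> c) = c.
Proof.
rewrite (_ : (fun _ => _) = (fun x : X => c * 1)).
  by rewrite state_scale; [case: hmu => _ _ ->; rewrite mulr1|exact: fba_cst].
by apply/funext => x; rewrite mulr1.
Qed.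

Lemma state_ge0 f : C f -> (forall x, 0 <= f x) -> 0 <= mu f.
Proof. by case: hmu => _ + _; apply. Qed.

Lemma state_le f g : C f -> C g -> (forall x, f x <= g x) -> mu f <= mu g.
Proof.
move=> Cf Cg fg; rewrite -subr_ge0 -state_sub//.
by apply: state_ge0 => [|x]; [exact: fba_sub|rewrite subr_ge0].
Qed.

Lemma state_le_cst f c : C f -> (forall x, f x <= c) -> mu f <= c.
Proof.
by move=> Cf fc; rewrite -[leRHS]state_cst; apply: state_le => //; exact: fba_cst.
Qed.

Lemma state_ge_cst f c : C f -> (forall x, c <= f x) -> c <= mu f.
Proof.
by move=> Cf fc; rewrite -[leLHS]state_cst; apply: state_le => //; exact: fba_cst.
Qed.

Lemma state_sum (I : eqType) (s : seq I) (F : I -> X -> R) :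
  (forall i, i \in s -> C (F i)) ->
  mu (fun x => \sum_(i <- s) F i x) = \sum_(i <- s) mu (F i).
Proof.
elim: s => [|i s ih] CF.
  rewrite big_nil (_ : (fun _ => _) = (fun=> 0)) ?state_cst//.
  by apply/funext => x; rewrite big_nil.
have CFs j : j \in s -> C (F j) by move=> js; apply: CF; rewrite inE js orbT.
rewrite big_cons -ih// -state_add; [|by apply: CF; rewrite mem_head|exact: fba_sum].
by congr mu; apply/funext => x; rewrite big_cons.
Qed.

End States.

Lemma state_eval (x : X) : states C (fun f => f x).
Proof. split; [by split|by move=> f _; exact|by []]. Qed.

Lemma state_mix mu nu t : states C mu -> states C nu -> 0 <= t <= 1 ->
  states C (fun f => (1 - t) * mu f + t * nu f).
Proof.
move=> hmu hnu /andP[t0 t1]; split.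
- split.
  + by move=> f g Cf Cg; rewrite (state_add hmu)// (state_add hnu)//; ring.
  + by move=> c f Cf; rewrite (state_scale hmu)// (state_scale hnu)//; ring.
- move=> f Cf f0; rewrite addr_ge0// mulr_ge0 ?subr_ge0//; exact: state_ge0.
- by rewrite (state_cst hmu) (state_cst hnu); ring.
Qed.

Lemma supnorm_ge f x : C f -> `|f x| <= supnorm f.
Proof.
move=> /(fba_bound hC)[M _ fM]; apply: ub_le_sup; last by exists x.
by exists M => _ [y _ <-].
Qed.

Lemma le_supnorm f x : C f -> f x <= supnorm f.
Proof. by move=> Cf; rewrite (le_trans (ler_norm _))// supnorm_ge. Qed.

Lemma supnorm_ge0 f (x : X) : C f -> 0 <= supnorm f.
Proof. by move=> Cf; rewrite (le_trans _ (supnorm_ge x Cf)). Qed.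

Lemma supnorm_le (x0 : X) f c : (forall x, 0 <= f x <= c) -> supnorm f <= c.
Proof.
move=> fc; apply: ge_sup; first by exists `|f x0|, x0.
by move=> _ [x _ <-]; have /andP[f0 ?] := fc x; rewrite ger0_norm.
Qed.

Record positive_operator (P : (X -> R) -> (X -> R)) : Prop := PositiveOperator {
  posop_sub : forall f, C f -> C (P f);
  posop_add : forall f g, C f -> C g ->
    P (fun x => f x + g x) = (fun x => P f x + P g x);
  posop_scale : forall c f, C f -> P (fun x => c * f x) = (fun x => c * P f x);
  posop_ge0 : forall f, C f -> (forall x, 0 <= f x) -> forall x, 0 <= P f x }.

Lemma posop_iter P n : positive_operator P -> positive_operator (iter n P).
Proof.
move=> hP; elim: n => [|n ih]; first by split.
split=> /=.
- by move=> f Cf; apply: posop_sub => //; exact: posop_sub.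
- move=> f g Cf Cg; rewrite (posop_add ih)// (posop_add hP)//; exact: posop_sub.
- move=> c f Cf; rewrite (posop_scale ih)// (posop_scale hP)//; exact: posop_sub.
- move=> f Cf f0; apply: (posop_ge0 hP); first exact: posop_sub.
  exact: posop_ge0.
Qed.

Lemma posop_mul P u : positive_operator P -> C u -> (forall x, 0 <= u x) ->
  positive_operator (fun f => P (fun x => u x * f x)).
Proof.
move=> hP Cu u0; split.
- by move=> f Cf; apply: posop_sub => //; exact: fba_mul.
- move=> f g Cf Cg; rewrite -(posop_add hP); try exact: fba_mul.
  by congr P; apply/funext => x; rewrite mulrDr.
- move=> c f Cf; rewrite -(posop_scale hP); last exact: fba_mul.
  by congr P; apply/funext => x; rewrite mulrCA.
- move=> f Cf f0; apply: posop_ge0 => //; first exact: fba_mul.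
  by move=> x; rewrite mulr_ge0.
Qed.

Section PosopTheory.
Variable P : (X -> R) -> (X -> R).
Hypothesis hP : positive_operator P.

Lemma posop_opp f : C f -> P (fun x => - f x) = (fun x => - P f x).
Proof.
move=> Cf; rewrite (_ : (fun _ => _) = (fun x => -1 * f x)).
  by rewrite posop_scale//; apply/funext => x; rewrite mulN1r.
by apply/funext => x; rewrite mulN1r.
Qed.

Lemma posop_le f g : C f -> C g -> (forall x, f x <= g x) ->
  forall x, P f x <= P g x.
Proof.
move=> Cf Cg fg x; rewrite -subr_ge0.
have := posop_ge0 hP (fba_sub hC Cg Cf) _ x.
rewrite (posop_add hP)//; last exact: fba_opp.
by rewrite posop_opp//; apply => y; rewrite subr_ge0.
Qed.

Lemma posop_le_cst f c : C f -> (forall x, f x <= c) ->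
  forall x, P f x <= c * P (fun=> 1) x.
Proof.
move=> Cf fc x; have -> : c * P (fun=> 1) x = P (fun=> c * 1) x.
  by rewrite posop_scale//; exact: fba_cst.
by apply: posop_le => //; [exact: fba_cst|move=> y; rewrite mulr1].
Qed.

Lemma posop_sum (I : eqType) (s : seq I) (F : I -> X -> R) :
  (forall i, i \in s -> C (F i)) ->
  P (fun x => \sum_(i <- s) F i x) = (fun x => \sum_(i <- s) P (F i) x).
Proof.
elim: s => [|i s ih] CF.
  have -> : (fun x => \sum_(i <- [::]) F i x) = (fun x => 0 * 0).
    by apply/funext => x; rewrite big_nil mul0r.
  rewrite (posop_scale hP); last exact: fba_cst.
  by apply/funext => x; rewrite mul0r big_nil.
have CFs j : j \in s -> C (F j) by move=> js; apply: CF; rewrite inE js orbT.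
have -> : (fun x => \sum_(j <- i :: s) F j x) =
    (fun x => F i x + \sum_(j <- s) F j x).
  by apply/funext => x; rewrite big_cons.
rewrite (posop_add hP); [|by apply: CF; rewrite mem_head|exact: fba_sum].
by rewrite ih//; apply/funext => x; rewrite big_cons.
Qed.

End PosopTheory.

(** [P^n 1] is at most the constant [supnorm (P^n 1)]; apply the positive operator [P^m] to this
    inequality. *)
Lemma posop_supnorm_submul P (x0 : X) m n : positive_operator P ->
  supnorm (iter (m + n) P (fun=> 1)) <=
  supnorm (iter m P (fun=> 1)) * supnorm (iter n P (fun=> 1)).
Proof.
move=> hP; have C1 := fba_cst hC 1.
have hPk k := posop_iter k hP.
have CP k : C (iter k P (fun=> 1)) by exact: posop_sub.
have P0 k x : 0 <= iter k P (fun=> 1) x by exact: posop_ge0.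
apply: supnorm_le => // x; rewrite P0 iterD /=.
have h := posop_le_cst (hPk m) (CP n) (fun y => le_supnorm y (CP n)).
by rewrite mulrC (le_trans (h x))// ler_wpM2l ?(supnorm_ge0 x)//; exact: le_supnorm.
Qed.

End PositiveOperators.

(** * Transfer operators and their weighted iterates *)

Section TransferOperator.
Variables (R : realType) (X : Type) (C : set (X -> R)).
Hypothesis hC : functional_base_algebra C.
Variables (a : X -> X) (A : (X -> R) -> (X -> R)).
Hypothesis C_dyn : forall f, C f -> C (f \o a).
Hypothesis hA : transfer_operator C a A.
Implicit Types (f g u : X -> R) (mu : (X -> R) -> R).

Lemma fba_dyn n f : C f -> C (fun x => f (iter n a x)).
Proof.
move=> Cf; elim: n => [//|n ih].
rewrite (_ : (fun _ => _) = (fun x => f (iter n a x)) \o a); first exact: C_dyn.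
by apply/funext => x /=; rewrite -iterSr.
Qed.

Lemma invariant_state_iter mu n f : invariant_states C a mu -> C f ->
  mu (fun x => f (iter n a x)) = mu f.
Proof.
move=> [hmu inv] Cf; elim: n => [//|n ih].
rewrite -[RHS]ih -[RHS]inv; last exact: fba_dyn.
by congr mu; apply/funext => x /=; rewrite -iterSr.
Qed.

Lemma transfer_posop : positive_operator C A.
Proof.
split.
- by move=> f Cf; exact: (transfer_sub hA Cf).
- by move=> f g Cf Cg; exact: (transfer_add hA Cf Cg).
- by move=> c f Cf; exact: (transfer_scale hA c Cf).
- by move=> f Cf f0 x; exact: (transfer_pos hA Cf f0).
Qed.

Lemma transfer_iter n : positive_operator C (iter n A).
Proof. exact/posop_iter/transfer_posop. Qed.

Lemma transfer_iter_id n f g : C f -> C g ->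
  iter n A (fun x => f (iter n a x) * g x) = (fun x => f x * iter n A g x).
Proof.
move=> Cf; elim: n g => [//|n ih] g Cg.
rewrite iterSr (_ : (fun _ => _) = ((fun x => f (iter n a x)) \o a) \* g).
  rewrite (transfer_id hA) ?ih//; last exact: fba_dyn.
    by apply/funext => x /=; rewrite -iterSr.
  exact: transfer_sub hA _ Cg.
by apply/funext => x /=; rewrite -iterSr.
Qed.

(** By the transfer identity a weight [u] standing outside [A^n] becomes [u] composed with [a^n]
    inside it, so the weights of successive steps accumulate to a product along the orbit. *)
Lemma weighted_iter n u g : C u -> C g ->
  iter n (fun f => A (fun x => u x * f x)) g =
  iter n A (fun x => (\prod_(k < n) u (iter k a x)) * g x).
Proof.
move=> Cu Cg; elim: n => [|n ih].
  by apply/funext => x /=; rewrite big_ord0 mul1r.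
rewrite !iterS {}ih -transfer_iter_id//; last first.
  by apply: fba_mul => //; apply: fba_prod => // k; exact: fba_dyn.
congr (A (iter n A _)); apply/funext => x.
by rewrite big_ord_recr/=; ring.
Qed.

End TransferOperator.

(** * Upper bound for the t-entropy *)

Section UpperBound.
Variables (R : realType) (X : Type) (C : set (X -> R)).
Hypothesis hC : functional_base_algebra C.
Implicit Types (f g u : X -> R) (mu m : (X -> R) -> R).

Lemma not_uniq_perm (T : eqType) (s : seq T) :
  ~~ uniq s -> exists (g : T) (s' : seq T), perm_eq s [:: g, g & s'].
Proof.
elim: s => [//|g s ih] /=; have [gs _|gs /= /ih[h [s' hs]]] := boolP (g \in s).
  by exists g, (rem g s); rewrite perm_cons perm_to_rem.
exists h, (g :: s'); apply/permP => q /=; rewrite (permP hs) /=.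
by rewrite addnCA; congr addn; rewrite addnCA.
Qed.

(* Partitions of unity are sets, so equal members of an indexed partition are
   merged; [Q] survives since it depends only on the support of [g]. *)
Lemma partition_of_unity_seq (Q : (X -> R) -> Prop) (s : seq (X -> R)) :
  (forall g, Q g -> Q (fun x => g x + g x)) ->
  (forall g, g \in s -> [/\ C g, forall x, 0 <= g x & Q g]) ->
  (forall x, \sum_(g <- s) g x = 1) ->
  exists2 D : {fset (X -> R)}, partition_of_unity C D & forall g, g \in D -> Q g.
Proof.
move=> QD; have [n] := ubnP (size s); elim: n s => // n ih s sn hs s1.
have [us|/not_uniq_perm[g [s' gs']]] := boolP (uniq s).
  exists [fset g in s]%fset; last by move=> g; rewrite inE => /hs[].
  split; [by move=> g; rewrite inE => /hs[]|by move=> g; rewrite inE => /hs[]|].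
  move=> x; rewrite -[RHS](s1 x); apply: perm_big; apply: uniq_perm => //.
  by move=> g; rewrite inE.
have hg : [/\ C g, forall x, 0 <= g x & Q g].
  by apply: hs; rewrite (perm_mem gs') mem_head.
apply: (ih ((fun x => g x + g x) :: s')).
- by move: sn; rewrite (perm_size gs').
- move=> h; rewrite inE => /predU1P[->|hs']; last first.
    by apply: hs; rewrite (perm_mem gs') !inE hs' !orbT.
  case: hg => Cg g0 Qg; split; [exact: fba_add|move=> x; exact: addr_ge0|exact: QD].
- move=> x; rewrite -[RHS](s1 x) [RHS](perm_big _ gs')/= !big_cons.
  by rewrite addrA.
Qed.

(** The members are differences of consecutive ramps [c j] of [u], clipped to [[0, 1]]. Such a
    difference vanishes unless [t j < u < t j + 2 eta], hence the centre [t j + eta], and the sum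
    telescopes to [c 0 - c J = 1]. *)
Lemma fine_partition u (eta : R) : C u -> 0 < eta ->
  exists2 D : {fset (X -> R)}, partition_of_unity C D &
    forall g, g \in D -> exists s : R, forall x, g x != 0 -> `|u x - s| <= eta.
Proof.
move=> Cu eta0; have [M M0 uM] := fba_bound hC Cu.
(* The levels start one step below [-M], so that the ramp [c 0] is already equal to 1 everywhere. *)
pose t (j : nat) := - M + (j%:R - 1) * eta.
pose c (j : nat) x := Num.min (Num.max ((u x - t j) / eta) 0) 1.
have Cc j : C (c j).
  apply: fba_min => //; last exact: fba_cst.
  apply: fba_max => //; last exact: fba_cst.
  rewrite (_ : (fun _ => _) = (fun x => eta^-1 * (u x - t j))).
    by apply: fba_scale => //; apply: fba_sub => //; exact: fba_cst.
  by apply/funext => x; rewrite mulrC.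
have cE1 j x : t j + eta <= u x -> c j x = 1.
  move=> h; rewrite /c; have h1 : 1 <= (u x - t j) / eta by rewrite ler_pdivlMr//; lra.
  by rewrite (max_idPl _) ?min_r// (le_trans _ h1).
have cE0 j x : u x <= t j -> c j x = 0.
  move=> h; rewrite /c; have h1 : (u x - t j) / eta <= 0.
    by rewrite pmulr_lle0 ?invr_gt0// subr_le0.
  by rewrite (max_idPr _)// min_l.
have c_anti j x : c j.+1 x <= c j x.
  have h : (u x - t j.+1) / eta <= (u x - t j) / eta.
    by rewrite ler_pM2r ?invr_gt0// /t -[j.+1%:R]natr1; lra.
  rewrite /c le_min !ge_min lexx orbT andbT; apply/orP; left.
  by rewrite ge_max !le_max h lexx orbT.
(* Two more than the integer part of [2 M / eta], because [t J = -M + (J - 1) eta] has to exceed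
   [M]. *)
pose J := (Num.truncn (2 * M / eta)).+2.
pose s := [seq (fun x => c j x - c j.+1 x) | j <- iota 0 J].
apply: (@partition_of_unity_seq _ s).
- move=> g [r hr]; exists r => x gx; apply: hr.
  by apply: contra_neq gx => ->; rewrite addr0.
- move=> _ /mapP[j _ ->]; split.
  + exact: fba_sub.
  + by move=> x; rewrite subr_ge0.
  + exists (t j + eta) => x cx.
    have h1 : t j < u x.
      rewrite ltNge; apply: contra_neqN cx => h.
      rewrite !cE0 ?subr0// (le_trans h)// /t -[j.+1%:R]natr1; lra.
    have h2 : u x < t j.+1 + eta.
      rewrite ltNge; apply: contra_neqN cx => h.
      rewrite !cE1 ?subrr// (le_trans _ h)// /t -[j.+1%:R]natr1; lra.
    move: h2; rewrite /t -[j.+1%:R]natr1 => h2.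
    by rewrite ler_norml; apply/andP; split; rewrite /t in h1 *; lra.
- move=> x; rewrite big_map.
  rewrite (eq_bigr (fun j => - c j.+1 x - - c j x)); last first.
    by move=> j _; rewrite opprK addrC.
  have := @telescope_sumr _ 0 J (fun j => - c j x) isT.
  rewrite /index_iota subn0 => ->.
  have /ler_normlP[ux1 ux2] := uM x.
  rewrite cE0 ?cE1; first by rewrite oppr0 sub0r opprK.
    by rewrite /t; lra.
  rewrite (le_trans ux2)// /t.
  have := truncnS_gt (2 * M / eta); rewrite ltr_pdivrMr//.
  have -> : (J%:R : R) = (Num.truncn (2 * M / eta)).+1%:R + 1 by rewrite natr1.
  by lra.
Qed.

Section TauTerm.
Variables (A : (X -> R) -> (X -> R)) (hA : positive_operator C A).
Variables (mu : (X -> R) -> R) (hmu : states C mu).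

(** This is [ln y <= y - 1] at [y = c m (A^n g) / mu g]. The bound is affine in [m] and can be
    summed over a partition, with [c] free to depend on [g]. *)
Lemma tau_term_le n m g (c : R) : states C m -> C g -> (forall x, 0 <= g x) ->
  0 < c ->
  (tau_term A mu n m g <= (m (iter n A g) * c - mu g - mu g * ln c)%:E)%E.
Proof.
move=> hm Cg g0 c0; have hAn := posop_iter n hA.
have m0 : 0 <= m (iter n A g).
  by apply: (state_ge0 hm); [exact: posop_sub hAn _ Cg|exact: posop_ge0 hAn _ Cg g0].
have mu0 : 0 <= mu g by exact: (state_ge0 hmu).
rewrite /tau_term; case: eqP => [->|/eqP mun0].
  by rewrite lee_fin mul0r !subr0 mulr_ge0// ltW.
have mup : 0 < mu g by rewrite lt_def mun0.
have := m0; rewrite le_eqVlt => /predU1P[<-|mp].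
  by rewrite mul0r le0_lneNy// gt0_muleNy ?lte_fin// leNye.
rewrite lne_EFin ?divr_gt0// -EFinM lee_fin.
have h : ln (m (iter n A g) / mu g * c) <= m (iter n A g) / mu g * c - 1.
  have /le_ln1Dx : -1 < m (iter n A g) / mu g * c - 1.
    by rewrite ltrBrDr addNr mulr_gt0 ?divr_gt0.
  by rewrite addrCA subrr addr0.
rewrite lnM ?posrE ?divr_gt0// in h.
have := ler_wpM2l (ltW mup) h; rewrite mulrDr mulrBr mulr1.
have -> : mu g * (m (iter n A g) / mu g * c) = m (iter n A g) * c.
  by field; rewrite gt_eqF.
by lra.
Qed.

(** Take a partition fine for [ln h], with [s g] the approximate value of [ln h] where [g] is
    nonzero. Then [sum_g e^(s g) A^n g <= e^eta A^n h], and the affine bound on each term with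
    [c = e^(s g) / H] makes the linear part at most [1 - 1]. One [eta] comes from this comparison,
    the other from replacing [mu (ln h)] by [sum_g mu g * s g]. *)
Lemma tau_nD_le n h (c eta kappa : R) : C h -> 0 < c -> (forall x, c <= h x) ->
  0 < eta -> 0 < kappa ->
  exists2 D : {fset (X -> R)}, partition_of_unity C D &
    (tau_nD C A mu n D <=
      (ln (supnorm (iter n A h) + kappa) + 2 * eta - mu (fun x => ln (h x)))%:E)%E.
Proof.
move=> Ch c0 ch eta0 kappa0.
have Clnh := fba_ln hC Ch c0 ch; have hAn := posop_iter n hA.
have [D [CD D0 D1] hD] := fine_partition Clnh eta0; exists D; first by split.
have {hD}[s hs] : exists s : (X -> R) -> R, forall g, g \in D ->
    forall x, g x != 0 -> `|ln (h x) - s g| <= eta.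
  suff /choice[s hs] : forall g, exists r : R, g \in D ->
    forall x, g x != 0 -> `|ln (h x) - r| <= eta by exists s.
  move=> g; have [gD|gD] := boolP (g \in D); last by exists 0.
  by have [r hr] := hD _ gD; exists r.
(* On an empty [X] the functions 1 and 0 coincide, which contradicts [mu 1 = 1]. *)
have X0 : exists x : X, True.
  apply/not_existsP => noX; have := state_cst hC hmu 1.
  rewrite (_ : (fun _ => 1) = (fun=> 0)) ?(state_cst hC hmu).
    by move/esym/eqP; rewrite oner_eq0.
  by apply/funext => x; case: (noX x).
have {X0}[x0 _] := X0.
(* The margin [kappa] keeps [H] positive even if [A^n h] vanishes. *)
pose H := expR eta * (supnorm (iter n A h) + kappa).
have CAh : C (iter n A h) := posop_sub hAn Ch.
have H0 : 0 < H.
  by rewrite mulr_gt0 ?expR_gt0// ltr_wpDl// (supnorm_ge0 hC x0).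
have lnH : ln H = eta + ln (supnorm (iter n A h) + kappa).
  rewrite lnM ?expRK ?posrE ?expR_gt0//.
  by rewrite ltr_wpDl// (supnorm_ge0 hC x0).
have muD1 : \sum_(g <- D) mu g = 1.
  rewrite -(state_sum hC hmu (F := id))// -[RHS](state_cst hC hmu 1).
  by congr mu; apply/funext.
have musD : mu (fun x => ln (h x)) - eta <= \sum_(g <- D) mu g * s g.
  rewrite (eq_big_seq (fun g => mu (fun x => s g * g x))); last first.
    by move=> g gD; rewrite (state_scale hmu) 1?mulrC//; exact: CD.
  have Cs g : g \in D -> C (fun x => s g * g x).
    by move=> /CD; exact: fba_scale.
  rewrite -(state_sum hC hmu (F := fun g x => s g * g x))//.
  rewrite -[X in _ - X](state_cst hC hmu) -(state_sub hC hmu)//; last exact: fba_cst.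
  apply: (state_le hC hmu) => //; [|exact: fba_sum|].
    by apply: fba_sub => //; exact: fba_cst.
  move=> x; rewrite -[leLHS]mulr1 -(D1 x) mulr_sumr big_seq [leRHS]big_seq.
  apply: ler_sum => g gD; have [->|gx] := eqVneq (g x) 0; first by rewrite !mulr0.
  rewrite ler_wpM2r ?D0//; have /ler_normlP[] := hs g gD x gx; lra.
apply: ge_ereal_sup => _ [m hm <-].
have mD : \sum_(g <- D) m (iter n A g) * expR (s g) <= H.
  have Cs g : g \in D -> C (fun x => expR (s g) * g x).
    by move=> /CD; exact: fba_scale.
  have mAg g : g \in D ->
      m (iter n A g) * expR (s g) = m (iter n A (fun x => expR (s g) * g x)).
    move=> /CD Cg; rewrite (posop_scale hAn)// (state_scale hm) 1?mulrC//.
    exact: posop_sub hAn _ Cg.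
  rewrite (eq_big_seq _ mAg) -(state_sum hC hm (F := fun g =>
    iter n A (fun x => expR (s g) * g x))); last first.
    by move=> g gD; apply: (posop_sub hAn); exact: Cs.
  rewrite -(posop_sum hC hAn (F := fun g x => expR (s g) * g x))//.
  have CS : C (fun x => \sum_(g <- D) expR (s g) * g x) by exact: fba_sum.
  have Ceh : C (fun x => expR eta * h x) by exact: fba_scale.
  apply: (@le_trans _ _ (m (iter n A (fun x => expR eta * h x)))).
    apply: (state_le hC hm); [exact: posop_sub hAn _ CS|exact: posop_sub hAn _ Ceh|].
    apply: (posop_le hC hAn) => // x.
    rewrite -[leRHS]mulr1 -(D1 x) mulr_sumr big_seq [leRHS]big_seq.
    apply: ler_sum => g gD; have [->|gx] := eqVneq (g x) 0; first by rewrite !mulr0.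
    rewrite ler_wpM2r ?D0// -[h x]lnK ?posrE ?(lt_le_trans c0 (ch x))// -expRD ler_expR.
    by have /ler_normlP[] := hs g gD x gx; lra.
  rewrite (posop_scale hAn)// (state_scale hm)// ler_wpM2l ?expR_ge0//.
  apply: (@le_trans _ _ (supnorm (iter n A h))); last by rewrite lerDl ltW.
  by apply: (state_le_cst hC hm CAh) => x; exact: (le_supnorm hC x CAh).
apply: (@le_trans _ _ (\sum_(g <- D) (m (iter n A g) * (expR (s g) / H) - mu g
    - mu g * ln (expR (s g) / H))%:E)%E).
  rewrite big_seq [leRHS]big_seq; apply: lee_sum => g gD.
  by apply: tau_term_le => //; [exact: CD|exact: D0|rewrite divr_gt0 ?expR_gt0].
rewrite sumEFin lee_fin.
rewrite (eq_bigr (fun g => m (iter n A g) * expR (s g) / H - mu g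
   - (mu g * s g - mu g * ln H))); last first.
  by move=> g _; rewrite ln_div ?posrE ?expR_gt0// expRK; ring.
rewrite !sumrB -!mulr_suml muD1.
have : (\sum_(g <- D) m (iter n A g) * expR (s g)) / H <= 1.
  by rewrite ler_pdivrMr// mul1r.
by rewrite lnH; lra.
Qed.

End TauTerm.
End UpperBound.

(** * Truncated weights and the upper bound *)

Section VariationalUpper.
Variables (R : realType) (X : Type) (C : set (X -> R)).
Hypothesis hC : functional_base_algebra C.
Variables (a : X -> X) (A : (X -> R) -> (X -> R)).
Hypothesis C_dyn : forall f, C f -> C (f \o a).
Hypothesis hA : transfer_operator C a A.
Variables (v : X -> R) (p : R).
Hypotheses (Cv : C v) (v0 : forall x, 0 <= v x) (p0 : 0 < p).

Definition weighted_transfer (f : X -> R) : X -> R :=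
  A (fun x => v x `^ p * f x).

Definition cocycle (e : R) (n : nat) (x : X) : R :=
  \prod_(k < n) Num.max (v (iter k a x)) e `^ p.

Lemma fba_max_powR e : 0 < e -> C (fun x => Num.max (v x) e `^ p).
Proof.
move=> e0; apply: fba_powR => //; first by apply: fba_max => //; exact: fba_cst.
by move=> x; rewrite le_max v0.
Qed.

Lemma fba_cocycle e n : 0 < e -> C (cocycle e n).
Proof.
move=> e0; apply: fba_prod => // k.
exact: (fba_dyn C_dyn (f := fun x => Num.max (v x) e `^ p) k (fba_max_powR e0)).
Qed.

Lemma cocycle_ge e n x : 0 < e -> (e `^ p) ^+ n <= cocycle e n x.
Proof.
move=> e0; rewrite -[n in leLHS]card_ord -prodr_const; apply: ler_prod => k _.
rewrite powR_ge0/= ge0_ler_powR ?nnegrE ?(ltW p0) ?(ltW e0)//.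
  by rewrite le_max v0.
by rewrite le_max lexx orbT.
Qed.

Lemma ln_cocycle e n x : 0 < e ->
  ln (cocycle e n x) = p * \sum_(k < n) ln (Num.max (v (iter k a x)) e).
Proof.
move=> e0; have m0 y : 0 < Num.max (v y) e by rewrite lt_max e0 orbT.
rewrite /cocycle; elim: n => [|n ih]; first by rewrite !big_ord0 ln1 mulr0.
rewrite !big_ord_recr/= lnM ?posrE ?powR_gt0//; last first.
  by apply: prodr_gt0 => k _; rewrite powR_gt0.
by rewrite ih ln_powR mulrDr.
Qed.

(** The error of the truncation is uniform in the point and vanishes with [e], so a strict
    inequality [supnorm (P^n 1) < c^n] survives it. The induction rests on
    [max (v, e)^p <= v^p + e^p]. *)
Lemma cocycle_le n : exists2 K : R, 0 < K & forall e x, 0 < e -> e <= 1 ->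
  cocycle e n x <= \prod_(k < n) v (iter k a x) `^ p + K * e `^ p.
Proof.
have [M M0 vM] := fba_bound hC Cv.
have vM' x : v x <= M by rewrite (le_trans (ler_norm _)).
pose N := (M + 1) `^ p.
have N1 : 1 <= N.
  have -> : (1 : R) = 1 `^ p by rewrite powR1.
  rewrite /N ge0_ler_powR ?nnegrE ?(ltW p0)// ?addr_ge0 ?(ltW M0)//.
  by rewrite lerDr ltW.
elim: n => [|n [K K0 ih]].
  by exists 1 => // e x e0 _; rewrite /cocycle !big_ord0 mul1r lerDl powR_ge0.
(* [K * N] is the old error times the new factor; [N^n] bounds the old product, which multiplies the
   new error [e^p]. *)
exists (K * N + N ^+ n); first by rewrite addr_gt0 ?mulr_gt0 ?exprn_gt0 ?(lt_le_trans _ N1).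
move=> e x e0 e1; rewrite /cocycle !big_ord_recr/= -/(cocycle e n x).
set y := iter n a x; set W := \prod_(k < n) _.
have W0 : 0 <= W by apply: prodr_ge0 => k _; exact: powR_ge0.
have WN : W <= N ^+ n.
  rewrite -[n in leRHS]card_ord -prodr_const; apply: ler_prod => k _.
  rewrite powR_ge0/= /N ge0_ler_powR ?nnegrE ?(ltW p0)// ?addr_ge0 ?(ltW M0)//.
  by rewrite (le_trans (vM' _))// lerDl.
have me0 : 0 <= Num.max (v y) e by rewrite le_max v0.
have mN : Num.max (v y) e `^ p <= N.
  rewrite /N ge0_ler_powR ?nnegrE ?(ltW p0)// ?addr_ge0 ?(ltW M0)//.
  rewrite ge_max (le_trans (vM' _)) ?lerDl//= (le_trans e1)// lerDr ltW//.
have mv : Num.max (v y) e `^ p <= v y `^ p + e `^ p.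
  by have [_|_] := leP (v y) e; rewrite ?lerDr ?lerDl powR_ge0.
have ep := powR_ge0 e p.
apply: (@le_trans _ _ ((W + K * e `^ p) * Num.max (v y) e `^ p)).
  by rewrite ler_wpM2r ?powR_ge0// ih.
rewrite mulrDl; apply: (@le_trans _ _ (W * (v y `^ p + e `^ p) + K * e `^ p * N)).
  by rewrite lerD// ler_wpM2l// mulr_ge0// ltW.
have : W * e `^ p <= N ^+ n * e `^ p by rewrite ler_wpM2r.
lra.
Qed.

(** [L] stands for [p] times the integral of [ln v]. It is required to lie below all truncations
    because the level [e] is chosen inside the proof, depending on [n] and [c]. *)
Lemma tau_le (x0 : X) mu (L c : R) n : invariant_states C a mu ->
  (forall e, 0 < e -> L <= p * mu (fun x => ln (Num.max (v x) e))) ->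
  (0 < n)%N -> 0 < c ->
  supnorm (iter n weighted_transfer (fun=> 1)) < c ^+ n ->
  (tau C A mu <= (ln c - L)%:E)%E.
Proof.
move=> imu hL n0 c0; set b := supnorm _ => bc; have hmu := imu.1.
have hAn := transfer_iter hA n.
have C1 := fba_cst hC 1.
(* One half of the gap pays for truncating [v], the other is the margin of [tau_nD_le]. *)
pose kappa := (c ^+ n - b) / 2.
have kappa0 : 0 < kappa by rewrite divr_gt0// subr_gt0.
have [K K0 hK] := cocycle_le n.
have Cw : C (fun x => v x `^ p) by exact: fba_powR.
pose W x := \prod_(k < n) v (iter k a x) `^ p.
have CW : C W.
  by apply: fba_prod => // k; exact: (fba_dyn C_dyn (f := fun x => v x `^ p) k Cw).
have bE : b = supnorm (iter n A W).
  rewrite /b /weighted_transfer (weighted_iter hC C_dyn hA)//.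
  by congr (supnorm (iter n A _)); apply/funext => x; rewrite mulr1.
pose N := supnorm (iter n A (fun=> 1)).
have N0 : 0 <= N by apply: (supnorm_ge0 hC x0); exact: posop_sub hAn _ C1.
have [e /andP[e0 e1] he] : exists2 e : R, 0 < e <= 1 & K * e `^ p * N <= kappa.
  pose d := kappa / (K * (N + 1)).
  have d0 : 0 < d by rewrite divr_gt0// mulr_gt0// ltr_wpDl.
  exists (Num.min (d `^ p^-1) 1).
    by rewrite lt_min powR_gt0// ltr01/= ge_min lexx orbT.
  apply: (@le_trans _ _ (K * d * N)).
    rewrite ler_wpM2r// ler_wpM2l ?(ltW K0)//.
    apply: (@le_trans _ _ ((d `^ p^-1) `^ p)).
      rewrite ge0_ler_powR ?nnegrE ?(ltW p0)// ?powR_ge0// ?ge_min ?lexx//.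
      by rewrite le_min powR_ge0 ler01.
    by rewrite -powRrM mulVf ?gt_eqF// powRr1// ltW.
  have -> : K * d * N = kappa * (N / (N + 1)).
    by rewrite /d; field; rewrite !gt_eqF// ltr_wpDl.
  rewrite -[leRHS]mulr1 ler_wpM2l ?(ltW kappa0)//.
  by rewrite ler_pdivrMr ?ltr_wpDl// mul1r lerDl.
have Cco := fba_cocycle n e0.
have hAco : supnorm (iter n A (cocycle e n)) <= b + kappa.
  apply: (supnorm_le x0) => x; apply/andP; split.
    apply: (posop_ge0 hAn Cco) => y.
    by rewrite (le_trans _ (cocycle_ge n y e0))// exprn_ge0// powR_ge0.
  have CWK : C (fun x => W x + K * e `^ p * 1).
    by apply: fba_add => //; exact: fba_cst.
  apply: (@le_trans _ _ (iter n A (fun x => W x + K * e `^ p * 1) x)).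
    by apply: (posop_le hC hAn) => // y; rewrite mulr1; exact: hK.
  rewrite (posop_add hAn)//; last exact: fba_cst.
  rewrite (posop_scale hAn)// bE lerD//.
    exact: (le_supnorm hC x (posop_sub hAn CW)).
  apply: le_trans he; rewrite ler_wpM2l ?mulr_ge0 ?(ltW K0) ?powR_ge0//.
  exact: (le_supnorm hC x (posop_sub hAn C1)).
(* By invariance all [n] summands of the Birkhoff sum have the same value under [mu]. *)
have mulnco : mu (fun x => ln (cocycle e n x)) =
    n%:R * (p * mu (fun x => ln (Num.max (v x) e))).
  have Cl := fba_ln_max hC Cv e0.
  have Clk k := fba_dyn C_dyn k Cl.
  rewrite (_ : (fun _ => _) =
      (fun x => p * \sum_(k < n) ln (Num.max (v (iter k a x)) e))); last first.
    by apply/funext => x; rewrite ln_cocycle.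
  rewrite (state_scale hmu); last first.
    by apply: (fba_sum hC (F := fun (k : 'I_n) x => ln (Num.max (v (iter k a x)) e))).
  rewrite (state_sum hC hmu (F := fun (k : 'I_n) x => ln (Num.max (v (iter k a x)) e)))//.
  rewrite (eq_bigr (fun=> mu (fun x => ln (Num.max (v x) e)))); last first.
    by move=> k _; rewrite (invariant_state_iter C_dyn k imu Cl).
  by rewrite sumr_const card_ord -mulr_natl; ring.
apply/lee_addgt0Pr => eta eta0.
have n0' : (0 : R) < n%:R by rewrite ltr0n.
have [D pD hD] := tau_nD_le hC (transfer_posop hA) hmu n Cco
   (exprn_gt0 n (powR_gt0 p e0)) (fun x => cocycle_ge n x e0)
   (divr_gt0 eta0 (ltr0n R 2)) kappa0.
apply: (@le_trans _ _ (tau_n C A mu n * (n%:R^-1)%:E)%E).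
  by apply: ereal_inf_lbound; exists n.
apply: (@le_trans _ _ (tau_nD C A mu n D * (n%:R^-1)%:E)%E).
  rewrite lee_wpmul2r ?lee_fin ?invr_ge0//.
  by apply: ereal_inf_lbound; exists D.
have n1 : (0 <= (n%:R^-1)%:E :> \bar R)%E by rewrite lee_fin invr_ge0.
apply: le_trans (lee_wpmul2r n1 hD) _.
rewrite -EFinM -EFinD lee_fin ler_pdivrMr// mulnco.
have : ln (supnorm (iter n A (cocycle e n)) + kappa) <= n%:R * ln c.
  rewrite mulr_natl -lnXn// ler_ln ?posrE ?exprn_gt0//.
    apply: (@le_trans _ _ (b + kappa + kappa)); first by rewrite lerD2r.
    by rewrite /kappa; lra.
  rewrite ltr_wpDl// (supnorm_ge0 hC x0)//; exact: posop_sub hAn _ Cco.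
have := ler_wpM2l (ltW n0') (hL e e0).
have : eta <= n%:R * eta by rewrite -[leLHS]mul1r ler_wpM2r ?(ltW eta0)// ler1n.
by rewrite (mulrC _ n%:R) mulrDr mulrBr; lra.
Qed.

End VariationalUpper.

(** * Invariant subgradients *)

Section HahnBanach.
Variables (R : realType) (X : Type) (C : set (X -> R)).
Hypothesis hC : functional_base_algebra C.
Implicit Types (f g : X -> R) (q : (X -> R) -> R).

Definition sublinear q : Prop :=
  (forall f g, C f -> C g -> q (fun x => f x + g x) <= q f + q g) /\
  (forall c f, 0 <= c -> C f -> q (fun x => c * f x) <= c * q f).

Lemma sublinear0 q : sublinear q -> q (fun=> 0) = 0.
Proof.
move=> [qD qZ]; have C0 := fba_cst hC 0; apply/eqP; rewrite eq_le; apply/andP; split.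
  by have /= := qZ 0 _ (lexx 0) C0; rewrite !mul0r.
have /= := qD _ _ C0 C0; rewrite addr0.
by rewrite -lerBlDl subrr.
Qed.

Lemma sublinear_opp q f : sublinear q -> C f -> - q (fun x => - f x) <= q f.
Proof.
move=> hq Cf; have [qD qZ] := hq.
rewrite -subr_ge0 opprK -[leLHS](sublinear0 hq).
apply: le_trans (qD _ _ Cf (fba_opp hC Cf)).
by rewrite [X in _ <= q X](_ : _ = (fun=> 0))//; apply/funext => x; rewrite subrr.
Qed.

Lemma sublinear_scale q c f : sublinear q -> 0 <= c -> C f ->
  q (fun x => c * f x) = c * q f.
Proof.
move=> hq; have [qD qZ] := hq; rewrite le_eqVlt => /predU1P[<-|c0] Cf.
  rewrite mul0r -[RHS](sublinear0 hq).
  by congr q; apply/funext => x; rewrite mul0r.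
apply/eqP; rewrite eq_le qZ//= ?(ltW c0)//.
rewrite -ler_pdivlMl//.
have := qZ c^-1 _ _ (fba_scale hC c Cf); rewrite invr_ge0 => /(_ (ltW c0)).
apply: le_trans; rewrite le_eqVlt; apply/orP; left; apply/eqP; congr q.
by apply/funext => x; rewrite mulrA mulVf ?mul1r// gt_eqF.
Qed.

(* A minimal sublinear functional [s] is additive: the functional
   [g |-> inf_(t >= 0) (s (g + t f) - t s f)] is sublinear and at most [s]. *)
Lemma minimal_sublinear_linear s : sublinear s ->
  (forall s', sublinear s' -> (forall f, C f -> s' f <= s f) ->
     forall f, C f -> s f <= s' f) ->
  linear_functional_on C s.
Proof.
move=> hs smin; have [sD sZ] := hs.
have superadd f g : C f -> C g -> s g + s f <= s (fun x => g x + f x).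
  move=> Cf Cg.
  pose S h : set R := [set s (fun x => h x + t * f x) - t * s f | t in [set t | 0 <= t]].
  have Ct h t : C h -> C (fun x => h x + t * f x).
    by move=> Ch; apply: fba_add => //; exact: fba_scale.
  have S_lb h : C h -> lbound (S h) (- s (fun x => - h x)).
    move=> Ch _ [t /= t0 <-]; rewrite -(sublinear_scale hs)//.
    have := sD _ _ (Ct h t Ch) (fba_opp hC Ch).
    rewrite (_ : (fun _ => _) = (fun x => t * f x)); last first.
      by apply/funext => x; ring.
    lra.
  have S_inf h : C h -> has_inf (S h).
    move=> Ch; split; last by eexists; exact: S_lb.
    by eexists; exists 0 => /=.
  pose s' h := inf (S h).
  have s'_le h t : C h -> 0 <= t -> s' h <= s (fun x => h x + t * f x) - t * s f.
    by move=> Ch t0; apply: ge_inf; [exact: (S_inf h Ch).2|exists t].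
  have hs' : sublinear s'.
    split=> [h k Ch Ck|c h c0 Ch].
      rewrite -lerBlDr; apply: lb_le_inf; first exact: (S_inf h Ch).1.
      move=> _ [t /= t0 <-]; rewrite lerBlDr -lerBlDl.
      apply: lb_le_inf; first exact: (S_inf k Ck).1.
      move=> _ [u /= u0 <-]; rewrite lerBlDl.
      apply: (le_trans (s'_le _ (t + u) _ _)); [exact: fba_add|exact: addr_ge0|].
      have := sD _ _ (Ct h t Ch) (Ct k u Ck).
      rewrite (_ : (fun _ => _) = (fun x => h x + k x + (t + u) * f x)); last first.
        by apply/funext => x; ring.
      lra.
    move: c0; rewrite le_eqVlt => /predU1P[<-|c0].
      have Ch0 : C (fun x => 0 * h x) by exact: fba_scale.
      apply: (le_trans (s'_le _ 0 Ch0 (lexx _))).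
      rewrite !mul0r subr0 (_ : (fun _ => _) = (fun=> 0)) ?(sublinear0 hs)//.
      by apply/funext => x; ring.
    rewrite mulrC -ler_pdivrMr//; apply: lb_le_inf; first exact: (S_inf h Ch).1.
    move=> _ [u /= u0 <-]; rewrite ler_pdivrMr//.
    have Cch : C (fun x => c * h x) by exact: fba_scale.
    apply: (le_trans (s'_le _ (c * u) Cch _)); first by rewrite mulr_ge0// ltW.
    rewrite (_ : (fun _ => _) = (fun x => c * (h x + u * f x))); last first.
      by apply/funext => x; ring.
    have := sZ c _ (ltW c0) (Ct h u Ch); lra.
  have s's h : C h -> s' h <= s h.
    move=> Ch; apply: (le_trans (s'_le h 0 Ch (lexx _))).
    rewrite mul0r subr0 (_ : (fun _ => _) = h)//.
    by apply/funext => x; ring.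
  have := le_trans (smin _ hs' s's g Cg) (s'_le g 1 Cg ler01).
  rewrite mul1r (_ : (fun _ => _) = (fun x => g x + f x)); first by lra.
  by apply/funext => x; rewrite mul1r.
have add f g : C f -> C g -> s (f \+ g) = s f + s g.
  by move=> Cf Cg; apply/eqP; rewrite eq_le superadd// andbT; exact: sD.
have opp f : C f -> s (fun x => - f x) = - s f.
  move=> Cf; have := add _ _ Cf (fba_opp hC Cf).
  rewrite (_ : f \+ _ = (fun=> 0)); last by apply/funext => x; rewrite /= subrr.
  by rewrite (sublinear0 hs) => /eqP; rewrite eq_sym addrC addr_eq0 => /eqP.
split=> // c f Cf.
have [c0|c0] := leP 0 c; first exact: sublinear_scale.
have := @sublinear_scale s (- c) f hs _ Cf; rewrite oppr_ge0 => /(_ (ltW c0)).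
rewrite (_ : (fun _ => _) = (fun x => - (c * f x))); last first.
  by apply/funext => x; rewrite mulNr.
by rewrite opp ?mulNr; [move=> /oppr_inj|exact: fba_scale].
Qed.

(** Zorn's lemma for sublinear functionals below [q], ordered downwards. The infimum of a chain is
    subadditive because any two members are comparable, and finite because every member satisfies
    [s f >= - q (- f)]. *)
Lemma hahn_banach q : sublinear q ->
  exists2 mu, linear_functional_on C mu & forall f, C f -> mu f <= q f.
Proof.
move=> hq; pose T := {s | sublinear s /\ forall f, C f -> s f <= q f}.
pose t0 : T := exist _ q (conj hq (fun f _ => lexx (q f))).
pose Rel (s t : T) := `[< forall f, C f -> proj1_sig t f <= proj1_sig s f >].
have [||A Atot|[s [hs sq]] smin] := @ZL_preorder T t0 Rel.
- by move=> t; apply/asboolP.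
- move=> r s t /asboolP rs /asboolP st; apply/asboolP => f Cf.
  exact: le_trans (st f Cf) (rs f Cf).
- have [[s0 As0]|noA] := pselect (exists s0 : T, A s0); last first.
    by exists t0 => s As; case: noA; exists s.
  pose S f : set R := [set proj1_sig r f | r in A].
  have S_inf f : C f -> has_inf (S f).
    move=> Cf; split; first by exists (proj1_sig s0 f), s0.
    exists (- q (fun x => - f x)) => _ [[s [hs sq]] As <-] /=.
    by rewrite (le_trans _ (sublinear_opp hs Cf))// lerN2 sq//; exact: fba_opp.
  pose t f := inf (S f).
  have t_le (s : T) f : A s -> C f -> t f <= proj1_sig s f.
    by move=> As Cf; apply: ge_inf; [exact: (S_inf f Cf).2|exists s].
  have ht : sublinear t.
    split=> [f g Cf Cg|c f c0 Cf].
      rewrite -lerBlDr; apply: lb_le_inf; first exact: (S_inf f Cf).1.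
      move=> _ [s1 As1 <-]; rewrite lerBlDr -lerBlDl.
      apply: lb_le_inf; first exact: (S_inf g Cg).1.
      move=> _ [s2 As2 <-]; rewrite lerBlDl.
      have Cfg : C (fun x => f x + g x) by exact: fba_add.
      have [/asboolP h|/asboolP h] := Atot _ _ As1 As2.
        apply: (le_trans (t_le _ _ As2 Cfg)).
        by apply: le_trans ((proj2_sig s2).1.1 _ _ Cf Cg) _; rewrite lerD2r h.
      apply: (le_trans (t_le _ _ As1 Cfg)).
      by apply: le_trans ((proj2_sig s1).1.1 _ _ Cf Cg) _; rewrite lerD2l h.
    have Ccf : C (fun x => c * f x) by exact: fba_scale.
    move: c0; rewrite le_eqVlt => /predU1P[c0|c0].
      apply: (le_trans (t_le _ _ As0 Ccf)).
      have -> : (fun x => c * f x) = (fun=> 0).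
        by apply/funext => x; rewrite -c0 mul0r.
      by rewrite -c0 mul0r (sublinear0 (proj2_sig s0).1).
    rewrite mulrC -ler_pdivrMr//; apply: lb_le_inf; first exact: (S_inf f Cf).1.
    move=> _ [s As <-]; rewrite ler_pdivrMr// mulrC.
    apply: (le_trans (t_le _ _ As Ccf)).
    by apply: (proj2_sig s).1.2 => //; exact: ltW.
  have tq f : C f -> t f <= q f.
    by move=> Cf; apply: le_trans (t_le _ _ As0 Cf) _; exact: (proj2_sig s0).2.
  exists (exist _ t (conj ht tq)) => s As; apply/asboolP => f Cf /=.
  exact: t_le.
- exists s => //; apply: minimal_sublinear_linear => // s' hs' s's f Cf.
  have s'q g : C g -> s' g <= q g by move=> Cg; rewrite (le_trans (s's g Cg))// sq.
  have := smin (exist _ s' (conj hs' s'q)).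
  by move=> /(_ (introT (asboolP _) s's)) /asboolP; exact.
Qed.

Section Subgradient.
Variable a : X -> X.
Hypothesis C_dyn : forall f, C f -> C (f \o a).

(* [S F] plays the role of the set of upper bounds of a convex functional
   [Lambda F] with [Lambda 0 = L0]; the state found is a subgradient at 0. *)
Lemma invariant_subgradient (S : (X -> R) -> set R) (L0 : R) :
  (forall F G s t l, C F -> C G -> S F s -> S G t -> 0 <= l <= 1 ->
     S (fun x => (1 - l) * F x + l * G x) ((1 - l) * s + l * t)) ->
  (forall F G c s, C F -> C G -> S F s -> (forall x, G x <= F x + c) ->
     S G (s + c)) ->
  (forall F g s, C F -> C g -> S F s -> S (fun x => F x + (g (a x) - g x)) s) ->
  (forall s, S (fun=> 0) s -> L0 <= s) ->
  (forall s, L0 < s -> S (fun=> 0) s) ->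
  exists2 mu, invariant_states C a mu &
    forall F s, C F -> S F s -> L0 + mu F <= s.
Proof.
move=> Sconv Sle Scob S0ge S0lt; have C0 := fba_cst hC 0.
(* Difference quotients of the convex functional along [f]; their infimum [q] is its one-sided
   directional derivative at 0. *)
pose Q f : set R := [set y | exists t s, [/\ 0 < t, S (fun x => t * f x) s &
  y = (s - L0) / t]].
have Ct t f : C f -> C (fun x => t * f x) by exact: fba_scale.
have Q_lb f : C f -> has_inf (Q f).
  move=> Cf; have [M M0 fM] := fba_bound hC Cf; split.
    exists ((L0 + 1 + M - L0) / 1), 1, (L0 + 1 + M); split=> //.
    apply: (Sle (fun=> 0)) => //; first exact: Ct.
      by apply: S0lt; rewrite ltrDl.
    by move=> x; rewrite mul1r add0r; have /ler_normlP[] := fM x.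
  exists (- M) => _ [t [s [t0 Ss ->]]]; rewrite ler_pdivlMr//.
  have := Sle _ _ (t * M) _ (Ct t f Cf) C0 Ss.
  have h x : 0 <= t * f x + t * M.
    rewrite -mulrDr mulr_ge0 ?(ltW t0)//.
    by have /ler_normlP[] := fM x; lra.
  by move=> /(_ h)/S0ge; lra.
pose q f := inf (Q f).
have q_le f t s : C f -> 0 < t -> S (fun x => t * f x) s -> q f <= (s - L0) / t.
  move=> Cf t0 Ss; apply: ge_inf; first exact: (Q_lb f Cf).2.
  by exists t, s.
have hq : sublinear q.
  split=> [f g Cf Cg|c f c0 Cf].
    rewrite -lerBlDr; apply: lb_le_inf; first exact: (Q_lb f Cf).1.
    move=> _ [t [s [t0 Ss ->]]]; rewrite lerBlDr -lerBlDl.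
    apply: lb_le_inf; first exact: (Q_lb g Cg).1.
    move=> _ [t' [s' [t'0 Ss' ->]]]; rewrite lerBlDl.
    have tt0 : 0 < t + t' by exact: addr_gt0.
    (* This weight gives [t f] and [t' g] the common coefficient [t t' / (t + t')], so the convex
       combination is a multiple of [f + g]. *)
    have l01 : 0 <= t / (t + t') <= 1.
      by rewrite divr_ge0 ?(ltW t0) ?(ltW tt0)//= ler_pdivrMr// mul1r lerDl ltW.
    have := Sconv _ _ _ _ _ (Ct t f Cf) (Ct t' g Cg) Ss Ss' l01.
    have tt'0 : t + t' != 0 by rewrite gt_eqF.
    have tn0 : t != 0 by rewrite gt_eqF.
    have t'n0 : t' != 0 by rewrite gt_eqF.
    rewrite (_ : (fun _ => _) = (fun x => (t * t' / (t + t')) * (f x + g x))); last first.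
      by apply/funext => x; field.
    move=> /q_le h; apply: le_trans (h (fba_add hC Cf Cg) _) _.
      by rewrite divr_gt0// mulr_gt0.
    rewrite le_eqVlt; apply/orP; left; apply/eqP; field.
    by rewrite t'n0 tn0 tt'0.
  have Ccf := Ct c f Cf.
  move: c0; rewrite le_eqVlt => /predU1P[c0|c0].
    rewrite -c0 mul0r; apply/ler_addgt0Pr => e e0; rewrite add0r.
    have : S (fun x => 1 * (c * f x)) (L0 + e).
      rewrite (_ : (fun _ => _) = (fun=> 0)); first by apply: S0lt; rewrite ltrDl.
      by apply/funext => x; rewrite -c0 mul0r mulr0.
    move=> /(q_le _ _ _ Ccf ltr01); rewrite -c0 divr1.
    have -> : L0 + e - L0 = e by ring.
    by [].
  rewrite mulrC -ler_pdivrMr//; apply: lb_le_inf; first exact: (Q_lb f Cf).1.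
  move=> _ [t [s [t0 Ss ->]]]; rewrite ler_pdivrMr//.
  have : S (fun x => (t / c) * (c * f x)) s.
    rewrite (_ : (fun _ => _) = (fun x => t * f x))//.
    by apply/funext => x; field; rewrite gt_eqF.
  move=> /(q_le _ _ _ Ccf (divr_gt0 t0 c0)) h; apply: (le_trans h).
  rewrite le_eqVlt; apply/orP; left; apply/eqP; field.
  by rewrite !gt_eqF.
have [mu mulin muq] := hahn_banach hq.
have q_cst f c : C f -> (forall x, f x <= c) -> q f <= c.
  move=> Cf fc; apply/ler_addgt0Pr => e e0.
  have : S (fun x => 1 * f x) (L0 + e + c).
    apply: (Sle (fun=> 0)) => //; first exact: Ct.
      by apply: S0lt; rewrite ltrDl.
    by move=> x; rewrite mul1r add0r.
  move=> /(q_le _ _ _ Cf ltr01); rewrite divr1.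
  by have -> : L0 + e + c - L0 = c + e by ring.
have muN f : C f -> mu (fun x => - f x) = - mu f.
  move=> Cf; have := lfun_scale mulin (-1) Cf; rewrite mulN1r => <-.
  by congr mu; apply/funext => x /=; rewrite mulN1r.
have hmu : states C mu.
  split=> //.
    move=> f Cf f0; rewrite -oppr_le0 -muN//.
    apply: le_trans (muq _ (fba_opp hC Cf)) _; apply: q_cst; first exact: fba_opp.
    by move=> x; rewrite oppr_le0.
  have C1 := fba_cst hC 1.
  apply/eqP; rewrite eq_le; apply/andP; split.
    by apply: le_trans (muq _ C1) _; exact: q_cst.
  rewrite -lerN2 -muN//; apply: le_trans (muq _ (fba_opp hC C1)) _.
  by apply: q_cst => //; exact: fba_opp.
(* Coboundaries do not change the pressure, so [mu] is nonpositive on them; applied to [- f] as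
   well, this gives invariance. *)
have cob f : C f -> mu (f \o a) <= mu f.
  move=> Cf; have Cfa := C_dyn Cf.
  rewrite -subr_le0 -(state_sub hC hmu)//.
  have Cd : C (fun x => f (a x) - f x) by exact: (fba_sub hC Cfa Cf).
  apply: le_trans (muq _ Cd) _; apply/ler_addgt0Pr => e e0; rewrite add0r.
  have : S (fun x => 1 * (f (a x) - f x)) (L0 + e).
    have := Scob _ _ _ C0 Cf (S0lt (L0 + e) _); rewrite ltrDl => /(_ e0).
    rewrite (_ : (fun _ => _) = (fun x => 1 * (f (a x) - f x)))//.
    by apply/funext => x; ring.
  move=> /(q_le _ _ _ Cd ltr01); rewrite divr1.
  by have -> : L0 + e - L0 = e by ring.
exists mu.
  split=> // f Cf; apply/eqP; rewrite eq_le cob//=.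
  rewrite -lerN2 -(muN _ Cf) -(muN _ (C_dyn Cf)).
  exact: (cob _ (fba_opp hC Cf)).
move=> F s CF SF; have : S (fun x => 1 * F x) s.
  rewrite (_ : (fun _ => _) = F)//.
  by apply/funext => x; rewrite mul1r.
move=> /(q_le _ _ _ CF ltr01); rewrite divr1.
by have := muq _ CF; lra.
Qed.

(** The subgradient construction for [F |-> inf_g sup (F + g o a - g)]. Its value at 0 is not
    negative: if [g o a - g <= s < 0], then [g] would tend to [-oo] along an orbit although it is
    bounded. *)
Lemma exists_invariant_state (x0 : X) : exists mu, invariant_states C a mu.
Proof.
pose S F : set R := [set s | exists2 g, C g & forall x, F x + (g (a x) - g x) <= s].
have [|||||mu imu _] := @invariant_subgradient S 0; last by exists mu.
- move=> F G s t l CF CG [g Cg hg] [h Ch hh] /andP[l0 l1].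
  exists (fun x => (1 - l) * g x + l * h x).
    by apply: fba_add => //; exact: fba_scale.
  move=> x; have l1' : 0 <= 1 - l by rewrite subr_ge0.
  have := ler_wpM2l l1' (hg x); have := ler_wpM2l l0 (hh x); lra.
- by move=> F G c s CF CG [g Cg hg] h; exists g => // x; have := hg x; have := h x; lra.
- move=> F g s CF Cg [h Ch hh]; exists (fun x => h x - g x); first exact: fba_sub.
  by move=> x; have := hh x; lra.
- move=> s [g Cg hg]; rewrite leNgt; apply/negP => s0.
  have [M M0 gM] := fba_bound hC Cg.
  have it n : g (iter n a x0) <= g x0 + n%:R * s.
    elim: n => [|n ih]; first by rewrite mul0r addr0.
    have := hg (iter n a x0); rewrite add0r /= -[n.+1%:R]natr1; lra.
  pose n := (Num.truncn (2 * M / - s)).+1.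
  have := truncnS_gt (2 * M / - s); rewrite ltr_pdivrMr ?oppr_gt0// -/n => hn.
  have := it n; have /ler_normlP[] := gM x0; have /ler_normlP[] := gM (iter n a x0).
  lra.
- move=> s s0; exists (fun=> 0); first exact: fba_cst.
  by move=> x; rewrite subrr addr0 ltW.
Qed.

End Subgradient.
End HahnBanach.

(** * Existence of an equilibrium state *)

Section Duality.
Variable R : realType.

(** A second-order lower bound, from [ln (1 + z) = - ln (1 - z / (1 + z)) >= z - z^2 / (1 + z)] and
    [1 + z >= 1/2]. *)
Lemma ln1D_ge (z : R) : - 2^-1 <= z -> z - 2 * z ^+ 2 <= ln (1 + z).
Proof.
move=> z2; have z1 : 0 < 1 + z by lra.
have e : (1 + z)^-1 = 1 + - (z / (1 + z)) by field; rewrite gt_eqF.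
have zV : -1 < - (z / (1 + z)).
  by have : 0 < (1 + z)^-1 by [rewrite invr_gt0]; rewrite [X in _ < X]e; lra.
have := le_ln1Dx zV; rewrite -e lnV ?posrE// lerN2; apply: le_trans.
have -> : z / (1 + z) = z - z ^+ 2 / (1 + z) by field; rewrite gt_eqF.
rewrite lerD2l lerN2 ler_pdivrMr// mulrAC.
have := sqr_ge0 z; nra.
Qed.

Lemma seq_pos_lb (I : eqType) (D : seq I) (f : I -> R) :
  (forall g, g \in D -> 0 < f g) ->
  exists2 k : R, 0 < k & forall g, g \in D -> k <= f g.
Proof.
elim: D => [|g D ih] h; first by exists 1.
have [i iD|k k0 kD] := ih; first by apply: h; rewrite inE iD orbT.
exists (Num.min k (f g)); first by rewrite lt_min k0 h// mem_head.
move=> i; rewrite inE => /predU1P[->|/kD ki]; first by rewrite ge_min lexx orbT.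
by rewrite ge_min ki.
Qed.

(* First-order optimality of a near-maximizer of [v |-> \sum_g mu g * ln (v g)]
   on a convex set: moving slightly from [w] towards [v] cannot increase the
   objective noticeably. *)
Lemma near_maximizer (I : eqType) (D : seq I) (mu : I -> R)
    (K : set (I -> R)) (k B xi : R) :
  (forall g, g \in D -> 0 <= mu g) -> \sum_(g <- D) mu g = 1 ->
  (forall v w t, K v -> K w -> 0 <= t <= 1 ->
     K (fun g => (1 - t) * v g + t * w g)) ->
  K !=set0 -> 0 < k -> 0 < xi ->
  (forall v g, K v -> g \in D -> k <= v g <= B) ->
  exists2 w, K w & forall v, K v -> \sum_(g <- D) mu g * (v g / w g) <= 1 + xi.
Proof.
move=> mu0 mu1 Kconv [u Ku] k0 xi0 KB.
pose G v := \sum_(g <- D) mu g * ln (v g).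
have D0 : exists g, g \in D.
  case: (D) mu1 => [|g D' _]; first by move=> /esym/eqP; rewrite big_nil oner_eq0.
  by exists g; rewrite mem_head.
have [g0 g0D] := D0.
have kB : k <= B by have /andP[] := KB _ _ Ku g0D; exact: le_trans.
pose Y := 1 + B / k.
have Bk0 : 0 <= B / k by rewrite divr_ge0 ?(ltW k0)// (le_trans (ltW k0)).
have Y1 : 1 <= Y by rewrite lerDl.
(* [Y] bounds [|v g / w g - 1|]. The first term gives [t Y <= 1/2], as [ln1D_ge] requires; the
   second keeps the quadratic loss [2 (t Y)^2] below [t xi / 2]. The other half of the gain [t xi]
   then exceeds the slack allowed to the near-maximizer. *)
pose t := Num.min (2 * Y)^-1 (xi / (4 * Y ^+ 2)).
have Y0 : 0 < Y by exact: lt_le_trans Y1.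
have t0 : 0 < t.
  by rewrite lt_min invr_gt0 divr_gt0 ?mulr_gt0 ?exprn_gt0.
have t1 : t * Y <= 2^-1.
  apply: (@le_trans _ _ ((2 * Y)^-1 * Y)).
    by rewrite ler_wpM2r ?(ltW Y0)// /t ge_min lexx.
  by rewrite invfM -mulrA mulVf ?mulr1// gt_eqF.
have t2 : t * Y ^+ 2 <= xi / 4.
  apply: (@le_trans _ _ (xi / (4 * Y ^+ 2) * Y ^+ 2)).
    by rewrite ler_wpM2r ?exprn_ge0 ?(ltW Y0)// /t ge_min lexx orbT.
  by rewrite le_eqVlt; apply/orP; left; apply/eqP; field; rewrite gt_eqF.
have tle1 : t <= 1.
  by have : t * 1 <= t * Y by [rewrite ler_wpM2l ?(ltW t0)]; lra.
pose S : set R := [set G v | v in K].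
have hS : has_sup S.
  split; first by exists (G u), u.
  exists (\sum_(g <- D) mu g * ln B) => _ [v Kv <-].
  rewrite /G big_seq [leRHS]big_seq; apply: ler_sum => g gD.
  have /andP[kv vB] := KB _ _ Kv gD.
  by rewrite ler_wpM2l ?mu0// ler_ln// posrE (lt_le_trans k0)// (le_trans kv).
have eta0 : 0 < t * xi / 2 by rewrite divr_gt0// mulr_gt0.
have [_ [w Kw <-] hw] := sup_adherent eta0 hS.
exists w => // v Kv; rewrite leNgt; apply/negP => hv.
pose vt g := (1 - t) * w g + t * v g.
have Kvt : K vt by apply: Kconv => //; rewrite (ltW t0).
have Gvt : G vt <= sup S by apply: ub_le_sup; [exact: hS.2|exists vt].
have : G w + t * xi - 2 * (t * Y) ^+ 2 <= G vt.
  apply: (@le_trans _ _ (\sum_(g <- D) (mu g * ln (w g) +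
      t * (mu g * (v g / w g) - mu g) - 2 * (t * Y) ^+ 2 * mu g))).
    rewrite sumrB big_split/= -!mulr_sumr sumrB mu1 mulr1 -/(G w) lerD2r lerD2l.
    by rewrite ler_wpM2l ?(ltW t0)//; lra.
  rewrite /G big_seq [leRHS]big_seq; apply: ler_sum => g gD.
  have /andP[kv vB] := KB _ _ Kv gD; have /andP[kw wB] := KB _ _ Kw gD.
  have w0 : 0 < w g by exact: lt_le_trans kw.
  have v0' : 0 < v g by exact: lt_le_trans kv.
  pose y := v g / w g - 1.
  have yY : `|y| <= Y.
    rewrite ler_norml; apply/andP; split.
      by rewrite /y; have : 0 <= v g / w g by [rewrite divr_ge0// ltW]; lra.
    have : v g / w g <= B / k.
      by rewrite ler_pM ?invr_ge0 ?(ltW v0') ?(ltW w0)// lef_pV2.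
    by rewrite /y /Y; lra.
  have tyY : `|t * y| <= t * Y by rewrite normrM (gtr0_norm t0) ler_wpM2l ?(ltW t0).
  have z2 : - 2^-1 <= t * y by move: tyY; rewrite ler_norml => /andP[]; lra.
  have z1 : 0 < 1 + t * y by lra.
  have vtE : vt g = w g * (1 + t * y) by rewrite /vt /y; field; rewrite gt_eqF.
  have sq : (t * y) ^+ 2 <= (t * Y) ^+ 2.
    by rewrite -[leLHS]real_normK ?num_real// lerXn2r ?nnegrE ?mulr_ge0 ?(ltW t0) ?(ltW Y0).
  have := ln1D_ge z2; rewrite vtE lnM ?posrE// => hl.
  have := ler_wpM2l (mu0 _ gD) hl; have := ler_wpM2l (mu0 _ gD) sq.
  have -> : mu g * (v g / w g) - mu g = mu g * y by rewrite /y; ring.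
  by move: (ln (w g)) (ln (1 + t * y)) (mu g) => l1 l2 c; lra.
have : 2 * (t * Y) ^+ 2 <= t * xi / 2.
  have -> : 2 * (t * Y) ^+ 2 = 2 * t * (t * Y ^+ 2) by ring.
  have -> : t * xi / 2 = 2 * t * (xi / 4) by field.
  by rewrite ler_wpM2l// mulr_ge0// ltW.
by lra.
Qed.

Variables (X : Type) (C : set (X -> R)).
Hypothesis hC : functional_base_algebra C.
Variables (A : (X -> R) -> (X -> R)) (hA : positive_operator C A).
Variables (mu : (X -> R) -> R) (hmu : states C mu).

(** Averaging states one at a time: a mixture with positive weights is positive wherever one of its
    components is. *)
Lemma common_positive_state (x0 : X) (D : seq (X -> R)) :
  (forall g, g \in D -> C g) ->
  (forall g, g \in D -> exists2 m, states C m & 0 < m g) ->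
  (forall g, g \in D -> forall x, 0 <= g x) ->
  exists2 m, states C m & forall g, g \in D -> 0 < m g.
Proof.
elim: D => [|g D ih] CD hD D0; first by exists (fun f => f x0) => //; exact: state_eval.
have sub h : h \in D -> h \in g :: D by rewrite inE => ->; rewrite orbT.
have [||h /sub/D0//|m hm mD] := ih; [by move=> h /sub/CD|by move=> h /sub/hD|].
have [m' hm' m'g] := hD g (mem_head _ _).
exists (fun f => (1 - 2^-1) * m f + 2^-1 * m' f).
  apply: (state_mix hC hm hm'); lra.
move=> h; rewrite inE => /predU1P[->|hD'].
  have := state_ge0 hm (CD g (mem_head _ _)) (D0 g (mem_head _ _)); lra.
have hgD := sub _ hD'.
have := mD h hD'; have := state_ge0 hm' (CD h hgD) (D0 h hgD); lra.
Qed.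

(** For a near-maximizer [w] of [sum_g mu g * ln (m (A^n g))] the weights are essentially
    [mu g / w g]: first-order optimality, tested at the point evaluations, is the constraint
    [sum_g c g * A^n g <= 1] up to a factor close to 1. The rest of the proof handles the [g] with
    [mu g = 0] and keeps the values [m (A^n g)] away from 0. *)
Lemma tau_duality (x0 : X) n (D : {fset (X -> R)}) (s eta : R) :
  partition_of_unity C D -> (tau_nD C A mu n D <= s%:E)%E -> 0 < eta ->
  exists c : (X -> R) -> R, [/\ forall g, g \in D -> 0 < c g,
    forall x, \sum_(g <- D) c g * iter n A g x <= 1 &
    - (s + eta) <= \sum_(g <- D) mu g * ln (c g)].
Proof.
move=> [CD D0 D1] hs eta0; have hAn := posop_iter n hA.
have CAg g : g \in D -> C (iter n A g) by move=> /CD; exact: posop_sub.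
have Ag0 g : g \in D -> forall x, 0 <= iter n A g x.
  by move=> gD; apply: (posop_ge0 hAn); [exact: CD|exact: D0].
have mu0 g : g \in D -> 0 <= mu g by move=> gD; apply: (state_ge0 hmu); [exact: CD|exact: D0].
have muD1 : \sum_(g <- D) mu g = 1.
  rewrite -(state_sum hC hmu (F := id))// -[RHS](state_cst hC hmu 1).
  by congr mu; apply/funext.
pose b := supnorm (iter n A (fun=> 1)).
have C1 := fba_cst hC 1.
have b0 : 0 <= b by apply: (supnorm_ge0 hC x0); exact: posop_sub.
have g1 g x : g \in D -> g x <= 1.
  move=> gD; rewrite -(D1 x) (big_fsetD1 g)//= lerDl big_seq sumr_ge0// => h.
  by rewrite !inE => /andP[_ /D0].
have mB m g : states C m -> g \in D -> m (iter n A g) <= b + 1.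
  move=> hm gD; apply: (@le_trans _ _ b); last by rewrite lerDl.
  apply: (state_le_cst hC hm); first exact: CAg.
  move=> x; apply: le_trans (le_supnorm hC x (posop_sub hAn C1)).
  by apply: (posop_le hC hAn) => //; [exact: CD|move=> y; exact: g1].
set B := b + 1 in mB; have B0 : 0 < B by rewrite ltr_wpDl.
pose N : R := (size (enum_fset D)).+1%:R.
have N0 : 0 < N by [].
have sumN (y : R) : 0 <= y -> \sum_(g <- D) y <= N * y.
  move=> y0; rewrite big_const_seq count_predT iter_addr_0 -mulr_natl.
  by rewrite ler_wpM2r// ler_nat.
(* In the degenerate case some [g0] with [mu g0 > 0] is killed by [A^n], as point evaluations
   show. *)
have [allpos|] := pselect (forall g, g \in D -> mu g != 0 ->
    exists2 m, states C m & 0 < m (iter n A g)); last first.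
  move=> /existsNP[g0 /not_implyP[g0D /not_implyP[mug0 nom]]].
  have Pg0 x : iter n A g0 x = 0.
    apply/eqP; rewrite eq_le Ag0// andbT leNgt; apply/negP => h; apply: nom.
    by exists (fun f => f x) => //; exact: state_eval.
  have mup : 0 < mu g0 by rewrite lt_def mug0 mu0.
  pose d := (N * B)^-1; have d0 : 0 < d by rewrite invr_gt0 mulr_gt0.
  (* The weight of [g0] is free of constraint since [A^n g0 = 0], so it is taken large enough to
     outweigh both [s + eta] and the logarithms of the small weights [d]. *)
  pose L := (`|ln d| + `|s + eta|) / mu g0.
  exists (fun g => if g == g0 then expR L else d); split.
  - by move=> g _; case: ifP; rewrite ?expR_gt0.
  - move=> x; apply: (@le_trans _ _ (\sum_(g <- D) d * B)); last first.
      apply: (le_trans (sumN _ _)); first by rewrite mulr_ge0 ?ltW.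
      by rewrite mulrCA /d mulVf// gt_eqF// mulr_gt0.
    rewrite big_seq [leRHS]big_seq; apply: ler_sum => g gD.
    case: eqP => [->|_]; first by rewrite Pg0 mulr0 mulr_ge0 ?ltW.
    by rewrite ler_wpM2l ?(ltW d0)//; exact: (mB (fun f => f x) g (state_eval C x) gD).
  - have : \sum_(g <- D) mu g * (- `|ln d|) + (`|ln d| + `|s + eta|) <=
        \sum_(g <- D) mu g * ln (if g == g0 then expR L else d).
      rewrite (big_fsetD1 g0)//= [leRHS](big_fsetD1 g0)//= eqxx expRK.
      have -> : mu g0 * L = `|ln d| + `|s + eta|.
        by rewrite /L; field; rewrite gt_eqF.
      have : mu g0 * (- `|ln d|) <= 0.
        by rewrite mulrN oppr_le0 mulr_ge0// ltW.
      have : \sum_(g <- (D `\ g0)%fset) mu g * (- `|ln d|) <=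
          \sum_(g <- (D `\ g0)%fset) mu g * ln (if g == g0 then expR L else d).
        rewrite big_seq [leRHS]big_seq; apply: ler_sum => g.
        rewrite !inE => /andP[/negbTE -> gD]; rewrite ler_wpM2l ?mu0//.
        by rewrite lerNl -normrN ler_norm.
      lra.
    rewrite -mulr_suml muD1 mul1r.
    have := ler_norm (- (s + eta)); rewrite normrN; lra.
pose D' := [seq g <- enum_fset D | mu g != 0].
have D'D g : g \in D' -> g \in D by rewrite mem_filter => /andP[].
have muD'1 : \sum_(g <- D') mu g = 1.
  rewrite -muD1 big_filter [RHS](bigID (fun g => mu g == 0))/=.
  by rewrite [X in _ = X + _]big1 ?add0r// => g /eqP.
have [||y /mapP[g /D'D gD ->]|m0 hm0 m0D] :=
  common_positive_state x0 (D := [seq iter n A g | g <- D']).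
- by move=> _ /mapP[g /D'D gD ->]; exact: CAg.
- move=> _ /mapP[g gD' ->]; apply: allpos; first exact: D'D.
  by move: gD'; rewrite mem_filter => /andP[].
- exact: Ag0.
have [k0 k00 k0D] : exists2 k : R, 0 < k & forall g, g \in D' -> k <= m0 (iter n A g).
  by apply: seq_pos_lb => g gD'; apply: m0D; apply/mapP; exists g.
pose xi := Num.min 1 (eta / 4).
have xi0 : 0 < xi by rewrite lt_min ltr01/= divr_gt0.
have xi1 : xi <= 1 by rewrite /xi ge_min lexx.
have xi_eta : 4 * xi <= eta.
  have : xi <= eta / 4 by rewrite /xi ge_min lexx orbT.
  lra.
pose t := xi / (1 + xi).
have xi1' : 0 < 1 + xi by rewrite addr_gt0.
have t0 : 0 < t by rewrite divr_gt0.
have t1 : t <= 1 by rewrite ler_pdivrMr// mul1r lerDr.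
have t01 : 0 <= t <= 1 by rewrite ltW.
have tE : 1 - t = (1 + xi)^-1 by rewrite /t; field; rewrite gt_eqF.
(* Value vectors of states, kept above [t k0] on the members of positive mass. Mixing any state with
   [m0] in proportion [t] enters this set, and [1 - t = 1 / (1 + xi)] makes the loss a factor
   [1 + xi]. *)
pose K : set ((X -> R) -> R) := [set v | exists2 m, states C m &
  v = (fun g => m (iter n A g)) /\ forall g, g \in D' -> t * k0 <= v g].
have Kmix m : states C m -> K (fun g => (1 - t) * m (iter n A g) + t * m0 (iter n A g)).
  move=> hm; exists (fun f => (1 - t) * m f + t * m0 f); first exact: (state_mix hC).
  split=> // g gD'; have gD := D'D _ gD'.
  rewrite -[leLHS]add0r lerD ?ler_wpM2l ?(ltW t0)// ?k0D//.
  by rewrite mulr_ge0 ?subr_ge0//; apply: (state_ge0 hm); [exact: CAg|exact: Ag0].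
have [||v w r [m hm [-> mk]] [m' hm' [-> m'k]] /andP[r0 r1]||||
    v g [m hm [-> mk]] gD'|w [m hm [wE wk]] hw] :=
    @near_maximizer _ D' mu K (t * k0) B xi.
- by move=> g /D'D; exact: mu0.
- exact: muD'1.
- exists (fun f => (1 - r) * m f + r * m' f).
    by apply: (state_mix hC) => //; rewrite r0.
  split=> // g gD'; have r1' : 0 <= 1 - r by rewrite subr_ge0.
  have := ler_wpM2l r1' (mk g gD'); have := ler_wpM2l r0 (m'k g gD'); lra.
- by eexists; exact: Kmix hm0.
- exact: mulr_gt0.
- exact: xi0.
- by rewrite mk//= mB//; exact: D'D.
(* The normalization: [(1 + xi)^2] from the optimality inequality and the mixing loss, and [xi] from
   the members with [mu g = 0]. As [xi <= 1], it is at most [1 + 4 xi]. *)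
pose Z := (1 + xi) ^+ 2 + xi.
have Z1 : 1 <= Z by rewrite /Z expr2; nra.
have Z0 : 0 < Z by lra.
have lnZ : ln Z <= eta.
  apply: (@le_trans _ _ (ln (1 + 4 * xi))).
    by rewrite ler_ln ?posrE// /Z; [rewrite expr2; nra|lra].
  by apply: le_trans xi_eta; apply: le_ln1Dx; lra.
have w0 g : g \in D' -> 0 < w g by move=> /wk; apply: lt_le_trans; exact: mulr_gt0.
have inD' g : g \in D -> mu g != 0 -> g \in D' by rewrite mem_filter => -> ->.
(* Members of mass zero get a small positive weight, since every [c g] must be positive for
   [sum_g c g * g] to be bounded away from 0. *)
pose c g := (if mu g == 0 then xi / (N * B) else mu g / w g) / Z.
exists c; split.
- move=> g gD; rewrite divr_gt0//; case: eqP => [_|/eqP mug].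
    by rewrite divr_gt0// mulr_gt0.
  by rewrite divr_gt0 ?w0// ?inD'// lt_def mug mu0.
- move=> x; have /hw := Kmix _ (state_eval C x).
  have : \sum_(g <- D') mu g * (((1 - t) * iter n A g x) / w g) <=
      \sum_(g <- D') mu g * (((1 - t) * iter n A g x + t * m0 (iter n A g)) / w g).
    rewrite big_seq [leRHS]big_seq; apply: ler_sum => g gD'.
    have gD := D'D _ gD'.
    rewrite ler_wpM2l ?mu0// ler_wpM2r ?invr_ge0 ?(ltW (w0 _ gD'))// lerDl.
    by rewrite mulr_ge0 ?(ltW t0)//; apply: (state_ge0 hm0); [exact: CAg|exact: Ag0].
  move=> /le_trans/[apply].
  rewrite (eq_bigr (fun g => (1 - t) * (mu g * (iter n A g x / w g)))); last first.
    by move=> g _; ring.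
  rewrite -mulr_sumr tE mulrC ler_pdivrMr// -expr2 => hD'.
  rewrite /c (eq_bigr (fun g =>
    ((if mu g == 0 then xi / (N * B) else mu g / w g) *
      iter n A g x) / Z)); last first.
    by move=> g _; rewrite mulrAC.
  rewrite -mulr_suml ler_pdivrMr// mul1r (bigID (fun g => mu g == 0))/= addrC.
  apply: lerD.
    move: hD'; rewrite big_filter; apply: le_trans.
    rewrite le_eqVlt; apply/orP; left; apply/eqP; apply: eq_bigr => g /negbTE ->.
    by rewrite mulrAC mulrA.
  apply: (@le_trans _ _ (\sum_(g <- D) xi / N)); last first.
    apply: (le_trans (sumN _ _)); first by rewrite divr_ge0 ?ltW.
    by rewrite mulrCA divff ?mulr1// gt_eqF.
  rewrite big_mkcond/= big_seq [leRHS]big_seq; apply: ler_sum => g gD.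
  case: ifP => [->/=|_]; last by rewrite divr_ge0 ?ltW.
  have /= h := mB (fun f => f x) g (state_eval C x) gD.
  apply: le_trans (ler_wpM2l (ltW (divr_gt0 xi0 (mulr_gt0 N0 B0))) h) _.
  by rewrite le_eqVlt; apply/orP; left; apply/eqP; field; rewrite !gt_eqF.
- pose T g := if mu g == 0 then 0 else mu g * ln (w g / mu g).
  have hT : \sum_(g <- D) T g <= s.
    rewrite -lee_fin -sumEFin; apply: le_trans hs.
    apply: le_trans (ereal_sup_ubound _); last by exists m.
    rewrite big_seq [leRHS]big_seq; apply: lee_sum => g gD.
    rewrite /tau_term /T; case: eqP => // /eqP mug.
    have wg := w0 _ (inD' _ gD mug).
    by rewrite wE in wg *; rewrite lne_EFin ?divr_gt0// ?EFinM// lt_def mug mu0.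
  have -> : \sum_(g <- D) mu g * ln (c g) = \sum_(g <- D) (- T g - mu g * ln Z).
    apply: eq_big_seq => g gD; rewrite /c /T; case: eqP => [->|/eqP mug].
      by rewrite !mul0r oppr0 addr0.
    have wg := w0 _ (inD' _ gD mug).
    have mup : 0 < mu g by rewrite lt_def mug mu0.
    by rewrite !ln_div ?posrE ?divr_gt0//; ring.
  by rewrite sumrB sumrN -mulr_suml muD1; lra.
Qed.

End Duality.

(** * Pressure and the lower bound *)

Section VariationalLower.
Variables (R : realType) (X : Type) (C : set (X -> R)).
Hypothesis hC : functional_base_algebra C.
Implicit Types (f g F G : X -> R).

(** Hölder's inequality for a positive operator in logarithmic form: with [F] and [G] normalized by
    [al] and [be], it is the convexity of [exp] integrated by [P]. *)
Lemma posop_expR_convex P F G (al be l : R) : positive_operator C P ->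
  C F -> C G -> 0 <= l <= 1 ->
  (forall x, P (fun y => expR (F y)) x <= expR al) ->
  (forall x, P (fun y => expR (G y)) x <= expR be) ->
  forall x, P (fun y => expR ((1 - l) * F y + l * G y)) x <=
    expR ((1 - l) * al + l * be).
Proof.
move=> hP CF CG /andP[l0 l1] hF hG x; set ga := _ * al + _.
have Ce f : C f -> C (fun y => expR (f y)) by exact: fba_exp.
pose c1 := expR ga * (1 - l) * expR (- al).
pose c2 := expR ga * l * expR (- be).
have l1' : 0 <= 1 - l by rewrite subr_ge0.
have c10 : 0 <= c1 by rewrite !mulr_ge0 ?expR_ge0.
have c20 : 0 <= c2 by rewrite !mulr_ge0 ?expR_ge0.
have CF' : C (fun y => c1 * expR (F y)) by apply: fba_scale => //; exact: Ce.
have CG' : C (fun y => c2 * expR (G y)) by apply: fba_scale => //; exact: Ce.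
apply: (@le_trans _ _ (P (fun y => c1 * expR (F y) + c2 * expR (G y)) x)).
  apply: (posop_le hC hP); first by apply: Ce; apply: fba_add => //; exact: fba_scale.
    exact: fba_add.
  move=> y; set u := F y - al; set w := G y - be.
  have -> : (1 - l) * F y + l * G y = ga + ((1 - l) * u + l * w).
    by rewrite /ga /u /w; ring.
  have -> : c1 * expR (F y) + c2 * expR (G y) =
      expR ga * ((1 - l) * expR u + l * expR w).
    by rewrite /c1 /c2 /u /w !expRD; ring.
  rewrite expRD ler_wpM2l ?expR_ge0//; set m := (1 - l) * u + l * w.
  have := ler_wpM2l l1' (expR_tangent u m); have := ler_wpM2l l0 (expR_tangent w m).
  have : (1 - l) * (expR m * (1 + (u - m))) + l * (expR m * (1 + (w - m))) = expR m.
    by rewrite /m; ring.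
  lra.
rewrite (posop_add hP)// !(posop_scale hP)//; try exact: Ce.
apply: (@le_trans _ _ (c1 * expR al + c2 * expR be)).
  by rewrite lerD// ler_wpM2l.
rewrite le_eqVlt; apply/orP; left; apply/eqP; rewrite /c1 /c2 -!mulrA.
by rewrite -!expRD !addNr expR0; ring.
Qed.

Lemma expR_mean (N : nat) (h : 'I_N -> R) : (0 < N)%N ->
  expR (N%:R^-1 * \sum_(j < N) h j) <= N%:R^-1 * \sum_(j < N) expR (h j).
Proof.
move=> N0; set m := N%:R^-1 * _.
have N0' : (0 : R) < N%:R by rewrite ltr0n.
have : \sum_(j < N) expR m * (1 + (h j - m)) <= \sum_(j < N) expR (h j).
  by apply: ler_sum => j _; exact: expR_tangent.
rewrite -mulr_sumr !big_split/= sumrN !sumr_const card_ord -mulr_natl mulr1.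
have -> : \sum_(i < N) h i = N%:R * m by rewrite /m mulVKf// gt_eqF.
rewrite -(mulr_natl m) subrr addr0 => hm.
by rewrite -ler_pdivrMl ?invr_gt0// invrK mulrC.
Qed.

(** Grouping by residue modulo [N] splits an orbit segment into [N] progressions of step [N]. *)
Lemma sum_mul_reindex (N k : nat) (h : nat -> R) :
  \sum_(l < k * N) h l = \sum_(j < N) \sum_(i < k) h (i * N + j)%N.
Proof.
elim: k => [|k ih].
  by rewrite mul0n big_ord0 big1// => j _; rewrite big_ord0.
under [RHS]eq_bigr do rewrite big_ord_recr/=.
rewrite big_split/= -ih -!(big_mkord xpredT) mulSn addnC.
rewrite (big_cat_nat (n := k * N)) ?leq_addr//=; congr (_ + _).
rewrite -{1}[(k * N)%N]add0n big_addn addKn !big_mkord.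
by apply: eq_bigr => j _; rewrite addnC.
Qed.

Variables (a : X -> X) (A : (X -> R) -> (X -> R)).
Hypothesis C_dyn : forall f, C f -> C (f \o a).
Hypothesis hA : transfer_operator C a A.

Lemma fba_birkhoff F n : C F -> C (fun y => \sum_(k < n) F (iter k a y)).
Proof.
move=> CF; apply: (fba_sum hC (F := fun (k : 'I_n) y => F (iter k a y))) => k _.
exact: (fba_dyn C_dyn k CF).
Qed.

(* If [A^N f0 <= 1] then the potential [F = (ln f0) / N] has nonpositive
   pressure: by convexity of [exp] the Birkhoff sum of [F] over [k * N] steps is
   controlled by the [N] products of [f0] along the steps of length [N]. *)
Lemma birkhoff_average_pressure (x0 : X) f0 (c0 d : R) N : C f0 -> 0 < c0 ->
  (forall x, c0 <= f0 x) -> (forall x, iter N A f0 x <= 1) -> (0 < N)%N ->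
  0 < d ->
  exists M : R, forall n x, iter n A (fun y =>
    expR (\sum_(k < n) ln (f0 (iter k a y)) / N%:R)) x <= expR (M + d * n%:R).
Proof.
move=> Cf0 c00 cf0 Af0 N0 d0.
have C1 := fba_cst hC 1; have hAn n := transfer_iter hA n.
have f00 y : 0 < f0 y by exact: lt_le_trans (cf0 y).
have Clnf0 := fba_ln hC Cf0 c00 cf0.
pose F y := ln (f0 y) / N%:R.
have CF : C F.
  rewrite (_ : F = (fun y => N%:R^-1 * ln (f0 y))); first exact: fba_scale.
  by apply/funext => y; rewrite /F mulrC.
pose u y := expR (F y).
have Cu : C u by exact: fba_exp.
pose P f := A (fun x => u x * f x).
have hP : positive_operator C P.
  by apply: posop_mul => //; [exact: transfer_posop hA|move=> x; exact: expR_ge0].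
have PE n : iter n P (fun=> 1) =
    iter n A (fun y => expR (\sum_(k < n) F (iter k a y))).
  rewrite (weighted_iter hC C_dyn hA)//; congr (iter n A _); apply/funext => y.
  by rewrite mulr1 expR_sum.
pose b n := supnorm (iter n P (fun=> 1)).
have CP n : C (iter n P (fun=> 1)) by exact: (posop_sub (posop_iter n hP)).
have b0 n : 0 <= b n by apply: (supnorm_ge0 hC x0).
have bsub m n : b (m + n)%N <= b m * b n by exact: posop_supnorm_submul hP.
pose E k y := \prod_(i < k) f0 (iter (i * N) a y).
have CE k : C (E k).
  by apply: fba_prod => // i; exact: (fba_dyn C_dyn (i * N) Cf0).
have E0 k y : 0 <= E k y by apply: prodr_ge0 => i _; exact: ltW.
(* The transfer identity takes the last factor of [E k.+1] out of [A^(k N)]; the inductive bound and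
   [A^N f0 <= 1] finish. *)
have AE k x : iter (k * N) A (E k) x <= 1.
  elim: k x => [|k ih] x; first by rewrite mul0n /= /E big_ord0.
  rewrite mulSn iterD /=.
  have -> : E k.+1 = (fun y => f0 (iter (k * N) a y) * E k y).
    by apply/funext => y; rewrite /E big_ord_recr/= mulrC.
  rewrite (transfer_iter_id C_dyn hA _ Cf0 (CE k)).
  have CAE : C (iter (k * N) A (E k)) by exact: (posop_sub (hAn _)).
  apply: le_trans (Af0 x); apply: (posop_le hC (hAn N)) => //.
    exact: fba_mul.
  by move=> y; rewrite -[leRHS]mulr1 ler_wpM2l// ltW.
pose K0 := \sum_(j < N.+1) supnorm (iter j A (fun=> 1)).
have CA1 j : C (iter j A (fun=> 1)) by exact: (posop_sub (hAn j)).
have K0le j x : (j <= N)%N -> iter j A (fun=> 1) x <= K0.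
  move=> jN; apply: le_trans (le_supnorm hC x (CA1 j)) _.
  rewrite /K0 (bigD1 (Ordinal (jN : (j < N.+1)%N)))//= lerDl sumr_ge0// => i _.
  exact: (supnorm_ge0 hC x0).
have K00 : 0 <= K0 by apply: sumr_ge0 => i _; exact: (supnorm_ge0 hC x0).
have [Mf Mf0 fM] := fba_bound hC Cf0.
(* For the progression starting at [j], the shift by [a^j] leaves [A^j] at the cost of
   [A^j 1 <= K0]. The last factor of [E k.+1] is bounded by [Mf], and the remaining [N - j] steps by
   [K0] again. *)
have AEj k j x : (j < N)%N ->
    iter (k.+1 * N) A (fun y => E k.+1 (iter j a y)) x <= K0 * (Mf * K0).
  move=> jN.
  have -> : (k.+1 * N = ((N - j) + k * N) + j)%N.
    by rewrite mulSn addnAC subnK// ltnW.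
  rewrite iterD.
  have -> : iter j A (fun y => E k.+1 (iter j a y)) =
      (fun y => E k.+1 y * iter j A (fun=> 1) y).
    rewrite -(transfer_iter_id C_dyn hA j (CE k.+1) C1).
    by congr (iter j A _); apply/funext => y; rewrite mulr1.
  have hm := hAn ((N - j) + k * N)%N.
  have CEk1 : C (fun y => K0 * Mf * E k y) by exact: fba_scale.
  apply: (@le_trans _ _ (iter (N - j + k * N) A (fun y => K0 * Mf * E k y) x)).
    apply: (posop_le hC hm) => //; first by apply: fba_mul.
    move=> y; apply: (@le_trans _ _ (E k.+1 y * K0)).
      by rewrite ler_wpM2l// K0le// ltnW.
    rewrite mulrC -mulrA ler_wpM2l// /E big_ord_recr/= -/(E k y) mulrC ler_wpM2r//.
    exact: le_trans (ler_norm _) (fM _).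
  rewrite (posop_scale hm)// mulrA ler_wpM2l ?mulr_ge0 ?(ltW Mf0)//.
  rewrite iterD; apply: le_trans (K0le (N - j)%N x (leq_subr _ _)).
  apply: (posop_le hC (hAn _)) => //; exact: (posop_sub (hAn _)).
pose K := K0 * (Mf * K0) + 1.
have K1 : 1 <= K by rewrite lerDr !mulr_ge0// ltW.
have bK k : b (k.+1 * N)%N <= K.
  apply: (supnorm_le x0) => x; rewrite (posop_ge0 (posop_iter _ hP))//=.
  rewrite PE.
  have hm := hAn (k.+1 * N)%N.
  have CEj (j : 'I_N) : C (fun y => E k.+1 (iter j a y)).
    exact: (fba_dyn C_dyn j (CE k.+1)).
  have CS : C (fun y => \sum_(j < N) E k.+1 (iter j a y)).
    by apply: (fba_sum hC (F := fun (j : 'I_N) y => E k.+1 (iter j a y))).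
  apply: (@le_trans _ _ (iter (k.+1 * N) A
      (fun y => N%:R^-1 * \sum_(j < N) E k.+1 (iter j a y)) x)).
    apply: (posop_le hC hm).
    - by apply: fba_exp => //; exact: fba_birkhoff.
    - exact: fba_scale.
    - move=> y; rewrite /F -mulr_suml [_ * N%:R^-1]mulrC.
      rewrite (sum_mul_reindex N k.+1 (fun l => ln (f0 (iter l a y)))).
      apply: le_trans (expR_mean _ N0) _; rewrite ler_wpM2l ?invr_ge0//.
      apply: ler_sum => j _; rewrite expR_sum /E.
      rewrite le_eqVlt; apply/orP; left; apply/eqP; apply: eq_bigr => i _.
      by rewrite lnK ?posrE// iterD.
  rewrite (posop_scale hm)//.
  rewrite (posop_sum hC hm (F := fun (j : 'I_N) y => E k.+1 (iter j a y)))//.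
  apply: (@le_trans _ _ (N%:R^-1 * \sum_(j < N) (K0 * (Mf * K0)))).
    rewrite ler_wpM2l ?invr_ge0//; apply: ler_sum => j _; exact: AEj.
  rewrite sumr_const card_ord -[X in _ * X]mulr_natl mulKf ?lerDl//.
  by rewrite pnatr_eq0 -lt0n.
(* [b] is bounded by [K] along the multiples of [N]; a multiple [q] with [K <= e^(d q)] turns this
   into the rate [e^d] for all [n]. *)
have [k hk] : exists k, K <= expR d ^+ (k.+1 * N).
  exists (Num.truncn (K / d)); rewrite -expRM_natl.
  apply: le_trans (expR_ge1Dx _).
  have : K / d <= (((Num.truncn (K / d)).+1 * N)%:R).
    apply: ltW; apply: lt_le_trans (truncnS_gt _) _.
    by rewrite ler_nat leq_pmulr.
  rewrite ler_pdivrMr//; lra.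
have kN0 : (0 < k.+1 * N)%N by rewrite muln_gt0.
have [M M0 bM] := submul_bound b0 bsub (expR_gt0 d) kN0 (le_trans (bK k) hk).
exists (ln M) => n x; rewrite -[X in X x](PE n).
apply: (le_trans (le_supnorm hC x (CP n))); apply: (le_trans (bM n)).
by rewrite expRD lnK ?posrE// [_ * n%:R]mulrC expRM_natl.
Qed.

Variables (v : X -> R) (p : R).
Hypotheses (Cv : C v) (v0 : forall x, 0 <= v x) (p0 : 0 < p).

(** Exponential rates dominating the operator with weight [v^p e^F], in other words upper bounds for
    the pressure of [F]. Working with rates avoids the limit, and the constant [M] absorbs the
    effect of coboundaries. *)
Definition growth F : set R := [set s | exists M, forall n x,
  iter n A (fun y => (\prod_(k < n) v (iter k a y) `^ p) *
    expR (\sum_(k < n) F (iter k a y))) x <= expR (M + s * n%:R)].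

(** The state is chosen before [N], [D], [s] and [e]. The real number [s] ranges over upper bounds
    of the possibly infinite [tau_nD]. *)
Theorem variational_lower (x0 : X) (r : R) : 0 < r ->
  (forall n, (0 < n)%N ->
     r ^+ n <= supnorm (iter n (weighted_transfer A v p) (fun=> 1))) ->
  (forall c, r < c -> exists2 M : R, 0 < M &
     forall n, supnorm (iter n (weighted_transfer A v p) (fun=> 1)) <= M * c ^+ n) ->
  exists2 mu, invariant_states C a mu &
    forall N D s e, (0 < N)%N -> partition_of_unity C D -> 0 < e ->
      (tau_nD C A mu N D <= s%:E)%E ->
      ln r <= p * mu (fun x => ln (Num.max (v x) e)) + s / N%:R.
Proof.
move=> r0 rb bM; have C1 := fba_cst hC 1; have hAn n := transfer_iter hA n.
have Cw : C (fun x => v x `^ p) by exact: fba_powR.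
pose W n y := \prod_(k < n) v (iter k a y) `^ p.
have CW n : C (W n).
  by apply: fba_prod => // k; exact: (fba_dyn C_dyn k Cw).
have W0 n y : 0 <= W n y by apply: prodr_ge0 => k _; exact: powR_ge0.
pose J n f := iter n A (fun y => W n y * f y).
have hJ n : positive_operator C (J n) by apply: posop_mul.
have J1 n : J n (fun=> 1) = iter n (weighted_transfer A v p) (fun=> 1).
  by rewrite /weighted_transfer (weighted_iter hC C_dyn hA).
have CS F n : C F -> C (fun y => \sum_(k < n) F (iter k a y)).
  exact: fba_birkhoff.
have CeS F n : C F -> C (fun y => expR (\sum_(k < n) F (iter k a y))).
  by move=> CF; apply: fba_exp => //; exact: CS.
have Jshift F G n c s M : C F -> C G ->
    (forall x, J n (fun y => expR (\sum_(k < n) F (iter k a y))) x <= expR (M + s)) ->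
    (forall y, \sum_(k < n) G (iter k a y) <= c + \sum_(k < n) F (iter k a y)) ->
    forall x, J n (fun y => expR (\sum_(k < n) G (iter k a y))) x <= expR (M + c + s).
  move=> CF CG hF FG x.
  apply: (@le_trans _ _ (J n (fun y => expR c * expR (\sum_(k < n) F (iter k a y))) x)).
    apply: (posop_le hC (hJ n)); [exact: CeS|apply: fba_scale => //; exact: CeS|].
    by move=> y; rewrite -expRD ler_expR.
  rewrite (posop_scale (hJ n)); last exact: CeS.
  by rewrite addrAC addrC expRD ler_wpM2l// expR_ge0.
have J0E n : J n (fun y => expR (\sum_(k < n) (fun=> 0) (iter k a y))) = J n (fun=> 1).
  by congr (J n _); apply/funext => y; rewrite big1// expR0.
have [|||||mu imu hmu] := invariant_subgradient hC C_dyn (S := growth) (L0 := ln r).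
- move=> F G s t l CF CG [M hM] [M' hM'] l01.
  exists ((1 - l) * M + l * M') => n x.
  have -> : (1 - l) * M + l * M' + ((1 - l) * s + l * t) * n%:R =
    (1 - l) * (M + s * n%:R) + l * (M' + t * n%:R) by ring.
  have := posop_expR_convex (hJ n) (CS F n CF) (CS G n CG) l01 (hM n) (hM' n) x.
  apply: le_trans; rewrite le_eqVlt; apply/orP; left; apply/eqP.
  congr (J n _ x); apply/funext => y; congr expR.
  by rewrite big_split/= !mulr_sumr.
- move=> F G c s CF CG [M hM] FG; exists M => n x.
  have -> : M + (s + c) * n%:R = M + c * n%:R + s * n%:R by ring.
  apply: (Jshift F G _ _ _ _ CF CG (hM n)) => y; rewrite [leRHS]addrC.
  apply: (@le_trans _ _ (\sum_(k < n) (F (iter k a y) + c))).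
    by apply: ler_sum => k _; exact: FG.
  by rewrite big_split/= sumr_const card_ord mulr_natr.
(* A coboundary telescopes in the Birkhoff sum, changing it by at most [2 Mg] for every [n]. *)
- move=> F g s CF Cg [M hM]; have [Mg Mg0 gM] := fba_bound hC Cg.
  exists (M + 2 * Mg) => n x; pose G y := F y + (g (a y) - g y).
  have CG : C G by apply: fba_add => //; apply: fba_sub => //; exact: C_dyn.
  apply: (Jshift F G _ _ _ _ CF CG (hM n)); rewrite /G.
  move=> y; rewrite big_split/= addrC lerD2r.
  have := telescope_sumr (fun k => g (iter k a y)) (leq0n n).
  rewrite big_mkord /= => ->.
  have /ler_normlP[] := gM y; have /ler_normlP[] := gM (iter n a y); lra.
- move=> s [M hM]; rewrite leNgt; apply/negP => sr.
  have h n : (0 < n)%N -> n%:R * (ln r - s) <= M.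
    move=> n0; have : r ^+ n <= expR (M + s * n%:R).
      apply: le_trans (rb n n0) _; apply: (supnorm_le x0) => x.
      rewrite -J1 (posop_ge0 (hJ n) C1)//=.
      by rewrite -J0E; exact: hM.
    rewrite -ler_ln ?posrE ?exprn_gt0 ?expR_gt0// lnXn// expRK -mulr_natl; lra.
  have sr0 : 0 < ln r - s by rewrite subr_gt0.
  have := h (Num.truncn (M / (ln r - s))).+1 isT.
  by rewrite leNgt -ltr_pdivrMr// truncnS_gt.
- move=> s rs; have [|M M0 hM] := bM (expR s).
    by rewrite -[ltLHS]lnK ?posrE// ltr_expR.
  exists (ln M) => n x; rewrite -/(W n) -/(J n _) J0E.
  have CJ : C (J n (fun=> 1)) by exact: (posop_sub (hJ n)).
  apply: (le_trans (le_supnorm hC x CJ)); rewrite J1; apply: (le_trans (hM n)).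
  by rewrite expRD lnK ?posrE// [_ * n%:R]mulrC expRM_natl.
exists mu => // N D s e N0 pD e0 hs; have smu := imu.1.
have [CD D0 D1] := pD.
have Cln := fba_ln_max hC Cv e0.
apply/ler_addgt0Pr => eta eta0.
have eta2 : 0 < eta / 2 by rewrite divr_gt0.
have [c [c0 hc cs]] := tau_duality hC (transfer_posop hA) smu x0 pD hs eta2.
pose f0 y := \sum_(g <- D) c g * g y.
have Ccg g : g \in D -> C (fun y => c g * g y) by move=> /CD; exact: fba_scale.
have Cf0 : C f0 by exact: fba_sum.
have [k k0 kc] := seq_pos_lb c0.
have kf0 x : k <= f0 x.
  rewrite -[leLHS]mulr1 -(D1 x) mulr_sumr big_seq /f0 [leRHS]big_seq.
  by apply: ler_sum => g gD; rewrite ler_wpM2r ?D0// kc.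
have Af0 x : iter N A f0 x <= 1.
  rewrite (posop_sum hC (hAn N) (F := fun g y => c g * g y))//.
  apply: le_trans (hc x); rewrite big_seq [leRHS]big_seq; apply: ler_sum => g gD.
  by rewrite (posop_scale (hAn N))//; exact: CD.
have [M hM] := birkhoff_average_pressure x0 Cf0 k0 kf0 Af0 N0 eta2.
have Clf0 := fba_ln hC Cf0 k0 kf0.
have N0' : (0 : R) < N%:R by rewrite ltr0n.
pose F y := N%:R^-1 * ln (f0 y) - p * ln (Num.max (v y) e).
have CF : C F by apply: fba_sub => //; exact: fba_scale.
(* The part [- p ln (max v e)] of [F] cancels at least the weight, as [v^p <= (max v e)^p]; what
   remains is the average handled by [birkhoff_average_pressure]. *)
have : growth F (eta / 2).
  exists M => n x; apply: le_trans (hM n x).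
  have CFN : C (fun y => ln (f0 y) / N%:R).
    rewrite (_ : (fun _ => _) = (fun y => N%:R^-1 * ln (f0 y))).
      exact: fba_scale.
    by apply/funext => y; rewrite mulrC.
  apply: (posop_le hC (hAn n)).
  - by apply: fba_mul => //; [exact: CW|exact: CeS].
  - exact: CeS CFN.
  - move=> y; rewrite !expR_sum -big_split/=; apply: ler_prod => i _.
    set z := iter i a y; rewrite mulr_ge0 ?powR_ge0 ?expR_ge0//=.
    rewrite /F mulrC (mulrC _ (ln _)) expRD -mulrA -[leRHS]mulr1.
    rewrite ler_wpM2l ?expR_ge0// expRN mulrC ler_pdivrMr ?expR_gt0// mul1r.
    have m0 : 0 < Num.max (v z) e by rewrite lt_max e0 orbT.
    have -> : expR (p * ln (Num.max (v z) e)) = Num.max (v z) e `^ p.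
      by rewrite /powR gt_eqF.
    by rewrite ge0_ler_powR ?nnegrE ?(ltW p0) ?(ltW m0)// le_max lexx.
move=> /(hmu _ _ CF).
rewrite (state_sub hC smu); [|exact: fba_scale|exact: fba_scale].
rewrite !(state_scale smu)// => hr.
(* Pointwise concavity of [ln], the values [g y] being the weights of a convex combination. *)
have : \sum_(g <- D) mu g * ln (c g) <= mu (fun y => ln (f0 y)).
  have Cg' g : g \in D -> C (fun y => ln (c g) * g y) by move=> /CD; exact: fba_scale.
  rewrite (eq_big_seq (fun g => mu (fun y => ln (c g) * g y))); last first.
    by move=> g gD; rewrite (state_scale smu) 1?mulrC//; exact: CD.
  rewrite -(state_sum hC smu (F := fun g y => ln (c g) * g y))//.
  apply: (state_le hC smu) => //; first exact: fba_sum.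
  move=> y; have fy0 : 0 < f0 y by exact: lt_le_trans (kf0 y).
  apply: (@le_trans _ _ (\sum_(g <- D) (ln (f0 y) * g y + (c g * g y / f0 y - g y)))).
    rewrite big_seq [leRHS]big_seq; apply: ler_sum => g gD.
    have h : ln (c g / f0 y) <= c g / f0 y - 1.
      have /le_ln1Dx : -1 < c g / f0 y - 1.
        by rewrite ltrBrDr addNr divr_gt0// c0.
      by rewrite addrCA subrr addr0.
    rewrite ln_div ?posrE ?c0// in h.
    have := ler_wpM2r (D0 g gD y) h; lra.
  rewrite big_split/= -mulr_sumr D1 mulr1 sumrB D1 -mulr_suml -/(f0 y).
  by rewrite divff ?gt_eqF// subrr addr0.
move=> hsum.
have hN : - (s + eta / 2) <= mu (fun y => ln (f0 y)) by exact: le_trans hsum.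
have : - (s / N%:R) - eta / 2 <= N%:R^-1 * mu (fun y => ln (f0 y)).
  have iN : 0 <= N%:R^-1 :> R by rewrite invr_ge0.
  have := ler_wpM2l iN hN.
  have : N%:R^-1 * (eta / 2) <= 1 * (eta / 2).
    by rewrite ler_wpM2r ?(ltW eta2)// invf_le1// ler1n.
  lra.
lra.
Qed.

End VariationalLower.

(** * Riesz representation on the spectrum of the function algebra *)

Section Spectrum.
Variables (R : realType) (X : Type) (C : set (X -> R)).
Hypothesis hC : functional_base_algebra C.
Implicit Types (f g : X -> R).

Lemma spectrum_char (y : spectrum C) : fun_character C (set_val y).
Proof. exact: set_valP. Qed.

(** A nonnegative [f] is the square of an element of [C], so a character is positive on it. All
    facts about states thereby apply to points of the spectrum. *)
Lemma gelfand_state (y : spectrum C) : states C (fun f => fun_gelfand f y).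
Proof.
have [y1 ylin yM _] := spectrum_char y; split=> // f Cf f0.
have Cs := fba_sqrt hC Cf f0.
rewrite (_ : f = (fun x => Num.sqrt (f x)) \* (fun x => Num.sqrt (f x))).
  by rewrite /fun_gelfand yM// -expr2 sqr_ge0.
by apply/funext => x /=; rewrite -expr2 sqr_sqrtr.
Qed.

Lemma gelfand_mul f g (y : spectrum C) : C f -> C g ->
  fun_gelfand (fun x => f x * g x) y = fun_gelfand f y * fun_gelfand g y.
Proof. by move=> Cf Cg; have [_ _ yM _] := spectrum_char y; exact: yM. Qed.

Lemma gelfand_norm f (y : spectrum C) : C f ->
  fun_gelfand (fun x => `|f x|) y = `|fun_gelfand f y|.
Proof.
move=> Cf; have Cn := fba_norm hC Cf.
have n0 : 0 <= fun_gelfand (fun x => `|f x|) y.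
  by apply: (state_ge0 (gelfand_state y)).
apply/eqP; rewrite -(@eqrXn2 _ 2)// real_normK ?num_real//.
rewrite !expr2 -!gelfand_mul//; apply/eqP; congr fun_gelfand.
by apply/funext => x; rewrite -!expr2 real_normK ?num_real.
Qed.

Definition eval_char_fun (x : X) : {ptws (X -> R) -> R} :=
  fun f => if `[< C f >] then f x else 0.

Lemma eval_charP (x : X) : eval_char_fun x \in fun_characters C.
Proof.
apply/mem_set; have E f : C f -> eval_char_fun x f = f x.
  by move=> Cf; rewrite /eval_char_fun asboolT.
split.
- by rewrite E//; exact: fba_cst.
- split=> [f g Cf Cg|c f Cf]; rewrite !E//; first exact: fba_add.
  exact: fba_scale.
- by move=> f g Cf Cg; rewrite !E//; exact: fba_mul.
- by move=> f nCf; rewrite /eval_char_fun asboolF.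
Qed.

Definition eval_char (x : X) : spectrum C := 
  exist (fun q => q \in fun_characters C) _ (eval_charP x).

(** Density of [X] in the spectrum: otherwise [sum_f (f - f(y))^2] would be at least [e^2] on [X],
    while the character [y] annihilates it. *)
Lemma gelfand_dense (y : spectrum C) (s : seq (X -> R)) (e : R) :
  (forall f, f \in s -> C f) ->
  0 < e -> exists x, forall f, f \in s -> `|f x - fun_gelfand f y| < e.
Proof.
move=> Cs e0; apply: contrapT => /forallNP noX; have hy := gelfand_state y.
pose d f x := f x - fun_gelfand f y.
have Cd f : f \in s -> C (d f).
  by move=> /Cs Cf; apply: fba_sub => //; exact: fba_cst.
have Cd2 f : f \in s -> C (fun x => d f x * d f x).
  by move=> /Cd h; exact: fba_mul.
have CS : C (fun x => \sum_(f <- s) d f x * d f x) by exact: fba_sum.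
have : fun_gelfand (fun x => \sum_(f <- s) d f x * d f x) y = 0.
  rewrite (state_sum hC hy (F := fun f x => d f x * d f x))// big_seq big1// => f fs.
  rewrite (gelfand_mul y (Cd f fs) (Cd f fs)).
  have -> : fun_gelfand (d f) y = fun_gelfand f y - fun_gelfand f y.
    rewrite -[X in _ - X](state_cst hC hy).
    exact: (state_sub hC hy (Cs f fs) (fba_cst hC _)).
  by rewrite subrr mul0r.
have : e ^+ 2 <= fun_gelfand (fun x => \sum_(f <- s) d f x * d f x) y.
  apply: (state_ge_cst hC hy CS) => x.
  have /existsNP[f /not_implyP[fs /negP]] := noX x; rewrite -leNgt => ef.
  rewrite (big_rem f)//= -[leLHS]addr0 lerD//; last first.
    by apply: sumr_ge0 => g _; rewrite -expr2 sqr_ge0.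
  rewrite -expr2 -[leRHS]real_normK ?num_real// lerXn2r// nnegrE.
  exact: ltW.
by move=> + h0; rewrite h0 leNgt exprn_gt0.
Qed.

(** By density, a point [x] approximates [y] on [f] and on [ln (max f c)] at once, and [ln] is
    [1/c]-Lipschitz above [c]; hence the factor [c] in the tolerance [d]. *)
Lemma gelfand_ln_max f (c : R) (y : spectrum C) : C f -> 0 < c ->
  fun_gelfand (fun x => ln (Num.max (f x) c)) y = ln (Num.max (fun_gelfand f y) c).
Proof.
move=> Cf c0; set g := fun x => _; have Cg : C g by exact: fba_ln_max.
apply/eqP; rewrite eq_sym -subr_eq0 -normr_le0; apply/ler_addgt0Pr => e e0.
rewrite add0r; pose d := Num.min (e / 2) (c * (e / 2)).
have d0 : 0 < d by rewrite lt_min !mulr_gt0// ?invr_gt0// ltr0n.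
have [|x hx] := @gelfand_dense y [:: f; g] d _ d0.
  by move=> h; rewrite !inE => /orP[] /eqP ->.
have := hx g; rewrite !inE eqxx orbT => /(_ isT) hg.
have := hx f; rewrite !inE eqxx => /(_ isT) hf.
have le_c (q : R) : c <= Num.max q c by rewrite le_max lexx orbT.
have h1 : `|g x - ln (Num.max (fun_gelfand f y) c)| <= e / 2.
  apply: le_trans (ln_lip c0 (le_c _) (le_c _)) _.
  rewrite ler_pdivrMl//; apply: (@le_trans _ _ d); last by rewrite ge_min lexx orbT.
  apply: le_trans (ltW hf).
  have := lexx `|f x - fun_gelfand f y|; rewrite {1}ler_norml.
  move: `|f x - _| => N /andP[hN1 hN2]; rewrite ler_norml.
  by case: (leP (f x) c) => h; case: (leP (fun_gelfand f y) c) => h';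
     apply/andP; split; lra.
have h2 : `|g x - fun_gelfand g y| <= e / 2.
  by apply: (le_trans (ltW hg)); rewrite ge_min lexx.
move: h1 h2; rewrite !ler_norml => /andP[? ?] /andP[? ?]; apply/andP; split; lra.
Qed.

Lemma fun_characters_closed : closed (fun_characters C).
Proof.
pose E f := fun y : {ptws (X -> R) -> R} => y f : R.
have ev f : continuous (E f).
  exact: (@proj_continuous _ (fun _ : X -> R => R) f).
have cl (h k : {ptws (X -> R) -> R} -> R) : continuous h -> continuous k ->
    closed [set y | h y = k y].
  move=> hc kc; rewrite (_ : [set _ | _] = (fun y => h y - k y) @^-1` [set r : R | r = 0]).
    apply: closed_comp => [y _|]; last exact: (@closed_eq R 0).
    exact: (@continuousB R R^o _ h k y (hc y) (kc y)).
  apply/seteqP; split=> y /=; first by move=> ->; rewrite subrr.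
  by move/eqP; rewrite subr_eq0 => /eqP.
have cD (h k : {ptws (X -> R) -> R} -> R) : continuous h -> continuous k ->
    continuous (fun y => h y + k y).
  by move=> hc kc y; exact: (@continuousD R R^o _ h k y (hc y) (kc y)).
have cM (h k : {ptws (X -> R) -> R} -> R) : continuous h -> continuous k ->
    continuous (fun y => h y * k y).
  by move=> hc kc y; exact: (@continuousM R _ h k y (hc y) (kc y)).
have -> : fun_characters C =
  [set y : {ptws (X -> R) -> R} | y (fun=> 1) = 1] `&`
  (\bigcap_(fg in [set fg : (X -> R) * (X -> R) | C fg.1 /\ C fg.2])
    [set y : {ptws (X -> R) -> R} | y (fg.1 \+ fg.2) = y fg.1 + y fg.2]) `&`
  (\bigcap_(cf in [set cf : R * (X -> R) | C cf.2])
    [set y : {ptws (X -> R) -> R} | y (cf.1 \*o cf.2) = cf.1 * y cf.2]) `&`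
  (\bigcap_(fg in [set fg : (X -> R) * (X -> R) | C fg.1 /\ C fg.2])
    [set y : {ptws (X -> R) -> R} | y (fg.1 \* fg.2) = y fg.1 * y fg.2]) `&`
  (\bigcap_(f in ~` C) [set y : {ptws (X -> R) -> R} | y f = 0]).
  apply/seteqP; split=> y.
    move=> [y1 [yD yZ] yM y0]; split; [split; [split; [split|]|]|].
    - exact: y1.
    - by move=> [f g] [Cf Cg]; exact: yD.
    - by move=> [c f] Cf; exact: yZ.
    - by move=> [f g] [Cf Cg]; exact: yM.
    - by move=> f nCf; exact: y0.
  move=> [[[[y1 yD] yZ] yM] y0]; split=> //.
    split=> [f g Cf Cg|c f Cf]; first exact: (yD (f, g)).
    exact: (yZ (c, f)).
  by move=> f g Cf Cg; exact: (yM (f, g)).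
apply: closedI; [apply: closedI; [apply: closedI; [apply: closedI|]|]|].
- by refine (cl (E (fun=> 1)) (fun=> 1) (ev _) (@cst_continuous _ _ (1 : R))).
- apply: closed_bigI => -[f g] _.
  by refine (cl (E (f \+ g)) _ (ev _) (cD _ _ (ev f) (ev g))).
- apply: closed_bigI => -[c f] _.
  by refine (cl (E (c \*o f)) _ (ev _) (cM (fun=> c) _ (@cst_continuous _ _ c) (ev f))).
- apply: closed_bigI => -[f g] _.
  by refine (cl (E (f \* g)) _ (ev _) (cM _ _ (ev f) (ev g))).
- apply: closed_bigI => f _.
  by refine (cl (E f) (fun=> 0) (ev f) (@cst_continuous _ _ (0 : R))).
Qed.

(** Tychonoff's theorem: characters form a closed subset of a product of segments
    [[- supnorm f, supnorm f]], reduced to [{0}] outside [C]. *)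
Lemma fun_characters_compact : compact (fun_characters C).
Proof.
pose M f : R := if `[< C f >] then supnorm f else 0.
have cK := @tychonoff (X -> R) (fun=> R) (fun f => `[- M f, M f]%classic)
  (fun f => @segment_compact R (- M f) (M f)).
apply: subclosed_compact fun_characters_closed cK _ => y hy f.
rewrite /= in_itv /= /M; case: asboolP => Cf; last first.
  by rewrite (fchar_out hy Cf) oppr0 lexx.
have hs := gelfand_state (exist (fun q => q \in fun_characters C) y (mem_set hy)).
rewrite /fun_gelfand set_valE /= in hs.
apply/andP; split.
  apply: (state_ge_cst hC hs Cf) => x.
  by have := supnorm_ge hC x Cf; rewrite ler_norml => /andP[].
by apply: (state_le_cst hC hs Cf) => x; exact: (le_supnorm hC x Cf).
Qed.

Lemma spectrum_compact : compact [set: spectrum C].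
Proof.
move=> F FF _.
pose G : set_system {ptws (X -> R) -> R} := set_val @ F.
have GF : ProperFilter G by exact: fmap_proper_filter.
have GW : G (fun_characters C).
  by rewrite /G /= nbhs_simpl; apply: filterS (@filterT _ F _) => y _; exact: set_valP.
have [w [Ww clw]] := fun_characters_compact GF GW.
exists (exist (fun q => q \in fun_characters C) w (mem_set Ww)); split=> // P Q FP.
move=> [_ [[N oN <-] Nw NQ]].
have GP : G (set_val @` P).
  by rewrite /G /= nbhs_simpl; apply: filterS FP => y Py; exists y.
have [|_ [[y Py <-] Ny]] := clw _ N GP.
  by apply: open_nbhs_nbhs; split.
by exists y; split=> //; apply: NQ.
Qed.

Lemma gelfand_continuous f : continuous (fun_gelfand f : spectrum C -> R).
Proof.
move=> y; apply: (@continuous_comp _ {ptws (X -> R) -> R} _ set_val (fun z => z f)).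
  exact: initial_continuous.
exact: (@proj_continuous _ (fun _ : X -> R => R) f).
Qed.

Lemma spectrum_separated (y z : spectrum C) :
  y != z -> exists2 f, C f & fun_gelfand f y != fun_gelfand f z.
Proof.
move=> yz; apply: contrapT => /forall2NP h; move/eqP: yz; apply.
apply: val_inj; apply/funext => f; rewrite -!set_valE.
have [Cf|nCf] := pselect (C f).
  by have [//|/negP] := h f; rewrite negbK => /eqP.
by rewrite !(fchar_out (spectrum_char _)).
Qed.

End Spectrum.

(** * Urysohn functions and the mass of open sets *)

Section Riesz.
Variables (R : realType) (X : Type) (C : set (X -> R)).
Hypothesis hC : functional_base_algebra C.
Implicit Types (f g : X -> R) (U V : set (spectrum C)).

Lemma gelfand_eval f x : C f -> fun_gelfand f (eval_char hC x) = f x.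
Proof.
by move=> Cf; rewrite /fun_gelfand set_valE /= /eval_char_fun asboolT.
Qed.

Lemma gelfand_max f g (y : spectrum C) : C f -> C g ->
  fun_gelfand (fun x => Num.max (f x) (g x)) y =
  Num.max (fun_gelfand f y) (fun_gelfand g y).
Proof.
move=> Cf Cg; have hy := gelfand_state hC y.
have -> : (fun x => Num.max (f x) (g x)) =
    (fun x => 2^-1 * ((f x + g x) + `|f x - g x|)).
  by apply/funext => x; rewrite maxr_absE mulrC.
have Cd : C (fun x => f x - g x) by exact: fba_sub.
have Cs : C (fun x => f x + g x) by exact: fba_add.
have Cn : C (fun x => `|f x - g x|) by exact: (fba_norm hC Cd).
rewrite (state_scale hy); last exact: fba_add.
rewrite (state_add hy Cs Cn) (state_add hy Cf Cg) (gelfand_norm hC _ Cd).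
by rewrite (state_sub hC hy Cf Cg) maxr_absE mulrC.
Qed.

Lemma gelfand_min f g (y : spectrum C) : C f -> C g ->
  fun_gelfand (fun x => Num.min (f x) (g x)) y =
  Num.min (fun_gelfand f y) (fun_gelfand g y).
Proof.
move=> Cf Cg; have hy := gelfand_state hC y.
have -> : (fun x => Num.min (f x) (g x)) = (fun x => f x + g x - Num.max (f x) (g x)).
  by apply/funext => x; case: leP => _; ring.
have Cs : C (fun x => f x + g x) by exact: fba_add.
rewrite (state_sub hC hy Cs) ?(state_add hy Cf Cg) ?gelfand_max//.
  by case: leP => _; ring.
exact: fba_max.
Qed.

Lemma spectrum_closed_compact (K : set (spectrum C)) : closed K -> compact K.
Proof. by move=> Kc; apply: subclosed_compact Kc (spectrum_compact hC) _. Qed.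

Lemma gelfand_open f (r : R) : open [set y : spectrum C | r < fun_gelfand f y].
Proof.
rewrite (_ : [set _ | _] = fun_gelfand f @^-1` [set s | r < s]).
  by apply: open_comp; [move=> y _; exact: gelfand_continuous|exact: open_gt].
by [].
Qed.

Lemma gelfand_closed f (r : R) : closed [set y : spectrum C | r <= fun_gelfand f y].
Proof.
rewrite (_ : [set _ | _] = fun_gelfand f @^-1` [set s | r <= s]).
  by apply: closed_comp; [move=> y _; exact: gelfand_continuous|exact: closed_ge].
by [].
Qed.

Lemma spectrum_finite_cover (K : set (spectrum C)) (f : spectrum C -> set (spectrum C)) :
  closed K -> (forall z, open (f z)) -> (forall z, K z -> f z z) ->
  exists2 s : seq (spectrum C), (forall z, z \in s -> K z) &
    forall w, K w -> exists2 z, z \in s & f z w.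
Proof.
move=> Kcl fo fz; have [[y0 _]|/nonemptyPn K0] := pselect (K !=set0); last first.
  by exists [::] => // w; rewrite K0.
(* The passage to open covers takes place on the pointed version of the spectrum, based at a point
   of [K]. *)
have := spectrum_closed_compact Kcl.
rewrite -[compact K]/(@compact (spectrum_at y0) K) compact_cover.
move=> /(_ (spectrum C) K f) [z _|w Kw|D DK Dcov]; [exact: fo|by exists w => //; exact: fz|].
exists (enum_fset D) => [z zD|w /Dcov[z zD fzw]]; last by exists z.
by apply: set_mem; apply: DK.
Qed.

(** For each [z] outside [U] a multiple of [|f - f(y)|] vanishes at [y] and exceeds 1 near [z].
    Finitely many of these cover the complement of [U], and [h] is the positive part of 1 minus
    their sum. *)
Lemma spectrum_urysohn U (y : spectrum C) : open U -> U y ->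
  exists h, [/\ C h, forall x, 0 <= h x <= 1, fun_gelfand h y = 1 &
    forall z, ~ U z -> fun_gelfand h z = 0].
Proof.
move=> oU Uy; have hy := gelfand_state hC y.
have sep z : exists g, ~ U z ->
    [/\ C g, forall x, 0 <= g x, fun_gelfand g y = 0 & 1 < fun_gelfand g z].
  have [Uz|nUz] := pselect (U z); first by exists (fun=> 0).
  have zy : z != y by apply/eqP => zy; apply: nUz; rewrite zy.
  have [f Cf fzy] := spectrum_separated zy.
  have hz := gelfand_state hC z.
  pose d := `|fun_gelfand f z - fun_gelfand f y|.
  have d0 : 0 < d by rewrite normr_gt0 subr_eq0.
  have Cd : C (fun x => f x - fun_gelfand f y) by apply: fba_sub => //; exact: fba_cst.
  have Cn : C (fun x => `|f x - fun_gelfand f y|) by exact: (fba_norm hC Cd).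
  have gd (w : spectrum C) : fun_gelfand (fun x => f x - fun_gelfand f y) w =
      fun_gelfand f w - fun_gelfand f y.
    have hw := gelfand_state hC w.
    rewrite -[X in _ - X](state_cst hC hw); apply: (state_sub hC hw Cf).
    exact: fba_cst.
  exists (fun x => 2 / d * `|f x - fun_gelfand f y|) => _; split.
  - exact: fba_scale.
  - by move=> x; rewrite mulr_ge0// divr_ge0// ltW.
  - by rewrite (state_scale hy)// (gelfand_norm hC _ Cd) gd subrr normr0 mulr0.
  - rewrite (state_scale hz)// (gelfand_norm hC _ Cd) gd -/d divfK ?gt_eqF//.
    by rewrite ltr1n.
have [g hg] := choice sep.
have [||z nUz|s sU scov] := @spectrum_finite_cover (~` U)
    (fun z => [set w | 1 < fun_gelfand (g z) w]).
- exact: open_closedC.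
- by move=> z; exact: gelfand_open.
- by have [] := hg z nUz.
pose S x := \sum_(z <- s) g z x.
have Cg z : z \in s -> C (g z) by move=> /sU /hg[].
have CS : C S by exact: fba_sum.
pose h x := Num.max (1 - S x) 0.
have C1S : C (fun x => 1 - S x) by apply: fba_sub => //; exact: fba_cst.
have gS (w : spectrum C) : fun_gelfand S w = \sum_(z <- s) fun_gelfand (g z) w.
  exact: (state_sum hC (gelfand_state hC w)).
have gh (w : spectrum C) : fun_gelfand h w = Num.max (1 - fun_gelfand S w) 0.
  rewrite gelfand_max//; last exact: fba_cst.
  have hw := gelfand_state hC w; rewrite (state_cst hC hw); congr Num.max.
  by rewrite (state_sub hC hw (fba_cst hC 1) CS) (state_cst hC hw).
exists h; split.
- by apply: fba_max => //; exact: fba_cst.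
- move=> x; rewrite /h le_max lexx orbT ge_max ler01 andbT /=.
  rewrite gerBl /S big_seq sumr_ge0// => z zs.
  by have [] := hg z (sU z zs).
- rewrite gh gS big_seq big1 ?subr0 ?max_l// => z zs.
  by have [] := hg z (sU z zs).
- move=> z /scov[z' z's /= h1]; rewrite gh max_r// gS subr_le0.
  rewrite (big_rem z')//= -[leLHS]addr0 lerD ?(ltW h1)//.
  rewrite big_seq sumr_ge0// => w /mem_rem ws.
  have [Cgw gw0 _ _] := hg w (sU w ws).
  exact: (state_ge0 (gelfand_state hC z)).
Qed.

Variables (x0 : X) (mu : (X -> R) -> R).
Hypothesis hmu : states C mu.

(** The relation between test functions and open sets in the Riesz construction, with vanishing off
    [U] in place of compact support inside [U]. *)
Definition below U f : Prop :=
  [/\ C f, forall x, 0 <= f x <= 1 & forall y, ~ U y -> fun_gelfand f y = 0].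

Definition open_mass U : R := sup [set mu f | f in below U].

Lemma below0 U : below U (fun=> 0).
Proof.
split=> [|x|y _]; [exact: fba_cst|by rewrite lexx ler01|].
exact: (state_cst hC (gelfand_state hC y)).
Qed.

Lemma open_mass_has_sup U : has_sup [set mu f | f in below U].
Proof.
split; first by exists (mu (fun=> 0)), (fun=> 0) => //; exact: below0.
exists 1 => _ [f [Cf f01 _] <-]; apply: (state_le_cst hC hmu) => // x.
by have /andP[] := f01 x.
Qed.

Lemma le_open_mass U f : below U f -> mu f <= open_mass U.
Proof. by move=> Uf; apply: ub_le_sup; [exact: (open_mass_has_sup U).2|exists f]. Qed.

Lemma open_mass_le U (c : R) : (forall f, below U f -> mu f <= c) -> open_mass U <= c.
Proof.
move=> h; apply: ge_sup; first exact: (open_mass_has_sup U).1.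
by move=> _ [f Uf <-]; exact: h.
Qed.

Lemma open_mass_ge0 U : 0 <= open_mass U.
Proof. by rewrite -(state_cst hC hmu 0); apply: le_open_mass; exact: below0. Qed.

Lemma open_mass_mono U V : U `<=` V -> open_mass U <= open_mass V.
Proof.
move=> UV; apply: open_mass_le => f [Cf f01 fU]; apply: le_open_mass.
by split=> // y nVy; apply: fU => /UV.
Qed.

Lemma open_mass_set0 : open_mass set0 = 0.
Proof.
apply/eqP; rewrite eq_le open_mass_ge0 andbT; apply: open_mass_le => f [Cf _ f0].
apply: (state_le_cst hC hmu) => // x.
by rewrite -(gelfand_eval x Cf) f0.
Qed.

Lemma open_massT : open_mass setT = 1.
Proof.
apply/eqP; rewrite eq_le; apply/andP; split.
  apply: open_mass_le => f [Cf f01 _]; apply: (state_le_cst hC hmu) => // x.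
  by have /andP[] := f01 x.
rewrite -(state_cst hC hmu 1); apply: le_open_mass.
split=> [|x|y /(_ I)//]; first exact: fba_cst.
by rewrite ler01 lexx.
Qed.

(** The compact set [f >= e] is covered by finitely many sets [h z > 1/2], with [h z] a Urysohn
    function for one of the [U i]. Summing the [2 h z] that share an index and capping at 1 gives
    functions [H i] below [U i] whose sum is at least 1 there; elsewhere [f <= e]. *)
Lemma open_mass_bigcup (U : nat -> set (spectrum C)) f (e : R) :
  (forall i, open (U i)) -> below (\bigcup_i U i) f -> 0 < e ->
  exists n, mu f <= \sum_(i < n) open_mass (U i) + e.
Proof.
move=> oU [Cf f01 fU] e0.
pose K := [set y : spectrum C | e <= fun_gelfand f y].
have pick z : exists ih : nat * (X -> R), K z ->
    [/\ U ih.1 z, C ih.2, forall x, 0 <= ih.2 x <= 1, fun_gelfand ih.2 z = 1 &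
      forall w, ~ U ih.1 w -> fun_gelfand ih.2 w = 0].
  have [Kz|nKz] := pselect (K z); last by exists (0%N, fun=> 0).
  have [i _ Uiz] : (\bigcup_i U i) z.
    apply: contrapT => /fU fz0; move: Kz; rewrite /K /= fz0 leNgt => /negP; exact.
  by have [h [Ch h01 hz hU]] := spectrum_urysohn (oU i) Uiz; exists (i, h).
have [ih hih] := choice pick.
pose h z := (ih z).2; pose ind z := (ih z).1.
have [||z Kz|s sK scov] := @spectrum_finite_cover K
    (fun z => [set w | 2^-1 < fun_gelfand (h z) w]).
- exact: gelfand_closed.
- by move=> z; exact: gelfand_open.
- by have [_ _ _ hz _] := hih z Kz; rewrite /h /= hz invf_lt1// ltr1n.
pose S i x := \sum_(z <- s | ind z == i) 2 * h z x.
pose H i x := Num.min (S i x) 1.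
have Ch z : z \in s -> C (h z) by move=> /sK/hih[].
have h0 z x : z \in s -> 0 <= h z x.
  by move=> /sK/hih[_ _ /(_ x) /andP[]].
have CF i z : z \in s -> C (fun x => if ind z == i then 2 * h z x else 0).
  move=> zs; case: eqP => _; last exact: fba_cst.
  by apply: fba_scale => //; exact: Ch.
have SE i : S i = (fun x => \sum_(z <- s) if ind z == i then 2 * h z x else 0).
  by apply/funext => x; rewrite /S big_mkcond.
have CS i : C (S i) by rewrite SE; exact: (fba_sum hC (CF i)).
have S0 i x : 0 <= S i x.
  rewrite /S big_seq_cond sumr_ge0// => z /andP[zs _].
  by rewrite mulr_ge0// h0.
have CH i : C (H i) by apply: fba_min => //; exact: fba_cst.
have belowH i : below (U i) (H i).
  split=> //; first by move=> x; rewrite /H le_min S0 ler01 ge_min lexx orbT.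
  move=> w nUw; rewrite gelfand_min//; last exact: fba_cst.
  have hw := gelfand_state hC w; rewrite (state_cst hC hw).
  suff -> : fun_gelfand (S i) w = 0 by rewrite min_l.
  rewrite SE (state_sum hC hw (CF i)) big_seq big1// => z zs.
  case: eqP => [iz|_]; last exact: (state_cst hC hw).
  have [_ _ _ _ hU] := hih z (sK z zs).
  by rewrite (state_scale hw _ (Ch z zs)) hU ?mulr0// -/(ind z) iz.
(* Any bound above all selected indices will do; the sum is one. *)
pose n := (\sum_(z <- s) ind z).+1.
exists n; have CHn (i : 'I_n) : C (H i) by [].
apply: (@le_trans _ _ (mu (fun x => \sum_(i < n) H i x + e))); last first.
  rewrite (state_add hmu);
    [|exact: (fba_sum hC (F := fun (i : 'I_n) x => H i x))|exact: fba_cst].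
  rewrite (state_cst hC hmu) lerD2r.
  rewrite (state_sum hC hmu (F := fun (i : 'I_n) x => H i x))//.
  by apply: ler_sum => i _; exact: le_open_mass.
apply: (state_le hC hmu) => //.
  apply: fba_add => //; last exact: fba_cst.
  exact: (fba_sum hC (F := fun (i : 'I_n) x => H i x)).
move=> x; have H0 i : 0 <= H i x by rewrite /H le_min S0 ler01.
have [fe|ef] := leP (f x) e.
  by rewrite (le_trans fe)// lerDr sumr_ge0.
have /scov[z zs /=] : K (eval_char hC x) by rewrite /K /= gelfand_eval// ltW.
rewrite gelfand_eval; last exact: Ch.
move=> hz; have zn : (ind z < n)%N.
  by rewrite ltnS (big_rem z)//= leq_addr.
have /andP[_ f1] := f01 x; apply: (le_trans f1).
have <- : H (ind z) x = 1.
  rewrite /H min_r// /S (big_rem z)//= eqxx -[leLHS]addr0 lerD//.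
    by move: hz; lra.
  rewrite big_seq_cond sumr_ge0// => w /andP[/mem_rem ws _].
  by rewrite mulr_ge0// h0.
rewrite (bigD1 (Ordinal zn))//= -addrA lerDl addr_ge0 ?(ltW e0)//.
by apply: sumr_ge0 => i _; exact: H0.
Qed.

End Riesz.

(** * The outer measure and the Borel measure *)

Section RieszMeasure.
Variables (R : realType) (X : Type) (C : set (X -> R)).
Hypothesis hC : functional_base_algebra C.
Variables (x0 : X) (mu : (X -> R) -> R).
Hypothesis hmu : states C mu.
Implicit Types (f g : X -> R) (U V E : set (spectrum C)).

Local Notation open_mass := (@open_mass R X C mu).

Definition open_covers E : set (set (spectrum C)) := [set U | open U /\ E `<=` U].

Definition outer_mass E : R := inf [set open_mass U | U in open_covers E].

Lemma outer_mass_has_inf E : has_inf [set open_mass U | U in open_covers E].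
Proof.
split; first by exists (open_mass setT), setT => //; split=> //; exact: openT.
by exists 0 => _ [U _ <-]; exact: open_mass_ge0.
Qed.

Lemma outer_mass_ge0 E : 0 <= outer_mass E.
Proof.
apply: lb_le_inf; first exact: (outer_mass_has_inf E).1.
by move=> _ [U _ <-]; exact: open_mass_ge0.
Qed.

Lemma outer_mass_le E U : open U -> E `<=` U -> outer_mass E <= open_mass U.
Proof. by move=> oU EU; apply: ge_inf; [exact: (outer_mass_has_inf E).2|exists U]. Qed.

Lemma le_outer_mass E c : (forall U, open U -> E `<=` U -> c <= open_mass U) ->
  c <= outer_mass E.
Proof.
move=> h; apply: lb_le_inf; first exact: (outer_mass_has_inf E).1.
by move=> _ [U [oU EU] <-]; exact: h.
Qed.

Lemma outer_mass_adherent E (e : R) : 0 < e ->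
  exists U, [/\ open U, E `<=` U & open_mass U < outer_mass E + e].
Proof.
move=> e0; have [_ [U [oU EU] <-] h] := inf_adherent e0 (outer_mass_has_inf E).
by exists U.
Qed.

Lemma outer_mass_mono E E' : E `<=` E' -> outer_mass E <= outer_mass E'.
Proof.
move=> EE'; apply: le_outer_mass => U oU E'U.
by apply: outer_mass_le => //; exact: subset_trans E'U.
Qed.

Lemma outer_mass_open U : open U -> outer_mass U = open_mass U.
Proof.
move=> oU; apply/eqP; rewrite eq_le outer_mass_le//=.
by apply: le_outer_mass => V _; exact: open_mass_mono.
Qed.

Lemma outer_mass_set0 : outer_mass set0 = 0.
Proof. by rewrite outer_mass_open ?open_mass_set0//; exact: open0. Qed.

(** One half of [e] is spread geometrically over open covers of the sets [F i]; the other half is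
    the error of [open_mass_bigcup]. *)
Lemma outer_mass_subadditive (F : nat -> set (spectrum C)) :
  ((outer_mass (\bigcup_i F i))%:E <= \sum_(i <oo) (outer_mass (F i))%:E)%E.
Proof.
apply/lee_addgt0Pr => e e0.
have e2 : 0 < e / 2 by rewrite divr_gt0.
have pick i : exists U, [/\ open U, F i `<=` U &
    open_mass U < outer_mass (F i) + e / 2 / (2 ^ i.+1)%:R].
  by apply: outer_mass_adherent; rewrite divr_gt0// ltr0n expn_gt0.
have [U hU] := choice pick.
have oU i : open (U i) by have [] := hU i.
apply: (@le_trans _ _ ((open_mass (\bigcup_i U i))%:E)).
  rewrite lee_fin; apply: outer_mass_le; first by apply: bigcup_open => i _.
  by apply: subset_bigcup => i _; have [] := hU i.
have -> : (e%:E = (e / 2)%:E + (e / 2)%:E :> \bar R)%E by rewrite -EFinD -splitr.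
rewrite addeA; apply: (@le_trans _ _ (\sum_(i <oo) (open_mass (U i))%:E + (e / 2)%:E)%E).
  have om0 i : xpredT i -> (0 <= (open_mass (U i))%:E)%E.
    by rewrite lee_fin open_mass_ge0.
  set Z := (_ + _)%E.
  have : forall f, below (\bigcup_i U i) f -> ((mu f)%:E <= Z)%E.
    move=> f fU; have [n hn] := open_mass_bigcup hC hmu oU fU e2.
    apply: (@le_trans _ _ (\sum_(i < n) open_mass (U i) + e / 2)%:E) => //.
    rewrite EFinD leeD2r// -sumEFin -(big_mkord xpredT (fun i => (open_mass (U i))%:E)).
    by apply: nneseries_lim_ge => i _ _; exact: om0.
  case: Z => [z| |] h; rewrite ?leey//.
    by rewrite lee_fin; apply: (open_mass_le hC hmu) => f /h.
  by have := h _ (below0 hC _).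
rewrite leeD2r//; apply: le_trans (epsilon_trick (e := e / 2) xpredT _ _); last by rewrite ltW.
  apply: lee_nneseries => i _; first by move=> _; rewrite lee_fin; exact: open_mass_ge0.
  by rewrite -EFinD lee_fin ltW//; have [] := hU i.
by move=> i; rewrite lee_fin; exact: outer_mass_ge0.
Qed.

(** For [f] below [V] intersected with [U], and [g] below [V] minus the set [f >= e], the positive
    part of [f - e] and [g] are never both nonzero on [X]. Their sum is thus still below [V], and
    [e] is the only loss. *)
Lemma outer_mass_caratheodory U E : open U ->
  outer_mass (E `&` U) + outer_mass (E `&` ~` U) <= outer_mass E.
Proof.
move=> oU; apply: le_outer_mass => V oV EV; apply/ler_addgt0Pr => e e0.
have oVU : open (V `&` U) by exact: openI.
apply: (@le_trans _ _ (open_mass (V `&` U) + outer_mass (E `&` ~` U))).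
  by rewrite lerD2r outer_mass_le//; exact: setSI.
rewrite -lerBrDr; apply: (open_mass_le hC hmu) => f [Cf f01 fVU]; rewrite lerBrDr -lerBrDl.
pose K := [set y : spectrum C | e <= fun_gelfand f y].
have oVK : open (V `&` ~` K).
  by apply: openI => //; apply: closed_openC; exact: gelfand_closed.
apply: (@le_trans _ _ (open_mass (V `&` ~` K))).
  apply: outer_mass_le => // y [Ey nUy]; split; first exact: EV.
  by rewrite /K /=; apply/negP; rewrite -ltNge fVU// => -[].
apply: (open_mass_le hC hmu) => g [Cg g01 gVK].
pose fe x := Num.max (f x - e) 0.
have Cfe0 : C (fun x => f x - e) by apply: fba_sub => //; exact: fba_cst.
have Cfe : C fe by apply: fba_max => //; exact: fba_cst.
have gfe (y : spectrum C) : fun_gelfand fe y = Num.max (fun_gelfand f y - e) 0.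
  have hy := gelfand_state hC y.
  rewrite gelfand_max//; last exact: fba_cst.
  rewrite (state_cst hC hy) (state_sub hC hy Cf (fba_cst hC e)).
  by rewrite (state_cst hC hy).
have mufe : mu f - e <= mu fe.
  rewrite -[X in _ - X](state_cst hC hmu) -(state_sub hC hmu)//; last exact: fba_cst.
  by apply: (state_le hC hmu) => // x; rewrite /fe le_max lexx.
have : mu (fun x => fe x + g x) <= open_mass V.
  apply: (le_open_mass hC hmu); split; first exact: fba_add.
    move=> x; have /andP[g0 g1] := g01 x; have /andP[f0 f1] := f01 x.
    rewrite addr_ge0//= /fe; last by rewrite le_max lexx orbT.
    have [fxe|efx] := leP (f x) e.
      by rewrite max_r ?add0r// subr_le0.
    have -> : g x = 0.
      rewrite -(gelfand_eval hC x Cg) gVK// => -[_]; apply.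
      by rewrite /K /= gelfand_eval// ltW.
    by rewrite addr0 ge_max ler01 andbT; lra.
  move=> y nVy; rewrite (state_add (gelfand_state hC y))// gfe.
  rewrite gVK ?addr0; last by move=> [].
  rewrite fVU; last by move=> [].
  by rewrite max_r// sub0r oppr_le0 ltW.
rewrite (state_add hmu)//; lra.
Qed.

Section Measure.
Variable y0 : spectrum C.

Let T := spectrum_at y0.

Let mass (E : set T) : \bar R := (outer_mass E)%:E.

Lemma riesz_measure : exists nu : probability (borel_spectrum y0) R,
  forall E, nu E = (outer_mass E)%:E.
Proof.
have h0 : mass set0 = 0%E by rewrite /mass outer_mass_set0.
have h1 E : (0 <= mass E)%E by rewrite lee_fin outer_mass_ge0.
have h2 : {homo mass : E F / E `<=` F >-> (E <= F)%E}.
  by move=> E F EF; rewrite lee_fin outer_mass_mono.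
have h3 : sigma_subadditive mass by move=> F; exact: outer_mass_subadditive.
pose massax := isOuterMeasure.Build R T mass h0 h1 h2 h3.
pose om : {outer_measure set T -> \bar R} := HB.pack mass massax.
have borelcara (E : set (borel_spectrum y0)) : measurable E -> om.-caratheodory E.
  apply: smallest_sub; first split.
  - exact: caratheodory_measurable_set0.
  - by move=> F hF; rewrite setTD; exact: (caratheodory_measurable_setC hF).
  - by move=> F hF; exact: (caratheodory_measurable_bigcup hF).
  - move=> U oU; apply: le_caratheodory_measurable => F.
    by rewrite -EFinD lee_fin; exact: outer_mass_caratheodory.
pose m (E : set (borel_spectrum y0)) : \bar R := (outer_mass E)%:E.
have m0 : m set0 = 0%E by rewrite /m outer_mass_set0.
have mge0 E : (0 <= m E)%E by rewrite lee_fin outer_mass_ge0.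
have madd : semi_sigma_additive m.
  move=> F mF tF mUF.
  apply: (@caratheodory_measure_sigma_additive R T om F) => //.
    by move=> i; exact: borelcara.
  exact: borelcara.
have m1 : m setT = 1%E.
  by rewrite /m outer_mass_open ?open_massT//; exact: openT.
pose max1 := isMeasure.Build _ (borel_spectrum y0) R m m0 mge0 madd.
pose M : {measure set (borel_spectrum y0) -> \bar R} := HB.pack m max1.
pose max2 := Measure_isProbability.Build _ (borel_spectrum y0) R M m1.
pose nu : probability (borel_spectrum y0) R := HB.pack m max1 max2.
by exists nu.
Qed.

End Measure.
End RieszMeasure.

(** * Integration against the constructed measure *)

Section Representation.
Variables (R : realType) (X : Type) (C : set (X -> R)).
Hypothesis hC : functional_base_algebra C.
Variables (x0 : X) (mu : (X -> R) -> R).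
Hypothesis hmu : states C mu.
Implicit Types (f g : X -> R).

Section Integration.
Variables (y0 : spectrum C) (nu : probability (borel_spectrum y0) R).

Lemma measurable_open (U : set (spectrum C)) :
  open U -> measurable (U : set (borel_spectrum y0)).
Proof. by move=> oU; exact: sub_sigma_algebra. Qed.

Lemma measurable_gelfand f :
  measurable_fun setT (fun_gelfand f : borel_spectrum y0 -> R).
Proof.
apply: (measurability _ (RGenOInfty.measurableE R)).
move=> _ [_ [r ->] <-]; rewrite setTI; apply: measurable_open.
rewrite (_ : _ @^-1` _ = [set y : spectrum C | r < fun_gelfand f y]).
  exact: gelfand_open.
by apply/seteqP; split=> y /=; rewrite in_itv/= andbT.
Qed.

Lemma gelfand_abs_le f (M : R) (y : spectrum C) : C f -> (forall x, `|f x| <= M) ->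
  `|fun_gelfand f y| <= M.
Proof.
move=> Cf fM; have hy := gelfand_state hC y; rewrite ler_norml.
apply/andP; split.
  by apply: (state_ge_cst hC hy Cf) => x; have := fM x; rewrite ler_norml => /andP[].
by apply: (state_le_cst hC hy Cf) => x; have := fM x; rewrite ler_norml => /andP[].
Qed.

Lemma integrable_gelfand f : C f ->
  nu.-integrable setT (fun y => (fun_gelfand f y)%:E).
Proof.
move=> Cf; have [M M0 fM] := fba_bound hC Cf.
apply: (@measurable_bounded_integrable _ _ _ nu (fun_gelfand f) setT).
- exact: measurableT.
- by apply: le_lt_trans (probability_le1 nu measurableT) _; rewrite ltry.
- exact: measurable_gelfand.
exists M; split; first exact: num_real.
by move=> r Mr y _; apply: le_trans (ltW Mr); exact: gelfand_abs_le.
Qed.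

Definition gelfand_integral f : R := fine (\int[nu]_y (fun_gelfand f y)%:E)%E.

Lemma gelfand_integralE f : C f ->
  (\int[nu]_y (fun_gelfand f y)%:E = (gelfand_integral f)%:E)%E.
Proof.
move=> Cf; rewrite /gelfand_integral fineK//.
exact: (integrable_fin_num measurableT (integrable_gelfand Cf)).
Qed.

Lemma gelfand_integral_cst (c : R) : gelfand_integral (fun=> c) = c.
Proof.
rewrite /gelfand_integral (eq_integral (cst c%:E)).
  by rewrite integral_cst//= probability_setT mule1.
by move=> y _ /=; rewrite (state_cst hC (gelfand_state hC y)).
Qed.

Lemma gelfand_integralD f g : C f -> C g ->
  gelfand_integral (fun x => f x + g x) = gelfand_integral f + gelfand_integral g.
Proof.
move=> Cf Cg; apply: EFin_inj; rewrite EFinD -!gelfand_integralE//; last exact: fba_add.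
rewrite -integralD_EFin//; [|exact: integrable_gelfand|exact: integrable_gelfand].
apply: eq_integral => y _; congr EFin.
by rewrite (state_add (gelfand_state hC y)).
Qed.

Lemma gelfand_integralZ c f : C f ->
  gelfand_integral (fun x => c * f x) = c * gelfand_integral f.
Proof.
move=> Cf; apply: EFin_inj; rewrite EFinM -!gelfand_integralE//; last exact: fba_scale.
rewrite -integralZl//; last exact: integrable_gelfand.
apply: eq_integral => y _; rewrite -EFinM; congr EFin.
by rewrite (state_scale (gelfand_state hC y)).
Qed.

(** Counts the layers starting below height [t]; after division by the number of layers the summand
    [1] is the discretization error. *)
Lemma sum_lt_le (t : R) n : 0 <= t -> \sum_(k < n) (k%:R < t)%R%:R <= t + 1 :> R.
Proof.
move=> t0; elim: n => [|n ih]; first by rewrite big_ord0 addr_ge0.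
have [nt|tn] := ltP n%:R t.
  apply: (@le_trans _ _ (\sum_(k < n.+1) 1)).
    by apply: ler_sum => k _; case: (_ < _).
  by rewrite sumr_const card_ord -natr1 lerD2r ltW.
by rewrite big_ord_recr/= ltNge tn addr0.
Qed.

Hypothesis mu_open : forall U f, open U -> below U f -> ((mu f)%:E <= nu U)%E.

(* Layer-cake: [f] is the sum over [k < N] of the pieces of height [1/N] lying
   above level [k/N], and [N] times such a piece is below [f > k/N]. *)
Lemma state_le_integral01 f : C f -> (forall x, 0 <= f x <= 1) ->
  mu f <= gelfand_integral f.
Proof.
move=> Cf f01; apply/ler_addgt0Pr => e e0.
pose N := (Num.truncn e^-1).+1; have N0 : (0 : R) < N%:R by [].
have Ne : N%:R^-1 <= e.
  by rewrite -[leRHS]invrK lef_pV2 ?posrE ?invr_gt0// ltW// truncnS_gt.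
pose U k : set (spectrum C) := [set y | k%:R / N%:R < fun_gelfand f y].
have oU k : open (U k) by exact: gelfand_open.
pose t k x := Num.min (f x) (k%:R / N%:R).
have Ct k : C (t k) by apply: fba_min => //; exact: fba_cst.
have gt k (y : spectrum C) : fun_gelfand (t k) y = Num.min (fun_gelfand f y) (k%:R / N%:R).
  by rewrite gelfand_min ?(state_cst hC (gelfand_state hC y))//; exact: fba_cst.
pose d k x := t k.+1 x - t k x.
have Cd k : C (d k) by exact: fba_sub.
have kk k : k.+1%:R / N%:R = k%:R / N%:R + N%:R^-1 :> R.
  by rewrite -natr1 mulrDl mul1r.
have iN : 0 < N%:R^-1 :> R by rewrite invr_gt0.
have bd k : below (U k) (fun x => N%:R * d k x).
  split; first exact: fba_scale.
    move=> x; rewrite /d /t kk -ler_pdivlMl// mulr1 pmulr_rge0//.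
    move: (f x) (k%:R / N%:R) => s c; move: (N%:R^-1) iN => i i0.
    by have [h|h] := leP s c; have [h'|h'] := leP s (c + i); apply/andP; split; lra.
  move=> y /negP; rewrite -leNgt => fy; rewrite (state_scale (gelfand_state hC y))//.
  rewrite (state_sub hC (gelfand_state hC y))// !gt kk !min_l ?subrr ?mulr0//.
  by rewrite (le_trans fy)// lerDl ltW.
have fE : f = (fun x => \sum_(k < N) d k x).
  apply/funext => x; rewrite -(big_mkord xpredT (fun k => d k x)) telescope_sumr//.
  have /andP[f0 f1] := f01 x.
  by rewrite /t mul0r divff ?gt_eqF// min_l// min_r// subr0.
have muf : ((mu f)%:E <= \sum_(k < N) (N%:R^-1)%:E * nu (U k))%E.
  rewrite {1}fE (state_sum hC hmu (F := fun (k : 'I_N) x => d k x))// -sumEFin.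
  apply: lee_sum => k _; rewrite -[mu (d k)](mulKf (lt0r_neq0 N0)) EFinM.
  apply: lee_wpmul2l; first by rewrite lee_fin ltW.
  rewrite -(state_scale hmu)//; exact: mu_open.
have mU k : measurable (U k : set (borel_spectrum y0)) by exact: measurable_open.
rewrite -lee_fin EFinD; apply: (le_trans muf).
apply: (@le_trans _ _ (\int[nu]_y ((fun_gelfand f y)%:E + (N%:R^-1)%:E))%E); last first.
  rewrite integralD_EFin//; last exact: (finite_measure_integrable_cst nu N%:R^-1).
    rewrite gelfand_integralE// leeD2l// (integral_cst _ _ N%:R^-1%:E)//=.
    by rewrite probability_setT mule1 lee_fin.
  exact: integrable_gelfand.
have -> : (\sum_(k < N) (N%:R^-1)%:E * nu (U k) =
    \int[nu]_y \sum_(k < N) ((N%:R^-1)%:E * (\1_(U k) y)%:E))%E.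
  rewrite ge0_integral_sum//.
  - apply: eq_bigr => k _; rewrite ge0_integralZl//.
    + by rewrite integral_indic// setIT.
    + exact/measurable_EFinP/measurable_indic.
  - move=> k; apply: measurable_funeM; exact/measurable_EFinP/measurable_indic.
apply: ge0_le_integral => //.
- by move=> y _; apply: sume_ge0 => k _; rewrite -EFinM lee_fin mulr_ge0.
- by apply: emeasurable_sum => k; apply: measurable_funeM;
    exact/measurable_EFinP/measurable_indic.
- by apply/measurable_EFinP; apply: measurable_funD => //; exact: measurable_gelfand.
move=> y _; rewrite sumEFin -EFinD lee_fin -mulr_sumr.
have gf0 : 0 <= fun_gelfand f y.
  by apply: (state_ge0 (gelfand_state hC y)) => // x; have /andP[] := f01 x.
have -> : \sum_(k < N) \1_(U k) y = \sum_(k < N) (k%:R < N%:R * fun_gelfand f y)%R%:R :> R.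
  apply: eq_bigr => k _; rewrite indicE; congr (nat_of_bool _)%:R.
  rewrite -ltr_pdivrMl// mulrC.
  by apply/idP/idP => [/set_mem//|h]; apply/mem_set.
apply: (@le_trans _ _ (N%:R^-1 * (N%:R * fun_gelfand f y + 1))).
  by rewrite ler_wpM2l ?(ltW iN)// sum_lt_le// mulr_ge0.
by rewrite mulrDr mulKf ?gt_eqF// mulr1.
Qed.

Lemma state_le_integral f : C f -> mu f <= gelfand_integral f.
Proof.
move=> Cf; have [M M0 fM] := fba_bound hC Cf.
have M20 : 0 < 2 * M by rewrite mulr_gt0.
pose g x := (2 * M)^-1 * (f x + M).
have CfM : C (fun x => f x + M) by apply: fba_add => //; exact: fba_cst.
have Cg : C g by exact: fba_scale.
have g01 x : 0 <= g x <= 1.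
  have := fM x; rewrite ler_norml => /andP[f1 f2].
  rewrite /g mulr_ge0 ?invr_ge0 ?(ltW M20)//=; first by rewrite ler_pdivrMl//; lra.
  lra.
have := state_le_integral01 Cg g01.
rewrite (state_scale hmu)// gelfand_integralZ// ler_pM2l ?invr_gt0//.
rewrite (state_add hmu)//; last exact: fba_cst.
rewrite gelfand_integralD//; last exact: fba_cst.
by rewrite (state_cst hC hmu) gelfand_integral_cst lerD2r.
Qed.

(** The inequality between [mu] and the integral holds on the whole vector space [C]; applied to
    [- f] it becomes an equality. *)
Lemma state_represented : represents nu mu.
Proof.
move=> f Cf; rewrite gelfand_integralE//; congr EFin; apply/eqP.
rewrite eq_le state_le_integral// andbT.
have := state_le_integral (fba_scale hC (-1) Cf).
by rewrite (state_scale hmu)// gelfand_integralZ// !mulN1r lerN2.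
Qed.

End Integration.

Theorem riesz_representation : exists (y0 : spectrum C)
  (nu : probability (borel_spectrum y0) R), regular_measure nu /\ represents nu mu.
Proof.
exists (eval_char hC x0).
have [nu nuE] := riesz_measure hC hmu (eval_char hC x0).
exists nu; split; last first.
  apply: state_represented => U f oU fU.
  by rewrite nuE lee_fin outer_mass_open//; exact: le_open_mass.
move=> E mE; split; apply/eqP; rewrite eq_le; apply/andP; split.
- apply: le_ereal_inf_tmp => _ [U [oU EU] <-].
  by rewrite !nuE lee_fin; exact: outer_mass_mono.
- apply/lee_addgt0Pr => e e0.
  have [U [oU EU h]] := outer_mass_adherent hC hmu E e0.
  apply: (@le_trans _ _ (nu U)); first by apply: ereal_inf_lbound; exists U.
  by rewrite !nuE -EFinD lee_fin outer_mass_open// ltW.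
(* Inner regularity is outer regularity of the complement, closed sets being compact here. *)
- apply/lee_addgt0Pr => e e0.
  have [U [oU EU h]] := outer_mass_adherent hC hmu (~` E) e0.
  have Kc : closed (~` U) by exact: open_closedC.
  apply: (@le_trans _ _ (nu (~` U) + e%:E)%E).
    have mU : measurable (U : set (borel_spectrum (eval_char hC x0))).
      exact: measurable_open.
    rewrite probability_setC// -[X in (nu X <= _)%E]setCK.
    rewrite probability_setC; last exact: measurableC.
    rewrite !nuE (outer_mass_open hC hmu oU) -!EFinB -EFinD lee_fin; lra.
  rewrite leeD2r//; apply: ereal_sup_ubound; exists (~` U) => //; split.
    exact: spectrum_closed_compact.
  by rewrite -[E]setCK; exact: subsetC.
- apply: ge_ereal_sup => _ [K [_ KE] <-].
  by rewrite !nuE lee_fin; exact: outer_mass_mono.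
Qed.

End Representation.

(** * The integral of a logarithm *)

Section LnIntegral.
Variables (R : realType) (X : Type) (C : set (X -> R)).
Hypothesis hC : functional_base_algebra C.
Variables (x0 : X) (mu : (X -> R) -> R).
Hypothesis hmu : states C mu.
Local Open Scope ereal_scope.

(** For [s > 0] the sequence is eventually constant; at [s = 0] it is [ln (k + 1)] and tends to
    [+oo]. *)
Lemma lne_max_cvg (s : R) : (0 <= s)%R ->
  maxe (- (ln (Num.max s k.+1%:R^-1))%:E) 0 @[k --> \oo] --> maxe (- lne s%:E) 0.
Proof.
rewrite le_eqVlt => /predU1P[<-|s0].
  rewrite le0_lneNy//= max_l ?leey//; apply/cvgeyPge => A.
  near=> k; rewrite [X in ln X]max_r ?invr_ge0// lnV ?posrE//= opprK le_max lee_fin.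
  apply/orP; left; rewrite -[leLHS]expRK ler_ln ?posrE ?expR_gt0//.
  apply: le_trans (ltW (truncnS_gt _)) _; rewrite ler_nat ltnS.
  by near: k; exists (Num.truncn (expR A)).
rewrite lne_EFin//; apply: cvg_near_cst; near=> k; congr (maxe (- (ln _)%:E) _).
apply: max_l; rewrite -[leRHS]invrK lef_pV2 ?posrE ?invr_gt0//.
apply: le_trans (ltW (truncnS_gt _)) _; rewrite ler_nat ltnS.
by near: k; exists (Num.truncn s^-1).
Unshelve. all: by end_near. Qed.

(** The truncation levels are at most 1, so all truncations share the positive part of [lne f],
    whose integral is finite. Only the negative parts vary; they increase with [k], and monotone
    convergence applies to them. *)
Lemma integral_lne_gelfand (y0 : spectrum C)
    (nu : probability (borel_spectrum y0) R) f : represents nu mu -> C f ->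
  (forall x, 0 <= f x)%R ->
  \int[nu]_y lne (fun_gelfand f y)%:E =
  ereal_inf [set (mu (fun x => ln (Num.max (f x) e)))%:E | e in [set e | (0 < e)%R]].
Proof.
move=> numu Cf f0.
pose ep k : R := (k.+1%:R^-1)%R.
have ep0 k : (0 < ep k)%R by rewrite invr_gt0.
have ep1 k : (ep k <= 1)%R by rewrite invf_le1// ler1n.
pose hf k x := ln (Num.max (f x) (ep k)).
have Ch k : C (hf k) by exact: fba_ln_max.
pose h k (y : borel_spectrum y0) := (fun_gelfand (hf k) y)%:E.
have hE k y : h k y = (ln (Num.max (fun_gelfand f y) (ep k)))%:E.
  by rewrite /h gelfand_ln_max.
have ih k : nu.-integrable setT (h k) by exact: integrable_gelfand.
pose F (y : borel_spectrum y0) := lne (fun_gelfand f y)%:E.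
have gf0 (y : spectrum C) : (0 <= fun_gelfand f y)%R.
  exact: (state_ge0 (gelfand_state hC y) Cf f0).
have posE k : F^\+ = (h k)^\+.
  apply/funext => y; rewrite !unlock /F hE; have := gf0 y.
  rewrite le_eqVlt => /predU1P[<-|g0].
    rewrite le0_lneNy// max_r ?leNye// [X in ln X]max_r ?(ltW (ep0 k))// max_r// lee_fin.
    by rewrite -ln1 ler_ln ?posrE.
  rewrite lne_EFin//; have [//|ge] := leP (ep k) (fun_gelfand f y).
  rewrite !max_r// lee_fin -ln1 ler_ln ?posrE//.
  by rewrite (le_trans (ltW ge)).
have negcvg y : (h k)^\- y @[k --> \oo] --> F^\- y.
  have := lne_max_cvg (gf0 y); rewrite unlock.
  by under eq_fun do rewrite -hE.
have int_neg : \int[nu]_y (h k)^\- y @[k --> \oo] --> \int[nu]_y F^\- y.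
  have -> : \int[nu]_y F^\- y = \int[nu]_y limn (fun k => (h k)^\- y).
    by apply: eq_integral => y _; apply/esym/cvg_lim => //; exact: negcvg.
  apply: cvg_monotone_convergence => //.
  - move=> k; apply: measurable_funeneg.
    by have /integrableP[] := ih k.
  - move=> y _ m n mn; rewrite unlock !hE.
    have h2 : (ep n <= ep m)%R by rewrite lef_pV2 ?posrE// ler_nat ltnS.
    have hln : (ln (Num.max (fun_gelfand f y) (ep n)) <=
        ln (Num.max (fun_gelfand f y) (ep m)))%R.
      rewrite ler_ln ?posrE ?lt_max ?ep0 ?orbT//.
      by rewrite ge_max !le_max lexx h2 !orbT.
    by rewrite ge_max !le_max leeN2 lee_fin hln lexx orbT.
have P_fin : \int[nu]_y F^\+ y \is a fin_num.
  rewrite (posE 0%N); apply: integrable_fin_num => //; exact: integrable_funepos.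
have muk k : (mu (hf k))%:E = \int[nu]_y F^\+ y - \int[nu]_y (h k)^\- y.
  by rewrite -(numu _ (Ch k)) integralE (posE k).
have cvgF : (mu (hf k))%:E @[k --> \oo] --> \int[nu]_y F y.
  rewrite integralE; under eq_fun do rewrite muk.
  apply: cvgeB => //; last exact: cvg_cst.
  exact: fin_num_adde_defr.
have mono (e e' : R) : (0 < e)%R -> (e <= e')%R ->
    (mu (fun x => ln (Num.max (f x) e)) <= mu (fun x => ln (Num.max (f x) e')))%R.
  move=> e0 ee'; have e'0 := lt_le_trans e0 ee'.
  apply: (state_le hC hmu); [exact: fba_ln_max|exact: fba_ln_max|move=> x].
  rewrite ler_ln ?posrE ?lt_max ?e0 ?e'0 ?orbT//.
  by rewrite ge_max !le_max lexx ee' !orbT.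
have cvgI : (mu (hf k))%:E @[k --> \oo] --> ereal_inf (range (fun k => (mu (hf k))%:E)).
  apply: ereal_nonincreasing_cvgn => m n mn; rewrite lee_fin; apply: mono => //.
  by rewrite lef_pV2 ?posrE// ler_nat ltnS.
have -> : \int[nu]_y lne (fun_gelfand f y)%:E = ereal_inf (range (fun k => (mu (hf k))%:E)).
  exact: cvg_unique cvgF cvgI.
apply/eqP; rewrite eq_le; apply/andP; split.
  apply: le_ereal_inf_tmp => _ [e /= e0 <-].
  apply: (@le_trans _ _ (mu (hf (Num.truncn e^-1)))%:E).
    by apply: ereal_inf_lbound; exists (Num.truncn e^-1).
  rewrite lee_fin; apply: mono => //.
  by rewrite -[leRHS]invrK lef_pV2 ?posrE ?invr_gt0// ltW// truncnS_gt.
by apply: ereal_inf_le_tmp => _ [k _ <-]; exists (ep k) => //=.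
Qed.

(** Every representing measure yields this infimum, so the choice made by [get] is determined once
    one regular representing measure exists. *)
Lemma ln_integralE f : C f -> (forall x, 0 <= f x)%R ->
  ln_integral C mu f =
  ereal_inf [set (mu (fun x => ln (Num.max (f x) e)))%:E | e in [set e | (0 < e)%R]].
Proof.
move=> Cf f0; rewrite /ln_integral; set V := [set v | _].
have [y0 [nu [reg rep]]] := riesz_representation hC x0 hmu.
have [y1 [nu' [_ rep' ->]]] : V (get V).
  by apply: getPex; exists (\int[nu]_y lne (fun_gelfand f y)%:E), y0, nu.
exact: integral_lne_gelfand.
Qed.

End LnIntegral.

(** * Existence of characters *)

Section SeminormCharacter.
Variables (R : realType) (K : comNzRingType) (c : {rmorphism R[i] -> K}).
Variable N0 : K -> R.

Definition modulus (l : R[i]) : R := complex.Re `|l|.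

Lemma modulusE (l : R[i]) : `|l| = (modulus l)%:C%C.
Proof. by rewrite /modulus RRe_real// normr_real. Qed.

Lemma modulus_ge0 l : 0 <= modulus l.
Proof. by rewrite -lecR -modulusE normr_ge0. Qed.

Lemma modulusM l m : modulus (l * m) = modulus l * modulus m.
Proof. by apply: complexI; rewrite -modulusE normrM !modulusE rmorphM. Qed.

Lemma modulus_real (r : R) : modulus r%:C%C = `|r|.
Proof. by apply: complexI; rewrite -modulusE normc_def /= expr0n addr0 sqrtr_sqr. Qed.

Lemma modulus_eq0 l : modulus l = 0 -> l = 0.
Proof. by move=> h; apply/eqP; rewrite -normr_eq0 modulusE h. Qed.

Lemma le_Re_modulus l : `|complex.Re l| <= modulus l.
Proof.
by rewrite /modulus normc_def /= -[leLHS]sqrtr_sqr ler_wsqrtr// lerDl sqr_ge0.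
Qed.

Lemma le_Im_modulus l : `|complex.Im l| <= modulus l.
Proof.
by rewrite /modulus normc_def /= -[leLHS]sqrtr_sqr ler_wsqrtr// lerDr sqr_ge0.
Qed.

Lemma modulus1 : modulus 1 = 1.
Proof. by rewrite (_ : 1 = 1%:C%C)// modulus_real normr1. Qed.

Hypothesis N0_ge0 : forall x, 0 <= N0 x.
Hypothesis N0D : forall x y, N0 (x + y) <= N0 x + N0 y.
Hypothesis N0M : forall x y, N0 (x * y) <= N0 x * N0 y.
Hypothesis N01 : N0 1 = 1.
Hypothesis N0c : forall l, N0 (c l) <= modulus l.

(** [asn_sqr] makes [N] multiplicative on squares, so that [N (f^(2^k))] stays positive when [N f]
    is. *)
Record algebra_seminorm (N : K -> R) : Prop := AlgebraSeminorm {
  asn_ge0 : forall x, 0 <= N x;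
  asn_add : forall x y, N (x + y) <= N x + N y;
  asn_mul : forall x y, N (x * y) <= N x * N y;
  asn_one : N 1 = 1;
  asn_sqr : forall x, N x ^+ 2 <= N (x ^+ 2);
  asn_le : forall x, N x <= N0 x }.

Lemma geometric_rate_le (r d M : R) : 0 < d ->
  (forall n, (0 < n)%N -> r ^+ n <= M * d ^+ n) -> r <= d.
Proof.
move=> d0 h; rewrite leNgt; apply/negP => dr.
have [n hn] := expr_eventually_dom (M + 1) d0 dr.
have := le_trans (hn n.+1 (leqnSn n)) (h n.+1 isT).
by rewrite leNgt ltr_pM2r ?exprn_gt0// ltrDl ltr01.
Qed.

(* The witness is [x |-> lim_n N0 (x^n)^(1/n)]. *)
Lemma spectral_seminorm : exists N, algebra_seminorm N.
Proof.
have rate x : exists r : R, [/\ 0 <= r, forall n, (0 < n)%N -> r ^+ n <= N0 (x ^+ n) &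
    forall d, r < d -> exists2 M : R, 0 < M & forall n, N0 (x ^+ n) <= M * d ^+ n].
  have [|r r0 [_ h1 h2]] := @submul_rate R (fun n => N0 (x ^+ n)) (fun n => N0_ge0 _).
    by move=> m n; rewrite exprD; exact: N0M.
  by exists r.
have [rho hrho] := choice rate.
have rho0 x : 0 <= rho x by have [] := hrho x.
have rho_pow x n : (0 < n)%N -> rho x ^+ n <= N0 (x ^+ n).
  by have [_ h _] := hrho x; exact: h.
have rho_bnd x d : rho x < d -> exists2 M : R, 0 < M & forall n, N0 (x ^+ n) <= M * d ^+ n.
  by have [_ _ h] := hrho x; exact: h.
have rho_le x (d M : R) : 0 < d -> (forall n, N0 (x ^+ n) <= M * d ^+ n) -> rho x <= d.
  by move=> d0 h; apply: (geometric_rate_le d0) => n n0;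
    exact: le_trans (rho_pow x n n0) (h n).
have rho_lt x (e : R) : 0 < e -> 0 < rho x + e by move=> e0; rewrite ltr_wpDl.
exists rho; split=> //.
- move=> x y; apply/ler_addgt0Pr => e e0.
  have e2 : 0 < e / 2 by rewrite divr_gt0.
  have [|M1 M10 h1] := rho_bnd x (rho x + e / 2); first by rewrite ltrDl.
  have [|M2 M20 h2] := rho_bnd y (rho y + e / 2); first by rewrite ltrDl.
  set u := rho x + e / 2 in h1 *; set v := rho y + e / 2 in h2 *.
  have u0 : 0 < u by exact: rho_lt.
  have v0 : 0 < v by exact: rho_lt.
  have -> : rho x + rho y + e = u + v by rewrite /u /v; field.
  (* The prefactors [x^i y^j] make the estimate inductive in [n], in place of a binomial
     expansion. *)
  have key n : forall i j, N0 (x ^+ i * y ^+ j * (x + y) ^+ n) <=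
      M1 * M2 * (u ^+ i * v ^+ j * (u + v) ^+ n).
    elim: n => [|n ih] i j.
      rewrite !expr0 !mulr1 mulrACA; apply: le_trans (N0M _ _) _.
      by rewrite ler_pM.
    have -> : x ^+ i * y ^+ j * (x + y) ^+ n.+1 =
        x ^+ i.+1 * y ^+ j * (x + y) ^+ n + x ^+ i * y ^+ j.+1 * (x + y) ^+ n.
      by rewrite !exprS; ring.
    apply: le_trans (N0D _ _) _; apply: le_trans (lerD (ih i.+1 j) (ih i j.+1)) _.
    rewrite le_eqVlt; apply/orP; left; apply/eqP; rewrite !exprS; ring.
  apply: (rho_le _ _ (M1 * M2)); first exact: addr_gt0.
  by move=> n; have := key n 0%N 0%N; rewrite !expr0 !mul1r.
- move=> x y; apply/ler_addgt0Pr => e e0.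
  pose d := Num.min 1 (e / (rho x + rho y + 1)).
  have s0 : 0 < rho x + rho y + 1 by rewrite ltr_wpDl// addr_ge0.
  have d0 : 0 < d by rewrite lt_min ltr01/= divr_gt0.
  have d1 : d <= 1 by rewrite /d ge_min lexx.
  have de : d * (rho x + rho y + 1) <= e.
    by rewrite -ler_pdivlMr// /d ge_min lexx orbT.
  have [|M1 M10 h1] := rho_bnd x (rho x + d); first by rewrite ltrDl.
  have [|M2 M20 h2] := rho_bnd y (rho y + d); first by rewrite ltrDl.
  apply: (@le_trans _ _ ((rho x + d) * (rho y + d))); last first.
    have : d * d <= d by rewrite -[leRHS]mulr1 ler_wpM2l// ltW.
    by lra.
  apply: (rho_le _ _ (M1 * M2)); first by rewrite mulr_gt0// rho_lt.
  move=> n; rewrite !exprMn; apply: le_trans (N0M _ _) _.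
  by rewrite mulrACA ler_pM.
- apply/eqP; rewrite eq_le; apply/andP; split.
    by have := rho_pow 1 1%N isT; rewrite !expr1 N01.
  apply/ler_addgt0Pr => e e0.
  have [|M M0 h] := rho_bnd 1 (rho 1 + e); first by rewrite ltrDl.
  apply: (@geometric_rate_le _ _ M); first exact: rho_lt.
  by move=> n _; have := h n; rewrite !expr1n N01.
- move=> x; apply/ler_addgt0Pr => e e0.
  have [|M M0 h] := rho_bnd (x ^+ 2) (rho (x ^+ 2) + e); first by rewrite ltrDl.
  apply: (@geometric_rate_le _ _ M); first exact: rho_lt.
  move=> n n0; rewrite -!exprM; apply: le_trans (rho_pow x (2 * n)%N _) _.
    by rewrite muln_gt0.
  by rewrite exprM.
- by move=> x; have := rho_pow x 1%N isT; rewrite !expr1.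
Qed.

Lemma le_inf_mul (S : set R) (a b : R) : S !=set0 -> 0 <= b ->
  (forall s, S s -> a <= s * b) -> a <= inf S * b.
Proof.
move=> S0; rewrite le_eqVlt => /predU1P[<-|b0] h.
  by have [s /h] := S0; rewrite !mulr0.
by rewrite -ler_pdivrMr//; apply: lb_le_inf => // s /h; rewrite ler_pdivrMr.
Qed.

(** Zorn's lemma below the spectral seminorm. Two members of a chain have a common smaller one in
    it, so submultiplicativity and subadditivity pass to the infimum. *)
Lemma minimal_seminorm : exists2 N, algebra_seminorm N &
  forall N', algebra_seminorm N' -> (forall x, N' x <= N x) -> forall x, N x <= N' x.
Proof.
pose T := {N | algebra_seminorm N}.
have [N1 hN1] := spectral_seminorm.
pose Rel (s t : T) := `[< forall x, proj1_sig t x <= proj1_sig s x >].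
have [||A Atot|[N hN] Nmin] := @ZL_preorder T (exist _ N1 hN1) Rel.
- by move=> t; apply/asboolP.
- by move=> r s t /asboolP rs /asboolP st; apply/asboolP => x; exact: le_trans (st x) (rs x).
- have [[s0 As0]|noA] := pselect (exists r : T, A r); last first.
    by exists (exist _ N1 hN1) => s As; case: noA; exists s.
  pose S x : set R := [set proj1_sig r x | r in A].
  have S_ne x : S x !=set0 by exists (proj1_sig s0 x), s0.
  have S_inf x : has_inf (S x).
    by split=> //; exists 0 => _ [r _ <-]; exact: (asn_ge0 (proj2_sig r)).
  pose t x := inf (S x).
  have t_le (r : T) x : A r -> t x <= proj1_sig r x.
    by move=> Ar; apply: ge_inf; [exact: (S_inf x).2|exists r].
  have t0 x : 0 <= t x.
    by apply: lb_le_inf => // _ [r _ <-]; exact: (asn_ge0 (proj2_sig r)).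
  have smaller (r1 r2 : T) : A r1 -> A r2 -> exists r, [/\ A r,
      forall x, proj1_sig r x <= proj1_sig r1 x & forall x, proj1_sig r x <= proj1_sig r2 x].
    move=> A1 A2; have [/asboolP h|/asboolP h] := Atot _ _ A1 A2.
      by exists r2; split.
    by exists r1; split.
  have tM x y : t (x * y) <= t x * t y.
    apply: (@le_inf_mul (S x) _ (t y)) => // _ [r1 A1 <-]; rewrite [leRHS]mulrC.
    apply: (@le_inf_mul (S y) _ (proj1_sig r1 x)); [exact: S_ne|exact: (asn_ge0 (proj2_sig r1))|].
    move=> _ [r2 A2 <-]; have [r [Ar h1 h2]] := smaller _ _ A1 A2.
    apply: le_trans (t_le r _ Ar) _; apply: le_trans (asn_mul (proj2_sig r) _ _) _.
    by rewrite [leRHS]mulrC ler_pM// (asn_ge0 (proj2_sig r)).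
  have ht : algebra_seminorm t.
    split=> //.
    + move=> x y; rewrite -lerBlDr; apply: lb_le_inf => // _ [r1 A1 <-].
      rewrite lerBlDr -lerBlDl; apply: lb_le_inf => // _ [r2 A2 <-]; rewrite lerBlDl.
      have [r [Ar h1 h2]] := smaller _ _ A1 A2.
      apply: le_trans (t_le r _ Ar) _; apply: le_trans (asn_add (proj2_sig r) _ _) _.
      exact: lerD.
    + apply/eqP; rewrite eq_le; apply/andP; split.
        by rewrite -[leRHS](asn_one (proj2_sig s0)) t_le.
      by apply: lb_le_inf => // _ [r _ <-]; rewrite (asn_one (proj2_sig r)).
    + move=> x; apply: lb_le_inf => // _ [r Ar <-].
      apply: le_trans (asn_sqr (proj2_sig r) x).
      by rewrite lerXn2r ?nnegrE ?t_le// (asn_ge0 (proj2_sig r)).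
    + by move=> x; apply: le_trans (t_le _ _ As0) _; exact: (asn_le (proj2_sig s0)).
  exists (exist _ t ht) => s As; apply/asboolP => x /=; exact: t_le.
- exists N => // N' hN' N'N x.
  have := Nmin (exist _ N' hN') (introT (asboolP _) N'N).
  by move=> /asboolP; exact.
Qed.

(* For [N f > 0], the limit of [N (g * f^(2^k)) / N (f^(2^k))] is again such a
   seminorm in [g], at most [N], hence equal to [N]. *)
Lemma minimal_seminorm_mul N : algebra_seminorm N ->
  (forall N', algebra_seminorm N' -> (forall x, N' x <= N x) -> forall x, N x <= N' x) ->
  forall x y, N (x * y) = N x * N y.
Proof.
move=> hN Nmin x f; apply/eqP; rewrite eq_le (asn_mul hN)/=.
have /predU1P[<-|f0] : (0 == N f) || (0 < N f) by rewrite -le_eqVlt (asn_ge0 hN).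
  by rewrite mulr0 (asn_ge0 hN).
have sqrE z : N (z ^+ 2) = N z ^+ 2.
  by apply/eqP; rewrite eq_le (asn_sqr hN) andbT !expr2 (asn_mul hN).
pose e k := f ^+ (2 ^ k).
have eS k : e k.+1 = e k ^+ 2 by rewrite /e expnSr exprM.
have ek0 k : 0 < N (e k).
  by elim: k => [|k ih]; [rewrite /e expn0 expr1|rewrite eS sqrE exprn_gt0].
pose q k g := N (g * e k) / N (e k).
have q0 k g : 0 <= q k g by rewrite divr_ge0 ?(asn_ge0 hN).
have qS k g : q k.+1 g <= q k g.
  rewrite /q eS sqrE ler_pdivrMr ?exprn_gt0// expr2 mulrA expr2 mulrA.
  by rewrite divfK ?gt_eqF// (asn_mul hN).
have q_anti k m g : (k <= m)%N -> q m g <= q k g.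
  move=> /subnK <-; elim: (m - k)%N => [//|d ih]; rewrite addSn.
  exact: le_trans (qS _ _) ih.
pose S g : set R := [set q k g | k in setT].
have S_ne g : S g !=set0 by exists (q 0%N g), 0%N.
have S_inf g : has_inf (S g) by split=> //; exists 0 => _ [k _ <-]; exact: q0.
pose t g := inf (S g).
have t_le k g : t g <= q k g by apply: ge_inf; [exact: (S_inf g).2|exists k].
have t0 g : 0 <= t g by apply: lb_le_inf => // _ [k _ <-]; exact: q0.
have ht : algebra_seminorm t.
  split=> //.
  - move=> g h; rewrite -lerBlDr; apply: lb_le_inf => // _ [k _ <-].
    rewrite lerBlDr -lerBlDl; apply: lb_le_inf => // _ [m _ <-]; rewrite lerBlDl.
    apply: le_trans (t_le (maxn k m) _) _.
    apply: le_trans (_ : q (maxn k m) g + q (maxn k m) h <= _).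
      by rewrite /q -mulrDl ler_wpM2r ?invr_ge0 ?(asn_ge0 hN)// mulrDl (asn_add hN).
    by rewrite lerD// q_anti// ?leq_maxl// leq_maxr.
  - move=> g h; apply: (@le_inf_mul (S g) _ (t h)) => // _ [k _ <-]; rewrite [leRHS]mulrC.
    apply: (@le_inf_mul (S h) _ (q k g)) => // _ [m _ <-]; rewrite [leRHS]mulrC.
    (* One index further the denominator is a square, [e (k + 1) = e k ^ 2], and can be shared
       between the two factors. *)
    apply: le_trans (t_le (maxn k m).+1 _) _.
    apply: le_trans (_ : q (maxn k m) g * q (maxn k m) h <= _); last first.
      by rewrite ler_pM// q_anti// ?leq_maxl// leq_maxr.
    rewrite /q eS sqrE mulf_div -expr2 ler_wpM2r ?invr_ge0 ?exprn_ge0 ?(asn_ge0 hN)//.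
    by rewrite expr2 mulrACA (asn_mul hN).
  - apply/eqP; rewrite eq_le; apply/andP; split.
      by apply: le_trans (t_le 0%N _) _; rewrite /q mul1r divff// gt_eqF.
    by apply: lb_le_inf => // _ [k _ <-]; rewrite /q mul1r divff// gt_eqF.
  - move=> g; apply: lb_le_inf => // _ [k _ <-]; apply: le_trans (qS k _).
    rewrite /q eS -exprMn !sqrE -exprVn -exprMn.
    by rewrite lerXn2r ?nnegrE// ?divr_ge0 ?(asn_ge0 hN)// t_le.
  - move=> g; apply: le_trans (t_le 0%N g) _; apply: le_trans (asn_le hN g).
    by rewrite /q ler_pdivrMr// (asn_mul hN).
have tN g : t g <= N g.
  by apply: le_trans (t_le 0%N g) _; rewrite /q ler_pdivrMr// (asn_mul hN).
(* Minimality gives [N x <= t x <= q 0 x = N (x f) / N f], the missing inequality. *)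
have := le_trans (Nmin t ht tN x) (t_le 0%N x).
by rewrite /q /e expn0 expr1 ler_pdivlMr.
Qed.

Section Ostrowski.
Variable N : K -> R.
Hypothesis hN : algebra_seminorm N.
Hypothesis NM : forall x y, N (x * y) = N x * N y.

Lemma seminorm_scalar l : N (c l) = modulus l.
Proof.
have le m : N (c m) <= modulus m by exact: le_trans (asn_le hN _) (N0c m).
apply/eqP; rewrite eq_le le/=; have [->|l0] := eqVneq l 0.
  by rewrite (_ : modulus 0 = 0) ?(asn_ge0 hN)// (_ : 0 = 0%:C%C)// modulus_real normr0.
have ml : 0 < modulus l.
  by rewrite lt_def modulus_ge0 andbT; apply: contraNneq l0 => /modulus_eq0 ->.
have : 1 <= N (c l) * modulus l^-1.
  rewrite -[leLHS](asn_one hN) -(rmorph1 c) -(divff l0) rmorphM NM.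
  by rewrite ler_wpM2l ?(asn_ge0 hN).
have -> : modulus l^-1 = (modulus l)^-1.
  apply: (mulfI (lt0r_neq0 ml)).
  by rewrite -modulusM !divff ?modulus1// gt_eqF.
by rewrite ler_pdivlMr// mul1r.
Qed.

Lemma seminormN x : N (- x) = N x.
Proof.
rewrite -mulN1r NM -(rmorph1 c) -rmorphN seminorm_scalar.
rewrite (_ : -1 = (-1)%:C%C); last by rewrite rmorphN1.
by rewrite modulus_real normrN1 mul1r.
Qed.

Lemma seminormB_le x y : N x - N y <= N (x - y).
Proof. by rewrite lerBlDr -[in leLHS](subrK y x) (asn_add hN). Qed.

Lemma seminorm_lip x l m :
  `|N (x - c l) - N (x - c m)| <= modulus (l - m).
Proof.
have h u v : N (x - c u) - N (x - c v) <= modulus (u - v).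
  apply: le_trans (seminormB_le _ _) _.
  have -> : x - c u - (x - c v) = - c (u - v) by rewrite rmorphB; ring.
  by rewrite seminormN seminorm_scalar.
rewrite ler_norml h andbT lerNl opprB; apply: le_trans (h m l) _.
by rewrite -seminorm_scalar -seminormN -rmorphN opprB seminorm_scalar.
Qed.

Lemma lip_continuous (g : R -> R) : (forall s t, `|g s - g t| <= `|s - t|) ->
  continuous g.
Proof.
move=> gl t; apply/cvgrPdist_le => e e0; near=> s.
apply: le_trans (gl t s) (ltW _); near: s.
exact: (nbhsx_ballx t e e0).
Unshelve. all: by end_near. Qed.

(** Outside the square of half-side [2 N x], the value exceeds [N x], which is the value at 0.
    Inside, the extreme value theorem is used once per coordinate; the inner minimum is again
    1-Lipschitz in the outer variable. *)
Lemma seminorm_attained x : exists l, forall m, N (x - c l) <= N (x - c m).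
Proof.
pose E (u v : R) := N (x - c (u +i* v)%C).
have modi u v u' v' : modulus ((u +i* v)%C - (u' +i* v')%C) <= `|u - u'| + `|v - v'|.
  rewrite /modulus normc_def /= -[leRHS]ger0_norm ?addr_ge0// -sqrtr_sqr ler_wsqrtr//.
  have a0 := normr_ge0 (u - u'); have b0 := normr_ge0 (v - v').
  rewrite -(real_normK (num_real (u - u'))) -(real_normK (num_real (v - v'))).
  by rewrite sqrrD lerD2r lerDl mulrn_wge0// mulr_ge0.
have Elip u v u' v' : `|E u v - E u' v'| <= `|u - u'| + `|v - v'|.
  exact: le_trans (seminorm_lip x _ _) (modi u v u' v').
pose M := 2 * N x.
have M0 : - M <= M by have := asn_ge0 hN x; rewrite /M; lra.
have minv u : exists w, (w \in `[- M, M]) /\ forall v, v \in `[- M, M] -> E u w <= E u v.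
  have [|w wM hw] := @EVT_min R (E u) (- M) M M0; last by exists w.
  apply: continuous_subspaceT; apply: lip_continuous => s t.
  by have := Elip u s u t; rewrite subrr normr0 add0r.
have [b hb] := choice minv.
have [|a aM ha] := @EVT_min R (fun u => E u (b u)) (- M) M M0.
  apply: continuous_subspaceT; apply: lip_continuous => s t.
  have h s' t' : E s' (b s') - E t' (b t') <= `|s' - t'|.
    have := (hb s').2 _ (hb t').1; have := Elip s' (b t') t' (b t').
    by rewrite subrr normr0 addr0 ler_norml => /andP[]; lra.
  by rewrite ler_norml h andbT lerNl opprB distrC.
exists (a +i* b a)%C => m; rewrite -/(E a (b a)).
have box u v : u \in `[- M, M] -> v \in `[- M, M] -> E a (b a) <= E u v.
  by move=> uM vM; apply: le_trans (ha u uM) _; exact: (hb u).2.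
have in0 : 0 \in `[- M, M] by rewrite in_itv/=; apply/andP; split; lra.
have E0 : E 0 0 = N x.
  by rewrite /E (_ : (0 +i* 0)%C = 0)// rmorph0 subr0.
case: m => u v; rewrite -/(E u v).
have [uM|uM] := boolP (u \in `[- M, M]); last first.
  apply: (le_trans (box 0 0 in0 in0)); rewrite E0.
  have := seminormB_le (c (u +i* v)%C) x.
  rewrite seminorm_scalar -[N (c _ - x)]seminormN opprB -/(E u v).
  have := le_Re_modulus (u +i* v)%C => /=.
  by move: uM; rewrite in_itv/= -ler_norml -ltNge /M; lra.
have [vM|vM] := boolP (v \in `[- M, M]); first exact: box.
apply: (le_trans (box 0 0 in0 in0)); rewrite E0.
have := seminormB_le (c (u +i* v)%C) x.
rewrite seminorm_scalar -[N (c _ - x)]seminormN opprB -/(E u v).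
have := le_Im_modulus (u +i* v)%C => /=.
by move: vM; rewrite in_itv/= -ler_norml -ltNge /M; lra.
Qed.

(* Ostrowski's argument: factoring [g^(2^k) - z^(2^k)] into linear factors shows
   that the set of minimizers is open. *)
Lemma seminorm_min_eq0 x l : (forall m, N (x - c l) <= N (x - c m)) ->
  N (x - c l) = 0.
Proof.
move=> lmin; apply/eqP; rewrite eq_le (asn_ge0 hN) andbT leNgt; apply/negP => r0.
set r := N (x - c l) in lmin r0 *.
have rle m : r <= N (x - c m) by exact: lmin.
have NX y n : N (y ^+ n) = N y ^+ n.
  elim: n => [|n ih]; first by rewrite !expr0 (asn_one hN).
  by rewrite !exprS NM ih.
(* Minimizers are stable under translation by [r / 2]; any translation shorter than [r] would make
   the ratio of powers below tend to 0. *)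
have step m : N (x - c m) = r -> N (x - c (m + (r / 2)%:C%C)) = r.
  move=> hm; set z := (r / 2)%:C%C; set g := x - c m.
  have gz : x - c (m + z) = g - c z by rewrite rmorphD /g; ring.
  have gle w : r <= N (g - c w).
    by have := rle (m + w); rewrite rmorphD opprD addrA.
  (* Every complex number is a square, so [g^(2^(j+1)) - w] splits into two factors of the same kind
     at level [j]. *)
  have hpow j : forall w, r ^+ (2 ^ j) <= N (g ^+ (2 ^ j) - c w).
    elim: j => [|j ih] w; first by rewrite expn0 !expr1.
    have -> : g ^+ (2 ^ j.+1) - c w =
        (g ^+ (2 ^ j) - c (sqrtC w)) * (g ^+ (2 ^ j) - c (- sqrtC w)).
      rewrite expnSr exprM -{1}[w]sqrtCK rmorphXn rmorphN; ring.
    by rewrite NM expnSr exprM expr2 ler_pM ?exprn_ge0 ?(ltW r0).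
  (* Each squaring splits off the cofactor [g^(2^k) + z^(2^k)], on which [hpow] gives the lower
     bound [r^(2^k)]. *)
  have hz k : N (g - c z) * r ^+ (2 ^ k) <= r * N (g ^+ (2 ^ k) - c (z ^+ (2 ^ k))).
    elim: k => [|k ih]; first by rewrite expn0 !expr1 mulrC.
    have -> : g ^+ (2 ^ k.+1) - c (z ^+ (2 ^ k.+1)) =
        (g ^+ (2 ^ k) - c (z ^+ (2 ^ k))) * (g ^+ (2 ^ k) - c (- z ^+ (2 ^ k))).
      by rewrite expnSr !exprM (rmorphXn _ 2) rmorphN; ring.
    rewrite NM mulrA expnSr exprM expr2 mulrA.
    by rewrite ler_pM ?mulr_ge0 ?(asn_ge0 hN) ?exprn_ge0 ?(ltW r0).
  apply/eqP; rewrite eq_le rle andbT; apply/ler_addgt0Pr => e e0.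
  have [||n hn] := @expr_eventually_dom R (r / e) (2^-1) 1; [by []|lra|].
  have := hz n; rewrite gz => h.
  have pn : (n <= 2 ^ n)%N by exact/ltnW/ltn_expl.
  have h1 : N (g ^+ (2 ^ n) - c (z ^+ (2 ^ n))) <= r ^+ (2 ^ n) + (r / 2) ^+ (2 ^ n).
    apply: le_trans (asn_add hN _ _) _; rewrite seminormN NX hm lerD2l.
    rewrite rmorphXn NX seminorm_scalar modulus_real ger0_norm//.
    by rewrite divr_ge0// ltW.
  have h2 : N (g - c z) * r ^+ (2 ^ n) <= (r + r * 2^-1 ^+ (2 ^ n)) * r ^+ (2 ^ n).
    apply: (le_trans h); rewrite mulrDl -mulrA.
    rewrite [2^-1 ^+ _ * _]mulrC -exprMn -mulrDr ler_wpM2l// ltW//.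
  rewrite ler_pM2r ?exprn_gt0// in h2; apply: (le_trans h2); rewrite lerD2l.
  have := hn _ pn; rewrite expr1n mulrAC ler_pdivrMr// mul1r; exact.
have hk k : N (x - c (l + k%:R * (r / 2)%:C%C)) = r.
  elim: k => [|k ih]; first by rewrite mul0r addr0.
  by rewrite -natr1 mulrDl mul1r addrA step.
(* Five steps travel [5 r / 2], whereas two minimizers are at distance at most [2 r]. *)
have := seminormB_le (c (5%:R * (r / 2)%:C%C)) (x - c l).
have -> : c (5%:R * (r / 2)%:C%C) - (x - c l) = - (x - c (l + 5%:R * (r / 2)%:C%C)).
  by rewrite (rmorphD c l); ring.
rewrite seminormN hk seminorm_scalar -/r.
have -> : 5%:R * (r / 2)%:C%C = (5 * (r / 2))%:C%C.
  by rewrite -(rmorph_nat (real_complex R) 5) -rmorphM.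
rewrite modulus_real ger0_norm ?mulr_ge0 ?divr_ge0 ?(ltW r0)//; lra.
Qed.

End Ostrowski.

(** [x f] is the scalar [l] with [N (f - c l) = 0], unique because [N (c l)] is the modulus of [l].
    The ring laws follow since the corresponding differences have seminorm 0. *)
Theorem exists_ring_character : exists x : K -> R[i],
  [/\ x 1 = 1, forall f g, x (f + g) = x f + x g,
      forall f g, x (f * g) = x f * x g & forall l, x (c l) = l].
Proof.
have [N hN Nmin] := minimal_seminorm; have NM := minimal_seminorm_mul hN Nmin.
have ex f : exists l, N (f - c l) = 0.
  have [l hl] := seminorm_attained hN NM f; exists l.
  exact: (seminorm_min_eq0 hN NM hl).
have [x hx] := choice ex.
have uniq f l : N (f - c l) = 0 -> x f = l.
  move=> hl; apply/eqP; rewrite -subr_eq0; apply/eqP/modulus_eq0.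
  rewrite -(seminorm_scalar hN NM); apply/eqP; rewrite eq_le (asn_ge0 hN) andbT.
  have -> : c (x f - l) = (f - c l) + - (f - c (x f)) by rewrite rmorphB; ring.
  by apply: le_trans (asn_add hN _ _) _; rewrite (seminormN hN NM) hl hx addr0.
have uniq0 f l : N (f - c l) <= 0 -> x f = l.
  by move=> h; apply: uniq; apply/eqP; rewrite eq_le h (asn_ge0 hN).
have xc l : x (c l) = l.
  apply: uniq; rewrite subrr -(rmorph0 c) (seminorm_scalar hN NM).
  by rewrite (_ : 0 = 0%:C%C)// modulus_real normr0.
exists x; split=> //.
- by rewrite -(rmorph1 c) xc.
- move=> f g; apply: uniq0.
  have -> : f + g - c (x f + x g) = (f - c (x f)) + (g - c (x g)).
    by rewrite rmorphD; ring.
  by apply: le_trans (asn_add hN _ _) _; rewrite !hx addr0.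
- move=> f g; apply: uniq0.
  have -> : f * g - c (x f * x g) = (f - c (x f)) * g + c (x f) * (g - c (x g)).
    by rewrite rmorphM; ring.
  by apply: le_trans (asn_add hN _ _) _; rewrite !NM !hx mul0r mulr0 addr0.
Qed.

End SeminormCharacter.

(** * Operator norms and characters of an operator algebra *)

Section OperatorAlgebra.
Variables (R : realType) (B : completeNormedModType R[i]).
Implicit Types (T : B -> B) (v w : B).

Lemma rnormE v : `|v| = (rnorm v)%:C%C.
Proof. by rewrite /rnorm RRe_real// normr_real. Qed.

Lemma rnorm_ge0 v : 0 <= rnorm v.
Proof. by rewrite -lecR -rnormE normr_ge0. Qed.

Lemma rnormZ l v : rnorm (l *: v) = modulus l * rnorm v.
Proof. by apply: complexI; rewrite -rnormE normrZ modulusE rnormE rmorphM. Qed.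

Lemma rnormD v w : rnorm (v + w) <= rnorm v + rnorm w.
Proof. by rewrite -lecR rmorphD /= -!rnormE ler_normD. Qed.

Lemma rnorm0 : rnorm (0 : B) = 0.
Proof. by rewrite /rnorm normr0. Qed.

Lemma rnorm_eq0 v : rnorm v = 0 -> v = 0.
Proof. by move=> h; apply/eqP; rewrite -normr_eq0 rnormE h. Qed.

Lemma linear_op0 T : linear T -> T 0 = 0.
Proof.
by move=> Tlin; have := Tlin (-1) 0 0; rewrite scaleN1r oppr0 addr0 scaleN1r addNr.
Qed.

Lemma linear_opZ T l v : linear T -> T (l *: v) = l *: T v.
Proof.
move=> Tlin; have h : T (l *: v + 0) = l *: T v + T 0 := Tlin l v 0.
by move: h; rewrite addr0 (linear_op0 Tlin) addr0.
Qed.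

Lemma bounded_op_bound T : bounded_op T ->
  exists2 M : R, 0 <= M & forall v, rnorm (T v) <= M * rnorm v.
Proof.
move=> [Tlin Tcont].
have T0 := linear_op0 Tlin.
have TZ l w := linear_opZ l w Tlin.
have T0c : T x @[x --> (0 : B)] --> (0 : B).
  exact: (eq_rect _ (fun y : B => T x @[x --> (0 : B)] --> y) (Tcont (0 : B)) _ T0).
have /cvgrPdist_lt /(_ 1 ltr01) := T0c.
move=> /nbhs_ballP[d /= d0 hd].
have dE : d = (complex.Re d)%:C%C by rewrite RRe_real// gtr0_real.
have d0' : 0 < complex.Re d by rewrite -ltcR -dE.
set e := complex.Re d in dE d0'.
exists (2 / e); first by rewrite divr_ge0// ltW.
move=> v; have [->|v0] := eqVneq v 0; first by rewrite T0 rnorm0 mulr0.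
have rv : 0 < rnorm v.
  by rewrite lt_def rnorm_ge0 andbT; apply: contraNneq v0 => /rnorm_eq0 ->.
pose s := (e / 2 / rnorm v)%:C%C : R[i].
have ms : modulus s = e / 2 / rnorm v.
  by rewrite modulus_real ger0_norm// !divr_ge0// ltW.
have /hd : ball (0 : B) d (s *: v).
  rewrite -ball_normE /ball_/= sub0r normrN rnormE dE ltcR rnormZ ms.
  by rewrite divfK ?gt_eqF// ltr_pdivrMr// ltr_pMr// ltr1n.
rewrite /= sub0r normrN rnormE -[1]/(1%:C%C) ltcR TZ rnormZ ms => h.
have : rnorm (T v) * e < 2 * rnorm v.
  have := ltr_pM2r (mulr_gt0 (ltr0n R 2) rv) (e / 2 / rnorm v * rnorm (T v)) 1.
  rewrite h mul1r => /idP.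
  have -> : e / 2 / rnorm v * rnorm (T v) * (2 * rnorm v) = rnorm (T v) * e.
    by field; rewrite gt_eqF.
  by [].
by rewrite -ltr_pdivlMr// => /ltW; rewrite mulrAC.
Qed.

Lemma opnorm_has_sup T : bounded_op T ->
  has_sup [set rnorm (T v) | v in [set v | rnorm v <= 1]].
Proof.
move=> /bounded_op_bound[M M0 hM]; split.
  by exists (rnorm (T 0)), 0 => //=; rewrite rnorm0.
exists M => _ [v /= v1 <-]; apply: (le_trans (hM v)).
by rewrite -[leRHS]mulr1 ler_wpM2l.
Qed.

Lemma opnorm_ge0 T : bounded_op T -> 0 <= opnorm T.
Proof.
move=> hT; apply: le_trans (rnorm_ge0 (T 0)) _; apply: ub_le_sup.
  exact: (opnorm_has_sup hT).2.
by exists 0 => //=; rewrite rnorm0.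
Qed.

Lemma le_opnorm T v : bounded_op T -> rnorm (T v) <= opnorm T * rnorm v.
Proof.
move=> hT; have [Tlin _] := hT.
have T0 := linear_op0 Tlin.
have TZ l w := linear_opZ l w Tlin.
have [->|v0] := eqVneq v 0; first by rewrite T0 rnorm0 mulr0.
have rv : 0 < rnorm v.
  by rewrite lt_def rnorm_ge0 andbT; apply: contraNneq v0 => /rnorm_eq0 ->.
rewrite -ler_pdivrMr//; apply: ub_le_sup; first exact: (opnorm_has_sup hT).2.
have mi : modulus (rnorm v)^-1%:C%C = (rnorm v)^-1.
  by rewrite modulus_real ger0_norm// invr_ge0 ltW.
exists ((rnorm v)^-1%:C%C *: v) => /=; first by rewrite rnormZ mi mulVf// gt_eqF.
by rewrite TZ rnormZ mi mulrC.
Qed.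

Lemma opnorm_le T (M : R) : 0 <= M -> (forall v, rnorm (T v) <= M * rnorm v) ->
  opnorm T <= M.
Proof.
move=> M0 hM; apply: ge_sup; first by exists (rnorm (T 0)), 0 => //=; rewrite rnorm0.
move=> _ [v /= v1 <-]; apply: (le_trans (hM v)).
by rewrite -[leRHS]mulr1 ler_wpM2l.
Qed.

Lemma opnorm_id : (exists v : B, v != 0) -> opnorm (idfun : B -> B) = 1.
Proof.
move=> [v v0]; have hid : bounded_op (idfun : B -> B).
  by split=> // x; exact: cvg_id.
apply/eqP; rewrite eq_le opnorm_le ?ler01//=; last by move=> w; rewrite mul1r.
have rv : 0 < rnorm v.
  by rewrite lt_def rnorm_ge0 andbT; apply: contraNneq v0 => /rnorm_eq0 ->.
by rewrite -(ler_pM2r rv) mul1r; exact: (le_opnorm v hid).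
Qed.

(** The algebra is repackaged as a commutative ring on a subtype, with [opnorm] as the initial
    seminorm. A nonzero vector of [B] gives [1 != 0] there, and the resulting character is extended
    by 0. *)
Theorem exists_character (BB : set (B -> B)) : (exists v : B, v != 0) ->
  banach_subalgebra BB -> commutative_subalgebra BB ->
  exists x : (B -> B) -> R[i], character BB x.
Proof.
move=> B0 hBB BBcomm.
pose V := {phi : B -> B | phi \in BB}.
have VP (f : V) : BB (val f) := set_mem (valP f).
have Vb (f : V) : bounded_op (val f) := bsub_op hBB (VP f).
pose mk phi (h : BB phi) : V := exist _ phi (mem_set h).
have veq (f g : V) : val f =1 val g -> f = g.
  by move=> h; apply/val_inj/funext.
have sc0 (phi : B -> B) : (0 : R[i]) \*: phi = fun=> 0.
  by apply/funext => v /=; rewrite scale0r.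
have h0 : BB (fun=> 0) by rewrite -(sc0 idfun); exact: (bsub_scale hBB _ (bsub_id hBB)).
pose zero : V := mk _ h0.
pose opp (f : V) : V := mk _ (bsub_scale hBB (-1) (VP f)).
pose add (f g : V) : V := mk _ (bsub_add hBB (VP f) (VP g)).
pose one : V := mk _ (bsub_id hBB).
pose mul (f g : V) : V := mk _ (bsub_comp hBB (VP f) (VP g)).
have addA : associative add by move=> f g h; apply: veq => v /=; rewrite addrA.
have addC : commutative add by move=> f g; apply: veq => v /=; rewrite addrC.
have add0 : left_id zero add by move=> f; apply: veq => v /=; rewrite add0r.
have addN : left_inverse zero opp add.
  by move=> f; apply: veq => v /=; rewrite scaleN1r addNr.
have mulA : associative mul by move=> f g h; exact: veq.
have mulC : commutative mul.
  by move=> f g; apply: val_inj; exact: (BBcomm _ _ (VP f) (VP g)).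
have mul1 : left_id one mul by move=> f; exact: veq.
have mulD : left_distributive mul add by move=> f g h; exact: veq.
have one0 : one != zero.
  have [v v0] := B0; apply: contraNneq v0 => /(congr1 val) h.
  by have := congr1 (@^~ v) h => /= ->.
pose zm := GRing.isZmodule.Build V addA addC add0 addN.
pose Z : zmodType := HB.pack V zm.
pose rm := GRing.Zmodule_isComNzRing.Build Z mulA mulC mul1 mulD one0.
pose K : comNzRingType := HB.pack V zm rm.
pose c (l : R[i]) : K := mk _ (bsub_scale hBB l (bsub_id hBB)).
have cB l m : c (l - m) = c l - c m.
  by apply: veq => v /=; rewrite scalerBl scaleN1r.
have cM : c 1 = 1 /\ {morph c : l m / l * m}.
  by split=> [|l m]; apply: veq => v /=; rewrite ?scale1r// scalerA.
pose ca := GRing.isZmodMorphism.Build R[i] K c cB.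
pose cm := GRing.isMonoidMorphism.Build R[i] K c cM.
pose cr : {rmorphism R[i] -> K} := HB.pack c ca cm.
have [x [x1 xD xM xc]] : exists x : K -> R[i],
    [/\ x 1 = 1, forall f g, x (f + g) = x f + x g,
        forall f g, x (f * g) = x f * x g & forall l, x (cr l) = l].
  apply: (@exists_ring_character R K cr (fun f => opnorm (val f))).
  - by move=> f; exact: opnorm_ge0.
  - move=> f g; apply: opnorm_le => [|v]; first by rewrite addr_ge0 ?opnorm_ge0.
    by rewrite mulrDl (le_trans (rnormD _ _))// lerD ?le_opnorm.
  - move=> f g; apply: opnorm_le => [|v]; first by rewrite mulr_ge0 ?opnorm_ge0.
    rewrite -mulrA (le_trans (le_opnorm _ (Vb f)))//.
    by rewrite ler_wpM2l ?opnorm_ge0// le_opnorm.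
  - exact: opnorm_id.
  - move=> l; apply: opnorm_le => [|v]; first exact: modulus_ge0.
    by rewrite /= rnormZ.
pose y (phi : B -> B) : R[i] :=
  if pselect (BB phi) is left h then x (mk phi h) else 0.
have yE (f : K) : y (val f) = x f.
  rewrite /y; case: pselect => [h|/(_ (VP f))//].
  by congr x; exact: val_inj.
exists y; split.
- by rewrite -x1 -(yE 1).
- move=> phi psi hphi hpsi.
  by rewrite -[phi]/(val (mk _ hphi : K)) -[psi]/(val (mk _ hpsi : K)) !yE -xD -yE.
- move=> l phi hphi; rewrite -[phi]/(val (mk _ hphi : K)) yE -{2}(xc l) -xM -yE.
  by congr y; apply/funext.
- move=> phi psi hphi hpsi.
  by rewrite -[phi]/(val (mk _ hphi : K)) -[psi]/(val (mk _ hpsi : K)) !yE -xM -yE.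
- by move=> phi h; rewrite /y; case: pselect.
Qed.

End OperatorAlgebra.

(** * The variational principle *)

Section VariationalPrinciple.
Variables (R : realType) (X : Type) (C : set (X -> R)).
Hypothesis hC : functional_base_algebra C.
Variables (a : X -> X) (A : (X -> R) -> (X -> R)).
Hypothesis C_dyn : forall f, C f -> C (f \o a).
Hypothesis hA : transfer_operator C a A.
Variables (v : X -> R) (p : R).
Hypothesis Cv : C v.
Hypothesis v0 : forall x, 0 <= v x.
Hypothesis p0 : 0 < p.
Variable x0 : X.

Let b n := supnorm (iter n (weighted_transfer A v p) (fun=> 1)).

Let value mu := (ln_integral C mu v + tau C A mu * (p^-1)%:E)%E.

(** The upper bound for the constant weight 1, with [n = 1] and [L = 0], as [ln (max 1 e) >= 0]. It
    excludes [tau = +oo], so that [tau] can be moved across an inequality. *)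
Lemma tau_lty mu : invariant_states C a mu -> (tau C A mu < +oo)%E.
Proof.
move=> hmu; have hs := hmu.1.
pose c := supnorm (iter 1 (weighted_transfer A (fun=> 1) 1) (fun=> 1)).
have h := @tau_le R X C hC a A C_dyn hA (fun=> 1) 1 (fba_cst hC 1) (fun=> ler01)
  ltr01 x0 mu 0 (`|c| + 1) 1 hmu.
apply: le_lt_trans (ltry (ln (`|c| + 1) - 0)); apply: h => //.
- move=> e e0; rewrite mul1r; apply: (state_ge_cst hC hs).
    by apply: (fba_ln_max hC) => //; exact: fba_cst.
  by move=> x; rewrite ln_ge0// le_max lexx.
- by rewrite expr1 -/c (le_lt_trans (ler_norm c))// ltrDl.
Qed.

Variable r : R.
Hypothesis r0 : 0 <= r.
Hypothesis rb : forall n, (0 < n)%N -> r ^+ n <= b n.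
Hypothesis br : forall c, r < c -> exists2 M, 0 < M & forall n, b n <= M * c ^+ n.

(** Two intermediate rates between [r] and [c]: passing to the larger absorbs the constant [M], and
    passing from it to [c] makes the inequality strict. *)
Lemma growth_lt (c : R) : r < c -> exists2 n, (0 < n)%N & b n < c ^+ n.
Proof.
move=> rc; have c0 : 0 < c := le_lt_trans r0 rc; have r0' := r0.
have [|M M0 hM] := br (c := (r + c) / 2); first by lra.
have [||n0 hn0] := @expr_eventually_dom R M ((r + c) / 2) ((r + 3 * c) / 4);
  [by rewrite divr_gt0 ?ltr_wpDl|by lra|].
exists n0.+1 => //; apply: le_lt_trans (hM _) _.
apply: le_lt_trans (hn0 _ (leqnSn _)) _.
by rewrite ltrXn2r//; lra.
Qed.

Lemma ln_integral_lty mu : states C mu -> (ln_integral C mu v < +oo)%E.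
Proof.
move=> hmu; rewrite (ln_integralE hC x0 hmu Cv v0).
by apply: le_lt_trans (ereal_inf_lbound _) (ltry _); exists 1 => //=.
Qed.

(** If the integral is [-oo], so is the value. Otherwise the integral [i] is the infimum over the
    truncations, and [L = p i] is admissible in [tau_le]. *)
Lemma value_le_ln mu (c : R) : invariant_states C a mu -> r < c ->
  (value mu <= (ln c / p)%:E)%E.
Proof.
move=> hmu rc; rewrite /value; have hs := hmu.1.
have := ln_integral_lty hs; case E : (ln_integral C mu v) => [i| |] // _; last first.
  by rewrite addNye leNye.
have [n n0 hn] := growth_lt rc; have c0 := le_lt_trans r0 rc.
have h : (tau C A mu <= (ln c - p * i)%:E)%E.
  apply: (tau_le hC C_dyn hA Cv v0 p0 x0 hmu _ n0 c0 hn) => e e0.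
  rewrite ler_pM2l// -lee_fin -E (ln_integralE hC x0 hs Cv v0).
  by apply: ereal_inf_lbound; exists e.
apply: (@le_trans _ _ (i%:E + (ln c - p * i)%:E * (p^-1)%:E)%E).
  by rewrite leeD2l// lee_wpmul2r// lee_fin invr_ge0 ltW.
rewrite -EFinM -EFinD lee_fin le_eqVlt; apply/orP; left; apply/eqP.
by field; rewrite gt_eqF.
Qed.

(** Let [c] decrease to [r]. For [r = 0] the bounds [ln c / p] take every real value, which forces
    [-oo]. *)
Lemma value_le mu : invariant_states C a mu ->
  (value mu <= lne (r `^ p^-1)%:E)%E.
Proof.
move=> hmu.
have h (y : R) : (r == 0) || (lne (r `^ p^-1)%:E < y%:E)%E ->
    (value mu <= y%:E)%E.
  move=> hy; have -> : y = ln (expR (p * y)) / p by rewrite expRK mulrAC divff ?mul1r ?gt_eqF.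
  apply: value_le_ln => //; case/predU1P: hy => [->|].
    exact: expR_gt0.
  have [->|rn0] := eqVneq r 0; first by rewrite expR_gt0.
  have r1 : 0 < r by rewrite lt_def rn0.
  rewrite lne_EFin ?powR_gt0// lte_fin ln_powR => hy.
  by rewrite -ltr_ln ?posrE ?expR_gt0// expRK -ltr_pdivrMl.
have [r00|rn0] := eqVneq r 0.
  have hr y : (value mu <= y%:E)%E by apply: h; rewrite r00 eqxx.
  rewrite r00 powR0 ?invr_eq0 ?gt_eqF// le0_lneNy//.
  case: (value mu) hr => [y hy| /(_ 0)|//]; last by rewrite leye_eq.
  by have := hy (y - 1); rewrite lee_fin lerBrDl gerDr leNgt ltr01.
have r1 : 0 < r by rewrite lt_def rn0.
apply/lee_addgt0Pr => e e0; rewrite lne_EFin ?powR_gt0//.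
rewrite -EFinD; apply: h; apply/orP; right.
by rewrite lne_EFin ?powR_gt0// lte_fin ltrDl.
Qed.

Lemma le_ereal_real (x : R) (y : \bar R) :
  (forall s : R, (y <= s%:E)%E -> x <= s) -> (x%:E <= y)%E.
Proof.
case: y => [y| |] h; first by rewrite lee_fin h.
  by rewrite leey.
by have := h (x - 1) (leNye _); rewrite lerBrDl gerDr leNgt ltr01.
Qed.

Theorem variational_principle :
  [set value mu | mu in invariant_states C a] (lne (r `^ p^-1)%:E) /\
  ubound [set value mu | mu in invariant_states C a] (lne (r `^ p^-1)%:E).
Proof.
split; last by move=> _ [mu hmu <-]; exact: value_le.
have [r00|rn0] := eqVneq r 0.
  have [mu hmu] := exists_invariant_state hC C_dyn x0.
  exists mu => //; apply/eqP; rewrite eq_le value_le// andTb.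
  by rewrite r00 powR0 ?invr_eq0 ?gt_eqF// le0_lneNy// leNye.
have r1 : 0 < r by rewrite lt_def rn0.
have [mu hmu hr] := variational_lower hC C_dyn hA Cv v0 p0 x0 r1 rb br.
exists mu => //; apply/eqP; rewrite eq_le value_le// andTb.
pose m e := mu (fun x => ln (Num.max (v x) e)).
(* One inequality for each [e], uniform in [N] and in the partition, so both infima defining [tau]
   can be taken. *)
have tge e : 0 < e -> ((ln r - p * m e)%:E <= tau C A mu)%E.
  move=> e0; apply: le_ereal_inf_tmp => _ [N /= N0 <-].
  have N0' : 0 < N%:R :> R by rewrite ltr0n.
  have : ((N%:R * (ln r - p * m e))%:E <= tau_n C A mu N)%E.
    apply: le_ereal_inf_tmp => _ [D hD <-]; apply: le_ereal_real => s hs.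
    rewrite mulrC -ler_pdivlMr// lerBlDl; exact: (hr N D s e N0 hD e0 hs).
  move=> h; have -> : ln r - p * m e = N%:R * (ln r - p * m e) / N%:R.
    by rewrite mulrAC divff ?mul1r ?gt_eqF.
  by rewrite EFinM lee_wpmul2r// lee_fin invr_ge0 ltW.
have := tau_lty hmu; case E : (tau C A mu) => [t| |] // _; last first.
  by have := tge 1 ltr01; rewrite E leeNy_eq.
(* With [tau] finite the inequality can be solved for [m e], and the integral is the infimum of the
   [m e]. *)
have hI : (((ln r - t) / p)%:E <= ln_integral C mu v)%E.
  rewrite (ln_integralE hC x0 hmu.1 Cv v0).
  apply: le_ereal_inf_tmp => _ [e /= e0 <-]; rewrite lee_fin ler_pdivrMr//.
  by have := tge e e0; rewrite E lee_fin -/(m e) [m e * p]mulrC; lra.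
rewrite lne_EFin ?powR_gt0// ln_powR /value E.
have -> : p^-1 * ln r = (ln r - t) / p + t / p by field; rewrite gt_eqF.
by rewrite EFinD EFinM leeD2r.
Qed.

End VariationalPrinciple.

(** * Application to the weighted shift operator *)

(** [C] is given only the real parts, and the imaginary part of [psi] is, up to sign, the real part
    of [i psi]; then [|psi|] is the root of a sum of two squares. *)
Lemma fba_gelfand_abs (R : realType) (B : completeNormedModType R[i])
  (BB : set (B -> B)) (C : set (max_space BB -> R)) (psi : B -> B) :
  banach_subalgebra BB -> functional_base_algebra C ->
  (forall phi, BB phi -> C (fun x => complex.Re (gelfand phi x))) ->
  BB psi -> C (gelfand_abs psi).
Proof.
move=> hBB hC C_Re hpsi; have Ci := C_Re _ (bsub_scale hBB 'i%C hpsi).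
have -> : gelfand_abs psi = (fun x : max_space BB =>
    Num.sqrt (complex.Re (gelfand psi x) * complex.Re (gelfand psi x) +
      complex.Re (gelfand ('i%C \*: psi) x) *
      complex.Re (gelfand ('i%C \*: psi) x))).
  apply/funext => x; rewrite /gelfand_abs normc_def /=.
  have [_ _ xZ _ _] : character BB (set_val x) := set_mem (valP x).
  rewrite [gelfand (_ \*: _) x]xZ// -[set_val x psi]/(gelfand psi x).
  by case: (gelfand psi x) => u w /=; congr Num.sqrt; ring.
apply: (fba_sqrt hC) => [|x]; last by rewrite -!expr2 addr_ge0// sqr_ge0.
by apply: (fba_add hC); apply: (fba_mul hC) => //; exact: C_Re.
Qed.

(** The roots lie above [r], so only an upper estimate is needed; it comes from inverting the power
    [1/p] at [r^(1/p) + e]. *)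
Lemma spectral_radius_rate (R : realType) (B : completeNormedModType R[i])
  (S : B -> B) (b : nat -> R) (p r : R) : 0 < p -> 0 <= r ->
  (forall n, 0 <= b n) -> (forall n, (0 < n)%N -> r ^+ n <= b n) ->
  (forall n, (0 < n)%N -> opnorm (iter n S) = b n `^ p^-1) ->
  (fun n => b n `^ n%:R^-1) @ \oo --> r -> spectral_radius S = r `^ p^-1.
Proof.
move=> p0 r0 b0 rb hb hr; apply/cvg_lim => //.
have : (b n `^ n%:R^-1) `^ p^-1 @[n --> \oo] --> r `^ p^-1.
  apply/cvgrPdist_lt => e e0.
  have q0 : 0 < r `^ p^-1 + e by rewrite ltr_wpDl ?powR_ge0.
  pose d := (r `^ p^-1 + e) `^ p.
  have dK : d `^ p^-1 = r `^ p^-1 + e by rewrite -powRrM mulfV ?powRr1 ?gt_eqF ?(ltW q0).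
  have rd : r < d.
    have -> : r = (r `^ p^-1) `^ p by rewrite -powRrM mulVf ?powRr1 ?gt_eqF.
    by rewrite gt0_ltr_powR ?nnegrE ?powR_ge0 ?(ltW q0)// ltrDl.
  have hd : \forall n \near \oo, b n `^ n%:R^-1 < d by exact: cvgr_lt hr _ rd.
  near=> n.
  have n0 : (0 < n)%N by near: n; exists 1%N.
  rewrite distrC ger0_norm.
    rewrite ltrBlDl -dK gt0_ltr_powR ?invr_gt0 ?nnegrE ?powR_ge0//.
    by near: n.
  rewrite subr_ge0 ge0_ler_powR ?invr_ge0 ?(ltW p0) ?nnegrE ?powR_ge0//.
  by rewrite powR_root_ge// rb.
apply: cvg_trans; apply: near_eq_cvg; near=> n.
rewrite hb; last by near: n; exists 1%N.
by rewrite -!powRrM mulrC.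
Unshelve. all: by end_near.
Qed.

Theorem theorem13p6 (R : realType) (B : completeNormedModType R[i])
  (B_nonzero : exists v : B, v != 0)
  (BB : set (B -> B)) (hBB : banach_subalgebra BB)
  (BBcomm : commutative_subalgebra BB) (BBss : semisimple BB)
  (delta : (B -> B) -> (B -> B)) (hdelta : endomorphism BB delta)
  (delta1 : delta idfun = idfun)
  (C : set (max_space BB -> R)) (hC : functional_base_algebra C)
  (C_Re : forall phi, BB phi -> C (fun x => complex.Re (gelfand phi x)))
  (C_dyn : forall f, C f -> C (f \o alpha hBB hdelta delta1))
  (A : (max_space BB -> R) -> (max_space BB -> R))
  (hA : transfer_operator C (alpha hBB hdelta delta1) A)
  (p : R) (hp : 1 <= p)
  (T : B -> B) (hT : bounded_op T) (psi : B -> B) (hpsi : BB psi)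
  (hnorm : forall n : nat, (0 < n)%N ->
     opnorm (iter n (psi \o T)) =
     supnorm (iter n (fun f => A (fun x => gelfand_abs psi x `^ p * f x))
                     (fun=> 1)) `^ p^-1) :
  let value mu := (ln_integral C mu (@gelfand_abs R B BB psi)
                   + tau C A mu * (p^-1)%:E)%E in
  [set value mu | mu in invariant_states C (alpha hBB hdelta delta1)]
    (lne (spectral_radius (psi \o T))%:E) /\
  ubound [set value mu | mu in invariant_states C (alpha hBB hdelta delta1)]
    (lne (spectral_radius (psi \o T))%:E).
Proof.
have [y hy] := exists_character B_nonzero hBB BBcomm.
pose x0 : max_space BB := exist (fun y => y \in characters BB) y (mem_set hy).
have Cv := fba_gelfand_abs hBB hC C_Re hpsi.
pose v : max_space BB -> R := gelfand_abs psi.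
have v0 x : 0 <= v x by rewrite /v /gelfand_abs normc_def /= sqrtr_ge0.
have p0 : 0 < p := lt_le_trans ltr01 hp.
have hP : positive_operator C (weighted_transfer A v p).
  apply: (posop_mul hC (transfer_posop hA)) => [|x]; last exact: powR_ge0.
  exact: (fba_powR hC).
pose b n := supnorm (iter n (weighted_transfer A v p) (fun=> 1)).
have b0 n : 0 <= b n.
  by apply: (supnorm_ge0 hC x0); apply: (posop_sub (posop_iter n hP)); exact: fba_cst.
have bM m n : b (m + n)%N <= b m * b n := posop_supnorm_submul hC x0 m n hP.
have [r r0 [cvgr rb br]] := submul_rate b0 bM.
have -> : spectral_radius (psi \o T) = r `^ p^-1.
  exact: (spectral_radius_rate p0 r0 b0 rb hnorm cvgr).
exact: (variational_principle hC C_dyn hA Cv v0 p0 x0 r0 rb br).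
Qed.
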